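(* Let $X$ be a compact metric space, let $g_1,\dots,g_k:X\to X$ be continuous, surjective, Ruelle expanding and jointly topologically mixing, and let $\varphi:X\to\mathbb R$ be Hölder continuous. With the objects defined in the context, the following hold. (1) $(\mathcal W^*,d_{\mathcal W^*})$ and $(\mathbb G,d_{\mathbb G})$ are discrete metric spaces. (2) The map $\mathcal W^*\to\mathbb G$, $w\mapsto(T_w,\varphi_w)$, is Hölder continuous. (3) A sequence $((h_n,\psi_n))_n$ in $\mathbb G$ is a Cauchy sequence if and only if $\kappa(h_n)\to\infty$ and $(\mu_{h_n,\psi_n})_n$ converges in the weak$^*$ topology. Moreover, two Cauchy sequences have the same limit if and only if their sequences of equilibrium states have the same limit. (4) Let $\partial\mathbb G$ be the boundary of the completion of $\mathbb G$ with respect to $d_{\mathbb G}$, identified with limits of Cauchy sequences $((h_n,\psi_n))_n$ in $\mathbb G$. Then the map $$\partial\mathbb G\to\{\mu_{\sigma,\omega}:\sigma\in\Sigma^-,\ \omega\in\Sigma\},\qquad ((h_n,\psi_n))_n\mapsto\lim_{n\to\infty}\mu_{h_n,\psi_n}$$ is Lipschitz continuous and onto.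
   Context: Setting. A map $T:X\to X$ is $(a,\lambda)$-Ruelle-expanding ($a>0$, $\lambda\in(0,1)$) if for all $x,y,\tilde x\in X$ with $d(x,y)<a$ and $T(\tilde x)=x$ there is a unique $\tilde y\in X$ with $T(\tilde y)=y$ and $d(\tilde x,\tilde y)<a$, and this $\tilde y$ satisfies $d(\tilde x,\tilde y)\le\lambda d(x,y)$; all $g_i$ are $(a,\lambda)$-Ruelle-expanding for common $a,\lambda$. Let $\mathcal W=\{1,\dots,k\}$, $\mathcal W^*$ the set of finite words over $\mathcal W$. For $w=i_1\cdots i_n$, $|w|=n$, $T_w=g_{i_n}\circ\cdots\circ g_{i_1}$ and $\varphi_w=\varphi+\varphi\circ T_{i_1}+\cdots+\varphi\circ T_{i_1\cdots i_{n-1}}$. The maps are jointly topologically mixing if for all nonempty open $U,V\subset X$ there is $m$ with $T_w^{-1}(U)\cap V\ne\emptyset$ for all words $w$ with $|w|\ge m$. $\varphi$ is $\alpha$-Hölder, $\alpha\in(0,1]$, with Hölder constant $D_\alpha(\varphi)$. Semigroup $\mathbb G$. $\mathbb G$ is the semigroup generated by $(g_1,\varphi),\dots,(g_k,\varphi)$ under the product $(g,\psi)\ast(g',\psi')=(g\circ g',\psi'+\psi\circ g')$; thus $\mathbb G$ consists of the pairs $(T_w,\varphi_w)$ with $w$ a nonempty finite word (different words may give the same element). Measures. $L_v(f)(x)=\sum_{T_v(y)=x}e^{\varphi_v(y)}f(y)$, $\mathbb P_u^v(f)=L_v(f\,L_u(\mathbf 1))/L_{uv}(\mathbf 1)$,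 with dual $(\mathbb P_u^v)^*$ on Borel probability measures. $\Sigma$ is the set of infinite words $\omega=i_1i_2\cdots$ with $[\omega]_l=i_1\cdots i_l$, $\Sigma^-$ the set of left-infinite words $\sigma=\cdots j_2j_1$ with ${}_k[\sigma]=j_k\cdots j_1$, and $\mu_{\sigma,\omega}=\lim_{k,l\to\infty}(\mathbb P_{{}_k[\sigma]}^{[\omega]_l})^*(\nu)$ (which exists and is independent of the probability measure $\nu$). For $(g,\psi)\in\mathbb G$, $\mu_{g,\psi}$ is the unique equilibrium state of the map $g$ and potential $\psi$; if $(g,\psi)=(T_w,\varphi_w)$ then $\mu_{g,\psi}=\mu_{\underline w,\overline w}$ where $\overline w=ww\cdots\in\Sigma$, $\underline w=\cdots ww\in\Sigma^-$. Metrics. For distinct $v=v_1\cdots v_m$, $w=w_1\cdots w_n$ in $\mathcal W^*$, $d_{\mathcal W^*}(v,w)=2^{-\min\{k:\,v_k\ne w_k\text{ or }k>\min\{m,n\}\}}+2^{-\min\{k:\,v_{m+1-k}\ne w_{n+1-k}\text{ or }k>\min\{m,n\}\}}$, and $d_{\mathcal W^*}(v,v)=0$. Let $C_\varphi=D_\alpha(\varphi)/(1-\lambda^\alpha)$, $\Delta=\max\{4C_\varphi,a^{-\alpha}\}$, $d^*(x,y)=\min\{1,\Delta d(x,y)^\alpha\}$, and $\overline W(\mu,\nu)=\inf_P\int d^*\,dP$ over couplings $P$ of $\mu,\nu$; the set of probability measures is metrised by $\overline W$. For a map $g$, $\kappa(g)=\lim_{\epsilon\to0}\inf\{d(g(x),g(y))/d(x,y):0<d(x,y)<\epsilon\}$.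 For distinct elements of $\mathbb G$, $d_{\mathbb G}((g,\psi_1),(h,\psi_2))=\overline W(\mu_{g,\psi_1},\mu_{h,\psi_2})+\frac1{\kappa(g)}+\frac1{\kappa(h)}$, and $d_{\mathbb G}=0$ for equal elements. Limits of Cauchy sequences in $\mathbb G$ are taken in the completion of $\mathbb G$ with respect to $d_{\mathbb G}$.
   Formalization: Assumes κ(T_w) finite for every nonempty word w (else d_G is not a metric or (4) fails); (3) is stated for Cauchy sequences that are not eventually constant (constant ones are counterexamples); (2) is for nonempty words, as the empty word need not give an element of G. *)

(* Defs.v *)
From HB Require Import structures.
From mathcomp Require Import all_boot all_order all_algebra.
From mathcomp Require Import all_classical all_reals all_analysis.

Set Implicit Arguments.
Unset Strict Implicit.
Unset Printing Implicit Defensive.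

Import Order.TTheory GRing.Theory Num.Theory.
Import numFieldNormedType.Exports.

Local Open Scope classical_set_scope.
Local Open Scope ring_scope.

(* The library's measurable types are pointed, hence so are our metric spaces;
   the point only serves as a default value. *)
#[short(type="pmetricType")]
HB.structure Definition PointedMetric (K : numDomainType) :=
  { M of Metric K M & Pointed M }.

Notation borel X := (g_sigma_algebraType (@open X)).

Section metric_on_a_set.
Context {R : realType} {T : Type}.
Implicit Types (A : set T) (d : T -> T -> R) (u v : nat -> T).

Definition is_metric_on A d : Prop :=
  [/\ forall x y, A x -> A y -> 0 <= d x y,
      forall x y, A x -> A y -> (d x y = 0 <-> x = y),
      forall x y, A x -> A y -> d x y = d y x &
      forall x y z, A x -> A y -> A z -> d x z <= d x y + d y z].

(* Every point is isolated. *)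
Definition is_discrete_on A d : Prop :=
  forall x, A x -> exists2 e : R, 0 < e & forall y, A y -> d x y < e -> y = x.

Definition is_cauchy_in A d u : Prop :=
  (forall n, A (u n)) /\
  (forall e : R, 0 < e -> exists N, forall m n,
     (N <= m)%N -> (N <= n)%N -> d (u m) (u n) < e).

(* The completion of (A, d) consists of the classes of Cauchy sequences u, v
   modulo d (u n) (v n) --> 0; the class of u is the limit of u in it. *)
Definition limit_class A d u : set (nat -> T) :=
  [set v | is_cauchy_in A d v /\ d (u n) (v n) @[n --> \oo] --> (0 : R)].

Definition completion A d : set (set (nat -> T)) :=
  [set limit_class A d u | u in is_cauchy_in A d].

Definition completion_dist d (C D : set (nat -> T)) : R :=
  get [set r : R | exists u v,
    [/\ C u, D v & d (u n) (v n) @[n --> \oo] --> r]].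

Definition completion_boundary A d : set (set (nat -> T)) :=
  completion A d `\` [set limit_class A d (fun=> x) | x in A].

Definition eventually_constant u : Prop :=
  exists N, forall n, (N <= n)%N -> u n = u N.

End metric_on_a_set.

Section words.
Context {k : nat}.
Implicit Types v w : seq 'I_k.

(* min {j >= 1 : v_j <> w_j or j > min {|v|, |w|}}, letters counted from 1 *)
Definition first_diff v w : nat :=
  let m := minn (size v) (size w) in
  (find (fun j => (onth v j != onth w j) || (m <= j)%N) (iota 0 m.+1)).+1.

Definition word_dist (R : realType) v w : R :=
  if v == w then 0
  else 2^-1 ^+ first_diff v w + 2^-1 ^+ first_diff (rev v) (rev w).

(* [omega]_l = i_1 ... i_l, where omega n is the letter i_{n+1} *)
Definition prefix_word (omega : nat -> 'I_k) (l : nat) : seq 'I_k :=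
  mkseq omega l.

(* _l[sigma] = j_l ... j_1, where sigma n is the letter j_{n+1} *)
Definition suffix_word (sigma : nat -> 'I_k) (l : nat) : seq 'I_k :=
  rev (mkseq sigma l).

End words.

Section expanding.
Context {R : realType} {X : pmetricType R}.
Implicit Types (T : X -> X) (phi : X -> R).

Definition ruelle_expanding (a lambda : R) T : Prop :=
  forall x y x' : X, mdist x y < a -> T x' = x ->
    exists y' : X, unique (fun z => T z = y /\ mdist x' z < a) y' /\
                   mdist x' y' <= lambda * mdist x y.

Definition holder (alpha : R) phi : Prop :=
  exists C : R, forall x y, `|phi x - phi y| <= C * mdist x y `^ alpha.

Definition holder_const (alpha : R) phi : R :=
  sup [set r | exists x y : X,
         x != y /\ r = `|phi x - phi y| / mdist x y `^ alpha].

Definition kappa T : \bar R :=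
  lim (ereal_inf [set (mdist (T z.1) (T z.2) / mdist z.1 z.2)%:E
                   | z in [set z : X * X | 0 < mdist z.1 z.2 < e]]
         @[e --> (0 : R)^'+]).

Section along_words.
Context {k : nat} (g : 'I_k -> X -> X).
Implicit Types u v w : seq 'I_k.

(* The first letter of w acts first. *)
Fixpoint word_map w : X -> X :=
  if w is i :: w' then word_map w' \o g i else id.

Definition word_pot phi w (x : X) : R :=
  \sum_(0 <= j < size w) phi (word_map (take j w) x).

Definition jointly_mixing : Prop :=
  forall U V : set X, open U -> open V -> U !=set0 -> V !=set0 ->
    exists m, forall w, (m <= size w)%N -> (word_map w @^-1` U) `&` V !=set0.

Definition word_pair phi w : (X -> X) * (X -> R) :=
  (word_map w, word_pot phi w).

End along_words.

Definition pair_prod (p q : (X -> X) * (X -> R)) : (X -> X) * (X -> R) :=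
  (p.1 \o q.1, fun x => q.2 x + p.2 (q.1 x)).

Inductive generated {k : nat} (g : 'I_k -> X -> X) phi :
    set ((X -> X) * (X -> R)) :=
| generated_gen i : generated g phi (g i, phi)
| generated_prod p q :
    generated g phi p -> generated g phi q -> generated g phi (pair_prod p q).

End expanding.

Section measures.
Context {R : realType} {X : pmetricType R}.
Local Notation prob := (probability (borel X) R).
Implicit Types (m nu : prob) (T : X -> X).

Definition weak_cvg (m_ : nat -> prob) m : Prop :=
  forall f : X -> R, continuous f ->
    \int[m_ n]_x f x @[n --> \oo] --> \int[m]_x f x.

Definition is_coupling (m nu : prob)
    (P : probability (borel X * borel X)%type R) : Prop :=
  forall A : set (borel X), measurable A ->
    P (A `*` setT) = m A /\ P (setT `*` A) = nu A.

Definition wasserstein (delta : X -> X -> R) m nu : R :=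
  inf [set \int[P]_z delta z.1 z.2 | P in is_coupling m nu].

(* Measurable partitions are encoded as finite-valued measurable maps xi,
   and the join of T^{-j} xi, j < n, as the itinerary map. *)
Definition itinerary T (q : nat) (xi : X -> 'I_q) (n : nat) (x : X) :
    {ffun 'I_n -> 'I_q} := [ffun j : 'I_n => xi (iter j T x)].

Definition partition_entropy m (I : finType) (xi : X -> I) : R :=
  - \sum_i (let p := fine (m (xi @^-1` [set i])) in p * ln p).

Definition measure_entropy m T : \bar R :=
  ereal_sup [set h | exists (q : nat) (xi : X -> 'I_q),
    (forall i, measurable (xi @^-1` [set i] : set (borel X))) /\
    h = (limn (fun n => partition_entropy m (itinerary T xi n) / n%:R))%:E].

Definition invariant_measure T m : Prop :=
  forall A : set (borel X), measurable A -> m (T @^-1` A) = m A.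

Definition free_energy T (psi : X -> R) m : \bar R :=
  (measure_entropy m T + (\int[m]_x psi x)%:E)%E.

Definition pressure T (psi : X -> R) : \bar R :=
  ereal_sup [set free_energy T psi m | m in invariant_measure T].

Definition is_equilibrium_state T (psi : X -> R) m : Prop :=
  invariant_measure T m /\ free_energy T psi m = pressure T psi.

Definition equilibrium_state (p : (X -> X) * (X -> R)) : prob :=
  get [set m | is_equilibrium_state p.1 p.2 m].

Section transfer.
Context {k : nat} (g : 'I_k -> X -> X) (phi : X -> R).
Implicit Types u v : seq 'I_k.

Definition transfer v (f : X -> R) (x : X) : R :=
  \sum_(y \in word_map g v @^-1` [set x]) expR (word_pot g phi v y) * f y.

Definition transfer_quot u v (f : X -> R) (x : X) : R :=
  transfer v (fun y => f y * transfer u (fun=> 1) y) x /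
  transfer (u ++ v) (fun=> 1) x.

(* (P_u^v)^* nu, as a functional on continuous functions *)
Definition dual_quot u v nu (f : X -> R) : R :=
  \int[nu]_x transfer_quot u v f x.

Definition mu_so (sigma omega : nat -> 'I_k) : prob :=
  get [set m : prob | forall nu (f : X -> R), continuous f ->
    dual_quot (suffix_word sigma z.1) (prefix_word omega z.2) nu f
      @[z --> filter_prod \oo \oo] --> \int[m]_x f x].

Definition mu_so_set : set prob :=
  [set m | exists sigma omega, m = mu_so sigma omega].

End transfer.

Section semigroup_metric.
Context (a lambda alpha : R) (phi : X -> R).

Definition Cphi : R := holder_const alpha phi / (1 - lambda `^ alpha).

Definition Delta : R := Num.max (4 * Cphi) (a `^ (- alpha)).

Definition dstar (x y : X) : R := Num.min 1 (Delta * mdist x y `^ alpha).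

Definition Wbar : prob -> prob -> R := wasserstein dstar.

Definition pair_dist (p q : (X -> X) * (X -> R)) : R :=
  if `[< p = q >] then 0
  else Wbar (equilibrium_state p) (equilibrium_state q)
       + (fine (kappa p.1))^-1 + (fine (kappa q.1))^-1.

End semigroup_metric.

(* Value at a point of the completion of the map sending the limit of a
   sequence of pairs to the weak limit of its equilibrium states. *)
Definition limit_state (C : set (nat -> (X -> X) * (X -> R))) : prob :=
  get [set m | exists2 u, C u & weak_cvg (equilibrium_state \o u) m].

End measures.

(* Main.v *)
Require Import Defs.
From HB Require Import structures.
From mathcomp Require Import all_boot all_order all_algebra finmap.
From mathcomp Require Import all_classical all_reals all_analysis.
From mathcomp Require Import measurable_realfun ring lra.

Set Implicit Arguments.
Unset Strict Implicit.
Unset Printing Implicit Defensive.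

Import Order.TTheory GRing.Theory Num.Theory.
Import numFieldNormedType.Exports.

Local Open Scope classical_set_scope.
Local Open Scope ring_scope.

(* The operators [P_u^v] contract the oscillation of Holder functions at a uniform
   exponential rate (a Lasota-Yorke inequality combined with a lower bound coming
   from mixing), and they depend exponentially little on the letters far away from
   the junction of [u] and [v].  Hence [W (mu_so s o) (mu_so s' o') <= C b^n] as soon
   as the last [n] letters of [s, s'] and the first [n] letters of [o, o'] agree.
   For a periodic pair of words [(... w w, w w ...)] the limit measure is the fixed
   measure of the transfer operator of [T_w], normalised by its eigenfunction
   [h = lim L_w^n 1 / L_w^n 1 (x0)].  For a normalised potential [lw], every invariant
   measure has entropy at most [- int lw], with equality exactly at the fixed measures;
   so the limit measure and the equilibrium state of [(T_w, phi_w)] have the same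
   integrals.  Since [1 / kappa T_w <= lambda^|w|], the Holder estimate follows from
   the bound above, and a non-trivial Cauchy sequence is one along which [kappa] blows
   up while the equilibrium states converge weakly.  Its limit is some [mu_so s o] by
   compactness of the space of pairs of infinite words, and every [mu_so s o] arises
   from the words [prefix_word o n ++ suffix_word s n]. *)

(** * Compact metric spaces *)

(** Three obstacles shape the argument. The bounds must be uniform in the word, although the radius
    on which [T_w] is seen to expand depends on [w]; hence the contraction estimates run letter by
    letter with the common [a] and [lambda], and only the entropy argument treats [T_w] as a single
    map. Secondly, contraction controls integrals of Holder functions, whereas the Wasserstein
    distance is an infimum over couplings; the passage goes through partitions of unity at scale
    [lambda ^+ j]. Their size grows exponentially in [j], so [j] is taken to be a small fraction of
    the number [n] of common letters, which keeps the final bound exponential in [n]. Thirdly,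
    [equilibrium_state], [mu_so] and [limit_state] are picked by [get] and are accessible only
    through their defining predicates; measures are therefore compared through their integrals of
    continuous functions, and an equality between two picked measures comes from the equality of the
    two predicates. *)

Section compact_metric.
Context {R : realType} {X : pmetricType R}.
Implicit Types (f : X -> R) (T : X -> X).

Lemma continuous_distP f : continuous f <->
  forall x (e : R), 0 < e -> exists2 d : R, 0 < d &
    forall y, mdist x y < d -> `|f x - f y| < e.
Proof.
split=> [cf x e e0|H x].
  have /cvgrPdist_lt/(_ e e0)/metricType_numDomainType.nbhs_mdistP[d d0 dP] := cf x.
  by exists d => // y; exact: dP.
apply/cvgrPdist_lt => e e0; have [d d0 dP] := H x e e0.
by apply/metricType_numDomainType.nbhs_mdistP; exists d.
Qed.

Lemma continuous_mapP T : continuous T <->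
  forall x (e : R), 0 < e -> exists2 d : R, 0 < d &
    forall y, mdist x y < d -> mdist (T x) (T y) < e.
Proof.
split=> [cf x e e0|H x].
  have /metricType_numDomainType.cvgrPdist_lt/(_ e e0)/metricType_numDomainType.nbhs_mdistP[d d0 dP] := cf x.
  by exists d => // y; exact: dP.
apply/metricType_numDomainType.cvgrPdist_lt => e e0; have [d d0 dP] := H x e e0.
by apply/metricType_numDomainType.nbhs_mdistP; exists d.
Qed.

Lemma open_mball (x : X) (r : R) : open [set y : X | mdist x y < r].
Proof.
rewrite openE => y /= xy; rewrite /interior; apply/metricType_numDomainType.nbhs_mdistP.
exists (r - mdist x y) => /=; first by rewrite subr_gt0.
move=> z /= yz; rewrite (le_lt_trans (metric_triangle _ y _))//; lra.
Qed.

Lemma openP (U : set X) : open U <->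
  forall x, U x -> exists2 d : R, 0 < d & forall y, mdist x y < d -> U y.
Proof.
split=> [|H].
  by rewrite openE => UU x /UU/metricType_numDomainType.nbhs_mdistP[d d0 dP]; exists d => // y; exact: dP.
by rewrite openE => x /H[d d0 dP]; apply/metricType_numDomainType.nbhs_mdistP; exists d.
Qed.

Lemma continuous_lip f (C : R) :
  (forall x y, `|f x - f y| <= C * mdist x y) -> continuous f.
Proof.
move=> H; apply/continuous_distP => x e e0.
have C0 : 0 < `|C| + 1 by rewrite ltr_wpDl.
exists (e / (`|C| + 1)); first by rewrite divr_gt0.
move=> y; rewrite ltr_pdivlMr// => xy; apply: le_lt_trans xy.
rewrite (le_trans (H x y))// mulrC ler_wpM2l ?mdist_ge0//.
by rewrite (le_trans (ler_norm _))// lerDl.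
Qed.

Hypothesis X_compact : compact [set: X].

Lemma finite_cover (e : X -> R) : (forall x, 0 < e x) ->
  exists s : seq X, forall y, exists x, x \in s /\ mdist x y < e x.
Proof.
move=> e0; move: X_compact; rewrite compact_cover.
move=> /(_ X setT (fun x => [set y | mdist x y < e x])).
case=> [x _|x _|D _ DP]; first exact: open_mball.
  by exists x => //=; rewrite mdistxx.
exists (finmap.enum_fset D) => y; have [x /= xD xy] := DP y I.
by exists x.
Qed.

Lemma finite_net (e : R) : 0 < e ->
  exists s : seq X, forall y, exists x, x \in s /\ mdist x y < e.
Proof. by move=> e0; exact: (@finite_cover (fun=> e)). Qed.

Lemma continuous_unif f : continuous f -> forall e : R, 0 < e ->
  exists2 d : R, 0 < d & forall x y, mdist x y < d -> `|f x - f y| < e.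
Proof.
move=> /continuous_distP cf e e0.
have e20 : 0 < e / 2 by rewrite divr_gt0.
pose r x := sval (cid2 (cf x _ e20)).
have r0 x : 0 < r x by rewrite /r; case: cid2.
have rP x y : mdist x y < r x -> `|f x - f y| < e / 2.
  by rewrite /r; case: cid2 => d d0 /= dP; exact: dP.
have [|s sP] := @finite_cover (fun x => r x / 2).
  by move=> x; rewrite divr_gt0.
exists (\big[Num.min/1]_(x <- s) (r x / 2)).
  by elim/big_ind : _ => // [x y x0 y0|x _]; [rewrite lt_min x0|rewrite divr_gt0].
move=> x y xy; have [z [zs zx]] := sP x.
have zy : mdist z y < r z.
  rewrite (le_lt_trans (metric_triangle _ x _))// [ltRHS](splitr (r z)) ltrD//.
  by rewrite (lt_le_trans xy)// (@bigmin_inf_seq _ _ _ _ _ z).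
have -> : f x - f y = (f z - f y) - (f z - f x) by ring.
rewrite (le_lt_trans (ler_normB _ _))// [e]splitr ltrD//; apply: rP => //.
by rewrite (lt_trans zx)// ltr_pdivrMr// ltr_pMr// ltr1n.
Qed.

Lemma continuous_map_unif T : continuous T -> forall e : R, 0 < e ->
  exists2 d : R, 0 < d & forall x y, mdist x y < d -> mdist (T x) (T y) < e.
Proof.
move=> /continuous_mapP cf e e0.
have e20 : 0 < e / 2 by rewrite divr_gt0.
pose r x := sval (cid2 (cf x _ e20)).
have r0 x : 0 < r x by rewrite /r; case: cid2.
have rP x y : mdist x y < r x -> mdist (T x) (T y) < e / 2.
  by rewrite /r; case: cid2 => d d0 /= dP; exact: dP.
have [|s sP] := @finite_cover (fun x => r x / 2).
  by move=> x; rewrite divr_gt0.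
exists (\big[Num.min/1]_(x <- s) (r x / 2)).
  by elim/big_ind : _ => // [x y x0 y0|x _]; [rewrite lt_min x0|rewrite divr_gt0].
move=> x y xy; have [z [zs zx]] := sP x.
have zy : mdist z y < r z.
  rewrite (le_lt_trans (metric_triangle _ x _))// [ltRHS](splitr (r z)) ltrD//.
  by rewrite (lt_le_trans xy)// (@bigmin_inf_seq _ _ _ _ _ z).
rewrite (le_lt_trans (metric_triangle _ (T z) _))// [e]splitr ltrD//; last exact: rP.
rewrite metric_sym; apply: rP.
by rewrite (lt_trans zx)// ltr_pdivrMr// ltr_pMr// ltr1n.
Qed.

Lemma continuous_bounded f : continuous f -> exists M : R, forall x, `|f x| <= M.
Proof.
move=> cf; have [d d0 dP] := continuous_unif cf ltr01.
have [s sP] := finite_net d0.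
exists (\sum_(x <- s) `|f x| + 1) => y.
have [x [xs /dP/ltW xy]] := sP y.
have -> : f y = f x - (f x - f y) by ring.
rewrite (le_trans (ler_normB _ _))// lerD// (big_rem x)//=.
by rewrite lerDl sumr_ge0.
Qed.

End compact_metric.

Section compact_metric2.
Context {R : realType} {X : pmetricType R}.
Hypothesis X_compact : compact [set: X].

(* Through the inf-convolution [x |-> inf_y (f y + n d(x, y))]. *)
Lemma lipschitz_dense (f : X -> R) : continuous f -> forall e : R, 0 < e ->
  exists h : X -> R, exists C : R,
    (forall x y, `|h x - h y| <= C * mdist x y) /\ forall x, `|f x - h x| <= e.
Proof.
move=> cf e e0.
have [d d0 dP] := continuous_unif X_compact cf e0.
have [M MP] := continuous_bounded X_compact cf.
have M0 : 0 <= M by rewrite (le_trans _ (MP point)).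
(* The slope at which the penalty [n * mdist x y] reaches the whole range [2 * M] of [f] at distance
   [d], so that points farther than [d] from [x] cannot bring the infimum below [f x]. *)
pose n := 2 * M / d.
have n0 : 0 <= n by rewrite divr_ge0 ?mulr_ge0// ltW.
pose S x := [set f y + n * mdist x y | y in [set: X]].
have lbS x : lbound (S x) (- M).
  move=> _ [y _ <-]; have := MP y; rewrite ler_norml => /andP[+ _].
  by have := mulr_ge0 n0 (mdist_ge0 x y); lra.
have hS x : has_inf (S x).
  by split; [exists (f x + n * mdist x x), x|exists (- M); exact: lbS].
pose h x := inf (S x).
have hle x y : h x <= f y + n * mdist x y.
  by apply: ge_inf; [case: (hS x)|exists y].
have hge x r : (forall y, r <= f y + n * mdist x y) -> r <= h x.
  by move=> H; apply: lb_le_inf; [case: (hS x)|move=> _ [y _ <-]].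
exists h, n; split.
  suff hh x y : h x - h y <= n * mdist x y.
    by move=> x y; rewrite ler_norml hh andbT lerNl opprB metric_sym hh.
  rewrite lerBlDr -lerBlDl; apply: hge => z.
  rewrite lerBlDl; apply: (le_trans (hle x z)).
  rewrite addrCA lerD2l -mulrDr ler_wpM2l// metric_triangle//.
move=> x; rewrite ler_norml; apply/andP; split.
  by have := hle x x; rewrite mdistxx mulr0 addr0; lra.
rewrite lerBlDr -lerBlDl; apply: hge => y.
have [xy|xy] := ltP (mdist x y) d.
  have := dP x y xy; rewrite ltr_norml => /andP[_ H].
  by have := mulr_ge0 n0 (mdist_ge0 x y); lra.
have : 2 * M <= n * mdist x y.
  by rewrite /n mulrAC ler_pdivlMr// ler_wpM2l// mulr_ge0.
by have := MP x; have := MP y; rewrite !ler_norml => /andP[? ?] /andP[? ?]; lra.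
Qed.

Definition set_dist (A : set X) (x : X) : R := inf [set mdist x y | y in A].

Lemma set_dist_ge0 A x : 0 <= set_dist A x.
Proof.
have [->|/set0P[a Aa]] := eqVneq A set0.
  by rewrite /set_dist image_set0 inf0.
apply: lb_le_inf; first by exists (mdist x a), a.
by move=> _ [y _ <-]; exact: mdist_ge0.
Qed.

Lemma set_dist_le A x y : A y -> set_dist A x <= mdist x y.
Proof.
move=> Ay; apply: ge_inf; last by exists y.
by exists 0 => _ [z _ <-]; exact: mdist_ge0.
Qed.

Lemma set_dist0 A x : A x -> set_dist A x = 0.
Proof.
move=> Ax; apply/eqP; rewrite eq_le set_dist_ge0 andbT.
by rewrite -[leRHS](mdistxx x) set_dist_le.
Qed.

Lemma set_dist_lip A x y : `|set_dist A x - set_dist A y| <= mdist x y.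
Proof.
have [->|/set0P[a Aa]] := eqVneq A set0.
  by rewrite /set_dist !image_set0 inf0 subrr normr0 mdist_ge0.
suff H u v : set_dist A u - set_dist A v <= mdist u v.
  by rewrite ler_norml H andbT lerNl opprB metric_sym H.
rewrite lerBlDl -lerBlDr; apply: lb_le_inf; first by exists (mdist v a), a.
move=> _ [z Az <-]; rewrite lerBlDr addrC.
by rewrite (le_trans (set_dist_le u Az))// metric_triangle.
Qed.

Lemma set_dist_continuous A : continuous (set_dist A).
Proof.
by apply: (@continuous_lip _ _ _ 1) => x y; rewrite mul1r set_dist_lip.
Qed.

(* The hypothesis [A !=set0] is needed as [inf set0 = 0]. *)
Lemma set_dist_closed_gt0 A x : closed A -> A !=set0 -> ~ A x -> 0 < set_dist A x.
Proof.
move=> cA [a Aa] nAx; have /openP oA : open (~` A) by exact: closed_openC.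
have [d d0 dP] := oA x nAx.
apply: (lt_le_trans d0); apply: lb_le_inf; first by exists (mdist x a), a.
by move=> _ [y Ay <-]; rewrite leNgt; apply/negP => /dP.
Qed.

(** Truncated multiples of the distance to the complement. Each point of [U] reaches the value 1
    after finitely many steps, so the closed sets where [h j = 1] increase to [U]; inner
    approximation is used below in this form. *)
Lemma open_approximation (U : set X) : open U ->
  exists h : nat -> X -> R,
    [/\ forall j, continuous (h j), forall j x, 0 <= h j x <= 1,
        forall j x, ~ U x -> h j x = 0,
        forall i j x, (i <= j)%N -> h i x <= h j x &
        forall x, U x -> exists j, h j x = 1].
Proof.
(* Treated apart, because [set_dist] to the empty complement is 0. *)
move=> oU; have [UT|/eqP UT] := pselect (U = setT).
  exists (fun _ _ => 1); split=> //; last by move=> x _; exists 0%N.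
  - by move=> j x /=; apply: cvg_cst.
  - by move=> j x; rewrite ler01 lexx.
  - by move=> j x; rewrite UT => /(_ I).
have U0 : ~` U !=set0 by apply/set0P; apply/eqP => /(congr1 (@setC X)); rewrite setCK setC0; exact/eqP.
have cU : closed (~` U) by exact: open_closedC.
exists (fun j x => Num.min 1 (j.+1%:R * set_dist (~` U) x)); split.
- move=> j; apply: (@continuous_lip _ _ _ j.+1%:R) => x y.
  have jl : `|j.+1%:R * set_dist (~` U) x - j.+1%:R * set_dist (~` U) y|
      <= j.+1%:R * mdist x y.
    by rewrite -mulrBr normrM ger0_norm// ler_wpM2l// set_dist_lip.
  apply: le_trans jl; set p := _ * _; set q := _ * _.
  by rewrite /Num.min; case: ltP => ?; case: ltP => ?;
    rewrite ?subrr ?normr0// ?ler_norml; apply/andP; split;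
    have := ler_norm (p - q); have := ler_norm (q - p); rewrite (distrC q p); lra.
- move=> j x; rewrite ge_min lexx /= le_min ler01 /=.
  by rewrite mulr_ge0// set_dist_ge0.
- by move=> j x Ux; rewrite set_dist0// mulr0 /Num.min ltNge ler01.
- move=> i j x ij; rewrite le_min ge_min lexx /= ge_min; apply/orP; right.
  by rewrite ler_wpM2r ?set_dist_ge0// ler_nat.
- move=> x Ux; have d0 : 0 < set_dist (~` U) x.
    by apply: set_dist_closed_gt0 => //; exact.
  exists (Num.truncn (set_dist (~` U) x)^-1).
  apply/min_idPl; rewrite -ler_pdivrMr// mul1r.
  by rewrite ltW// truncnS_gt.
Qed.

End compact_metric2.

(** * Bounded measurable functions *)

Section bounded_measurable.
Context {R : realType} d {T : measurableType d}.
Implicit Types (f h : T -> R) (P : probability T R) (A B : set T).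

(** Under a probability all these functions are integrable, so linearity and monotonicity of the
    integral come without further side conditions; the class is also stable under the products that
    occur as densities of couplings. *)
Definition bmf f := measurable_fun setT f /\ exists M : R, forall x, `|f x| <= M.

Lemma bmf_cst (c : R) : bmf (fun=> c).
Proof. by split; [exact: measurable_cst|exists `|c|]. Qed.

Lemma bmfD f h : bmf f -> bmf h -> bmf (fun x => f x + h x).
Proof.
move=> [mf [M fM]] [mh [N hN]]; split; first exact: measurable_funD.
by exists (M + N) => x; rewrite (le_trans (ler_normD _ _))// lerD.
Qed.

Lemma bmfM f h : bmf f -> bmf h -> bmf (fun x => f x * h x).
Proof.
move=> [mf [M fM]] [mh [N hN]]; split; first exact: measurable_funM.
by exists (M * N) => x; rewrite normrM ler_pM.
Qed.

Lemma bmfZ (c : R) f : bmf f -> bmf (fun x => c * f x).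
Proof. by move=> bf; apply: bmfM => //; exact: bmf_cst. Qed.

Lemma bmfN f : bmf f -> bmf (fun x => - f x).
Proof.
by move=> /(bmfZ (-1)); congr bmf; apply/funext => x; rewrite mulN1r.
Qed.

Lemma bmfB f h : bmf f -> bmf h -> bmf (fun x => f x - h x).
Proof. by move=> bf bh; apply: bmfD => //; exact: bmfN. Qed.

Lemma bmf_sum (I : Type) (s : seq I) (p : pred I) (F : I -> T -> R) :
  (forall i, p i -> bmf (F i)) -> bmf (fun x => \sum_(i <- s | p i) F i x).
Proof.
move=> H; elim: s => [|i s IH].
  have -> : (fun x => \sum_(i <- [::] | p i) F i x) = fun=> 0.
    by apply/funext => x; rewrite big_nil.
  exact: bmf_cst.
have -> : (fun x => \sum_(j <- i :: s | p j) F j x) = (fun x => (if p i then F i x else 0) +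
    \sum_(j <- s | p j) F j x).
  by apply/funext => x; rewrite big_cons; case: ifP; rewrite ?add0r.
by apply: bmfD => //; case: (boolP (p i)) => [/H//|_]; exact: bmf_cst.
Qed.

Lemma bmf_indic A : measurable A -> bmf (\1_A : T -> R).
Proof.
move=> mA; split; first exact: measurable_indic.
by exists 1 => x; rewrite indicE; case: (_ \in _); rewrite ?normr1 ?normr0.
Qed.

Lemma bmf_integrable P f : bmf f -> P.-integrable setT (EFin \o f).
Proof.
move=> [mf [M fM]]; apply: measurable_bounded_integrable => //.
  by apply: le_lt_trans (probability_le1 P measurableT) _; rewrite ltry.
by exists M; split; [exact: num_real|move=> N MN x _ /=; rewrite (le_trans (fM x))// ltW].
Qed.

Lemma RintD P f h : bmf f -> bmf h ->
  \int[P]_x (f x + h x) = \int[P]_x f x + \int[P]_x h x.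
Proof. by move=> bf bh; apply: RintegralD => //; exact: bmf_integrable. Qed.

Lemma RintB P f h : bmf f -> bmf h ->
  \int[P]_x (f x - h x) = \int[P]_x f x - \int[P]_x h x.
Proof. by move=> bf bh; apply: RintegralB => //; exact: bmf_integrable. Qed.

Lemma RintZ P (c : R) f : bmf f -> \int[P]_x (c * f x) = c * \int[P]_x f x.
Proof. by move=> bf; apply: RintegralZl => //; exact: bmf_integrable. Qed.

Lemma Rint_cst P (c : R) : \int[P]_x c = c.
Proof.
by rewrite Rintegral_cst// [X in fine X](@probability_setT _ _ _ P) mulr1.
Qed.

Lemma Rint_le P f h : bmf f -> bmf h -> (forall x, f x <= h x) ->
  \int[P]_x f x <= \int[P]_x h x.
Proof.
by move=> bf bh fh; apply: le_Rintegral => //; exact: bmf_integrable.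
Qed.

Lemma Rint_ge0 P f : (forall x, 0 <= f x) -> 0 <= \int[P]_x f x.
Proof. by move=> f0; apply: Rintegral_ge0. Qed.

Lemma Rint_eq P f h : (forall x, f x = h x) -> \int[P]_x f x = \int[P]_x h x.
Proof. by move=> fh; apply: eq_Rintegral => x _. Qed.

Lemma Rint_sum P (I : Type) (s : seq I) (p : pred I) (F : I -> T -> R) :
  (forall i, p i -> bmf (F i)) ->
  \int[P]_x (\sum_(i <- s | p i) F i x) = \sum_(i <- s | p i) \int[P]_x F i x.
Proof.
move=> H; elim: s => [|i s IH].
  by rewrite big_nil -[RHS](Rint_cst P); apply: Rint_eq => x; rewrite big_nil.
rewrite big_cons; case: ifPn => pi.
  rewrite -IH -RintD; [|exact: H|exact: bmf_sum].
  by apply: Rint_eq => x; rewrite big_cons pi.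
by rewrite -IH; apply: Rint_eq => x; rewrite big_cons (negbTE pi).
Qed.

Lemma Rint_dist P f h (e : R) : bmf f -> bmf h ->
  (forall x, `|f x - h x| <= e) ->
  `|\int[P]_x f x - \int[P]_x h x| <= e.
Proof.
move=> bf bh fh; rewrite -RintB// ler_norml -{1 2}[e](Rint_cst P).
have fhn x : - e <= f x - h x <= e by rewrite -ler_norml.
have bfh := bmfB bf bh; have be c := @bmf_cst c.
apply/andP; split; last by apply: Rint_le => // x; case/andP: (fhn x).
rewrite -[X in X <= _]mulN1r -RintZ//.
by apply: Rint_le => [||x]; [exact: bmfZ|exact: bfh|rewrite mulN1r; case/andP: (fhn x)].
Qed.

Definition pr P A : R := fine (P A).

Lemma pr_fin P A : measurable A -> P A = (pr P A)%:E.
Proof. by move=> mA; rewrite /pr fineK// fin_num_measure. Qed.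

Lemma Rint_indic P A : measurable A -> \int[P]_x \1_A x = pr P A.
Proof. by move=> mA; rewrite /Rintegral integral_indic// setIT. Qed.

Lemma pr_ge0 P A : 0 <= pr P A.
Proof. by rewrite /pr fine_ge0// measure_ge0. Qed.

Lemma pr_le P A B : measurable A -> measurable B -> A `<=` B -> pr P A <= pr P B.
Proof.
by move=> mA mB AB; rewrite -lee_fin -!pr_fin// le_measure// inE.
Qed.

Lemma prT P : pr P setT = 1.
Proof. by rewrite /pr [X in fine X](@probability_setT _ _ _ P). Qed.

Lemma pr0 P : pr P set0 = 0.
Proof. by rewrite /pr measure0. Qed.

Lemma pr_le1 P A : measurable A -> pr P A <= 1.
Proof. by move=> mA; rewrite -(prT P) pr_le. Qed.

Lemma prU P A B : measurable A -> measurable B -> A `&` B = set0 ->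
  pr P (A `|` B) = pr P A + pr P B.
Proof.
move=> mA mB AB; apply: EFin_inj; rewrite EFinD -!pr_fin//.
  by rewrite [LHS](measureU P).
exact: measurableU.
Qed.

Lemma prD P A B : measurable A -> measurable B -> B `<=` A ->
  pr P (A `\` B) = pr P A - pr P B.
Proof.
move=> mA mB BA; rewrite -[X in _ = pr P X - _](setDUK BA) prU//.
- by rewrite addrC addKr.
- exact: measurableD.
- by rewrite setDE setICA setICr setI0.
Qed.

Lemma pr_up P (F : nat -> set T) : (forall i, measurable (F i)) ->
  nondecreasing_seq F -> pr P (F n) @[n --> \oo] --> pr P (\bigcup_n F n).
Proof.
move=> mF ndF; apply: fine_cvg; rewrite -pr_fin; last exact: bigcup_measurable.
by apply: nondecreasing_cvg_mu => //; exact: bigcup_measurable.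
Qed.

Lemma pr_partition P (I : finType) (xi : T -> I) A :
  (forall i, measurable (xi @^-1` [set i])) -> measurable A ->
  pr P A = \sum_i pr P (A `&` xi @^-1` [set i]).
Proof.
move=> mxi mA; rewrite -Rint_indic//.
have mAi i : measurable (A `&` xi @^-1` [set i]) by exact: measurableI.
under [RHS]eq_bigr do rewrite -Rint_indic//.
rewrite -Rint_sum; last by move=> i _; exact: bmf_indic.
apply: Rint_eq => x; rewrite (bigD1 (xi x))//= big1 ?addr0.
  by rewrite !indicE; congr (_%:R); congr nat_of_bool; apply/idP/idP; rewrite !inE => // -[].
move=> i ix; rewrite indicE memNset//= => -[_ /= /eqP].
by rewrite eq_sym (negbTE ix).
Qed.

End bounded_measurable.

(** * Borel probabilities and continuous functions *)

Section borel_measures.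
Context {R : realType} {X : pmetricType R}.
Local Notation prob := (probability (borel X) R).
Implicit Types (m : prob) (f : X -> R).

Lemma open_borel (U : set X) : open U -> measurable (U : set (borel X)).
Proof. by move=> oU; apply: sub_sigma_algebra. Qed.

Lemma closed_borel (U : set X) : closed U -> measurable (U : set (borel X)).
Proof.
move=> cU; rewrite -(setCK U); apply: measurableC; apply: open_borel.
exact: closed_openC.
Qed.

Lemma continuous_borel f : continuous f -> measurable_fun setT (f : borel X -> R).
Proof.
move=> /continuousP cf; apply: (measurability _ (RGenOpens.measurableE R)).
move=> _ [_ [a [b ->] <-]]; rewrite setTI; apply: open_borel.
exact/cf/interval_open.
Qed.

Lemma continuous_map_borel (T : X -> X) : continuous T ->
  measurable_fun setT (T : borel X -> borel X).
Proof.
move=> /continuousP cf; apply: (@measurability _ _ (borel X) (borel X) _ _ (@open X)) => //.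
by move=> _ [U oU <-]; rewrite setTI; apply: open_borel; exact: cf.
Qed.

Hypothesis X_compact : compact [set: X].

Lemma continuous_bmf f : continuous f -> bmf (f : borel X -> R).
Proof.
by move=> cf; split; [exact: continuous_borel|exact: continuous_bounded].
Qed.

(** The sets where an approximating function equals 1 increase to [U], and the indicator of each is
    below that function. *)
Lemma pr_open_le m (U : set X) (c : R) : open U ->
  (forall h : X -> R, continuous h -> (forall x, 0 <= h x <= 1) ->
    (forall x, ~ U x -> h x = 0) -> \int[m]_x h x <= c) ->
  pr m (U : set (borel X)) <= c.
Proof.
move=> oU H; have [h [ch h01 h0 hnd h1]] := open_approximation oU.
pose F j : set (borel X) := [set x | h j x = 1].
have mF j : measurable (F j).
  rewrite (_ : F j = (h j : borel X -> R) @^-1` [set 1])//.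
  by rewrite -[X in measurable X]setTI; apply: continuous_borel.
have FU : \bigcup_j F j = U.
  apply/seteqP; split=> [x [j _ Fjx]|x /h1[j hj]]; last by exists j.
  by apply: contrapT => /(h0 j); rewrite Fjx => /eqP; rewrite oner_eq0.
have c1 : pr m (F n) @[n --> \oo] --> pr m (U : set (borel X)).
  rewrite -FU; apply: pr_up => // i j ij; apply/subsetPset => x Fix.
  apply/eqP; rewrite eq_le; case/andP: (h01 j x) => _ -> /=.
  by rewrite -Fix; exact: hnd.
apply: (cvgr_to_le c1); apply: nearW => j.
rewrite -Rint_indic// (@le_trans _ _ (\int[m]_x h j x))//.
  2: by apply: H => [|x|x]; [exact: ch|exact: h01|exact: h0].
apply: Rint_le; [exact: bmf_indic|exact: continuous_bmf|].
move=> x; rewrite indicE; case: (boolP (_ \in _)) => [|_]; first by rewrite inE => ->.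
by case/andP: (h01 j x).
Qed.

Lemma open_le_pr (m1 m2 : prob) :
  (forall f, continuous f -> \int[m1]_x f x = \int[m2]_x f x) ->
  forall U : set X, open U -> pr m1 (U : set (borel X)) <= pr m2 (U : set (borel X)).
Proof.
move=> H U oU; apply: pr_open_le => // h ch h01 h0.
have mU := open_borel oU; rewrite H// -Rint_indic//.
apply: Rint_le; [exact: continuous_bmf|exact: bmf_indic|].
move=> x; rewrite indicE; case: (boolP (_ \in _)) => [_|].
  by case/andP: (h01 x).
by rewrite notin_setE => /h0 ->.
Qed.

Lemma prob_continuous_unique (m1 m2 : prob) :
  (forall f, continuous f -> \int[m1]_x f x = \int[m2]_x f x) ->
  forall A : set (borel X), measurable A -> m1 A = m2 A.
Proof.
move=> H.
apply: (@measure_unique _ R (borel X) (@open X) (fun=> setT) erefl _ _ _ m1 m2).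
- by move=> A B; exact: openI.
- by move=> _; exact: openT.
- by rewrite bigcup_const//; exists 0%N.
- move=> U oU; have mU := open_borel oU.
  have mU' : measurable (U : set (borel X)) by [].
  have E : pr m1 (U : set (borel X)) = pr m2 (U : set (borel X)).
    apply/eqP; rewrite eq_le !open_le_pr// => f cf.
    by rewrite H.
  by move: (pr_fin m1 mU'); rewrite E -pr_fin.
- by move=> k; apply: le_lt_trans (probability_le1 m1 measurableT) _; rewrite ltry.
Qed.

(** The sets that can be squeezed in this way form a sigma-algebra; it contains the open sets, since
    [open_approximation] exhausts them by closed ones. *)
Lemma prob_regular m (A : set (borel X)) : measurable A -> forall e : R, 0 < e ->
  exists K U : set X, [/\ closed K, open U, K `<=` A, A `<=` U &
    pr m (U `\` K : set (borel X)) < e].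
Proof.
pose G := [set A : set (borel X) | forall e : R, 0 < e ->
  exists K U : set X, [/\ closed K, open U, K `<=` A, A `<=` U &
    pr m (U `\` K : set (borel X)) < e]].
suff: @measurable _ (borel X) `<=` G by move=> H /H.
apply: smallest_sub; last first.
  move=> U oU e e0; have [h [ch h01 h0 hnd h1]] := open_approximation oU.
  have cF j : closed [set x | h j x = 1].
    rewrite (_ : [set x | h j x = 1] = h j @^-1` [set 1])//.
    by apply: preimage_closed => [x _|]; [exact: (ch j x)|exact: closed_eq].
  pose F j : set (borel X) := [set x | h j x = 1].
  have mF j : measurable (F j) by exact: (closed_borel (cF j)).
  have FU : \bigcup_j F j = U.
    apply/seteqP; split=> [x [j _ Fjx]|x /h1[j hj]]; last by exists j.
    by apply: contrapT => /(h0 j); rewrite Fjx => /eqP; rewrite oner_eq0.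
  have : pr m (F n) @[n --> \oo] --> pr m (\bigcup_n F n).
    apply: pr_up => // i j ij; apply/subsetPset => x Fix.
    apply/eqP; rewrite eq_le; case/andP: (h01 j x) => _ -> /=.
    by rewrite -Fix; exact: hnd.
  move=> /cvgrPdist_lt/(_ e e0)[N _ /(_ N (leqnn N))] /=; rewrite FU => NP.
  have FsubU x : F N x -> U x.
    by move=> Fx; have : (\bigcup_j F j) x by [exists N]; rewrite FU.
  exists (F N), U; split => //; first exact: cF.
  apply: le_lt_trans NP; apply: le_trans (ler_norm _).
  by rewrite -(prD m (open_borel oU) (mF N) FsubU).
split.
- move=> e e0; exists set0, set0; split => //; [exact: closed0|exact: open0|].
  by rewrite setD0 pr0.
- move=> B GB e /GB[K [U [cK oU KB BU KU]]]; exists (~` U), (~` K); split.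
  + exact: open_closedC.
  + exact: closed_openC.
  + by rewrite setTD; exact: subsetC.
  + by rewrite setTD; exact: subsetC.
  + by rewrite setDE setCK setIC -setDE.
- move=> F GF e e0.
  have e40 n : 0 < e / 4 / (2 ^ n.+1)%:R by rewrite !divr_gt0// ltr0n expn_gt0.
  have /choice[KU KUP] : forall n, exists KU : set X * set X,
      [/\ closed KU.1, open KU.2, KU.1 `<=` F n, F n `<=` KU.2 &
      pr m (KU.2 `\` KU.1 : set (borel X)) < e / 4 / (2 ^ n.+1)%:R].
    by move=> n; have [K [U KUP]] := GF n _ (e40 n); exists (K, U).
  pose K n : set (borel X) := (KU n).1; pose U n : set (borel X) := (KU n).2.
  have mK n : measurable (K n) by apply: closed_borel; case: (KUP n).
  have mU n : measurable (U n) by apply: open_borel; case: (KUP n).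
  pose UU : set (borel X) := \bigcup_n U n.
  have mUU : measurable UU by exact: bigcupT_measurable.
  (* A countable union of closed sets need not be closed: only finitely many [K i] are kept, and
     continuity from below makes the loss small. *)
  pose KK n : set (borel X) := \big[setU/set0]_(i < n) K i.
  have mKK n : measurable (KK n) by exact: bigsetU_measurable.
  have KKUU n : KK n `<=` UU.
    move=> x; rewrite /KK -bigcup_mkord => -[i /= _ Kx]; exists i => //.
    by case: (KUP i) => _ _ KF FU _; exact/FU/KF.
  have lim1 : pr m (KK n) @[n --> \oo] --> pr m (\bigcup_n KK n).
    apply: pr_up => // i j ij; apply/subsetPset.
    by rewrite /KK -!bigcup_mkord => x [l /= li Kx]; exists l => //=; exact: leq_trans ij.
  have mKoo : measurable (\bigcup_n KK n) by exact: bigcupT_measurable.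
  have KooUU : \bigcup_n KK n `<=` UU by move=> x [n _]; exact: KKUU.
  have small : pr m (UU `\` \bigcup_n KK n) <= e / 4.
    have mUK n : measurable (U n `\` K n) by exact: measurableD.
    rewrite -lee_fin -pr_fin; last exact: measurableD.
    have s1 : UU `\` \bigcup_n KK n `<=` \bigcup_n (U n `\` K n).
      move=> x [[n _ Ux] nK]; exists n => //; split => // Kx; apply: nK.
      by exists n.+1 => //; rewrite /KK -bigcup_mkord; exists n => /=.
    apply: (le_trans (measure_sigma_subadditive m mUK (measurableD mUU mKoo) s1)).
    apply: le_trans (@epsilon_trick0 _ (e / 4) xpredT _); last by rewrite divr_ge0// ltW.
    apply: lee_nneseries => // n _.
    by rewrite [X in (X <= _)%E](pr_fin m (mUK n)) lee_fin ltW//; case: (KUP n).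
  have e40' : 0 < e / 4 by rewrite divr_gt0.
  move/cvgrPdist_lt : lim1 => /(_ _ e40')[N _ /(_ N (leqnn N))] /= NP.
  exists (KK N), UU; split.
  + rewrite /KK; elim/big_ind : _ => //; [exact: closed0|exact: closedU|].
    by move=> i _; case: (KUP i).
  + by apply: bigcup_open => n _; case: (KUP n).
  + move=> x; rewrite /KK -bigcup_mkord => -[i /= _ Kx]; exists i => //.
    by case: (KUP i) => _ _ KF _ _; exact: KF.
  + by move=> x [n _ Fx]; exists n => //; case: (KUP n) => _ _ _ FU _; exact: FU.
  + rewrite prD//; move: small; rewrite prD// => small.
    by have := ler_norm (pr m (\bigcup_n KK n) - pr m (KK N)); lra.
Qed.

End borel_measures.

(** * The Riesz representation theorem *)

Section riesz.
Context {R : realType} {X : pmetricType R}.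
Hypothesis X_compact : compact [set: X].
Variable L : (X -> R) -> R.
Implicit Types (U V A B : set X) (f h : X -> R).
Hypothesis LD : forall f h, continuous f -> continuous h ->
  L (fun x => f x + h x) = L f + L h.
Hypothesis LZ : forall (c : R) f, continuous f -> L (fun x => c * f x) = c * L f.
Hypothesis L_ge0 : forall f, continuous f -> (forall x, 0 <= f x) -> 0 <= L f.
Hypothesis L1 : L (fun=> 1) = 1.
Let ccst (c : R) : continuous (fun _ : X => c).
Proof. by move=> x; exact: cvg_cst. Qed.

Let cD f h : continuous f -> continuous h -> continuous (fun x => f x + h x).
Proof. by move=> cf ch x; apply: cvgD; [exact: cf|exact: ch]. Qed.

Let cZ (c : R) f : continuous f -> continuous (fun x => c * f x).
Proof. by move=> cf x; apply: cvgM; [exact: ccst|exact: cf]. Qed.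

Let cmin f h : continuous f -> continuous h -> continuous (fun x => Num.min (f x) (h x)).
Proof. by move=> cf ch x; apply: continuous_min; [exact: cf|exact: ch]. Qed.

Let cmax f h : continuous f -> continuous h -> continuous (fun x => Num.max (f x) (h x)).
Proof. by move=> cf ch x; apply: continuous_max; [exact: cf|exact: ch]. Qed.

Let Lcst (c : R) : L (fun=> c) = c.
Proof.
rewrite -[RHS]mulr1 -L1 -(LZ c (@ccst 1)); congr L.
by apply/funext => x; rewrite mulr1.
Qed.

Let L_le f h : continuous f -> continuous h -> (forall x, f x <= h x) -> L f <= L h.
Proof.
move=> cf ch fh; rewrite -subr_ge0.
have <- : L (fun x => h x + (-1) * f x) = L h - L f.
  by rewrite LD ?LZ ?mulN1r//; exact: cZ.
by apply: L_ge0 => [|x]; [apply: cD => //; exact: cZ|rewrite mulN1r subr_ge0].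
Qed.

Let L_sum (n : nat) (F : nat -> X -> R) : (forall i, continuous (F i)) ->
  continuous (fun x => \sum_(i < n) F i x) /\
  L (fun x => \sum_(i < n) F i x) = \sum_(i < n) L (F i).
Proof.
move=> cF; elim: n => [|n [IH1 IH2]].
  rewrite (_ : (fun x => \sum_(i < 0) F i x) = fun=> 0); last first.
    by apply/funext => x; rewrite big_ord0.
  by rewrite big_ord0 Lcst; split => //; exact: ccst.
rewrite (_ : (fun x => \sum_(i < n.+1) F i x) =
    fun x => \sum_(i < n) F i x + F n x); last first.
  by apply/funext => x; rewrite big_ord_recr.
by rewrite big_ord_recr/= LD// IH2; split => //; exact: cD.
Qed.

Definition test_fun U : set (X -> R) :=
  [set f : X -> R | [/\ continuous f, forall x, 0 <= f x <= 1 & forall x, ~ U x -> f x = 0]].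

(** The value that a measure representing [L] is forced to give to an open set; outer regularity and
    Caratheodory's criterion extend it to Borel sets. *)
Definition open_content U : R := sup [set L f | f in test_fun U].

Let test0 U : test_fun U (fun=> 0).
Proof. by split => [|x|//]; [exact: ccst|rewrite lexx ler01]. Qed.

Let content_sup U : has_sup [set L f | f in test_fun U].
Proof.
split; first by exists (L (fun=> 0)), (fun=> 0).
exists 1 => _ [f [cf f01 _] <-]; rewrite -L1; apply: L_le => // x.
by case/andP: (f01 x).
Qed.

Let content_ge U f : test_fun U f -> L f <= open_content U.
Proof. by move=> Uf; apply: sup_ubound; [case: (content_sup U)|exists f]. Qed.

Let content_le U (c : R) : (forall f, test_fun U f -> L f <= c) -> open_content U <= c.
Proof.
by move=> H; apply: ge_sup; [case: (content_sup U)|move=> _ [f Uf <-]; exact: H].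
Qed.

Let content_adh U (e : R) : 0 < e ->
  exists f, test_fun U f /\ open_content U - e < L f.
Proof.
move=> e0; have [_ [f Uf <-] H] := sup_adherent e0 (content_sup U).
by exists f.
Qed.

Let content_ge0 U : 0 <= open_content U.
Proof. by rewrite -(Lcst 0); apply: content_ge; exact: test0. Qed.

Let content_mono U V : U `<=` V -> open_content U <= open_content V.
Proof.
move=> UV; apply: content_le => f [cf f01 f0]; apply: content_ge; split => // x nV.
by apply: f0 => /UV/nV.
Qed.

(** The support of [f] need not be a compact part of the union, so it cannot be covered directly by
    finitely many [U n]. But at a point outside the union [f] vanishes and hence is below [e]
    nearby; compactness of the whole space then yields one [N] with [f <= e + S N] everywhere. *)
Let content_subadd (U : nat -> set X) (f : X -> R) (e : R) : 0 < e ->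
  (forall n, open (U n)) -> test_fun (\bigcup_n U n) f ->
  exists N, L f <= e + \sum_(n < N) open_content (U n).
Proof.
move=> e0 oU [cf f01 f0].
have /choice[h hP] := fun n => open_approximation (oU n).
have hc n j : continuous (h n j) by case: (hP n).
pose S (j : nat) x := \sum_(n < j) h n j x.
have cS j : continuous (S j) by case: (@L_sum j (h^~ j) (hc^~ j)).
have hge0 n j x : 0 <= h n j x by case: (hP n) => _ /(_ j x)/andP[].
have hmono n i j x : (i <= j)%N -> h n i x <= h n j x.
  by case: (hP n) => _ _ _ + _; exact.
have Smono i j x : (i <= j)%N -> S i x <= S j x.
  move=> ij; rewrite /S -(subnKC ij) big_split_ord/= -[leLHS]addr0 lerD//.
    by apply: ler_sum => k _; apply: hmono; rewrite subnKC.
  by apply: sumr_ge0 => k _.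
have loc x : exists jd : nat * R, 0 < jd.2 /\
    forall y, mdist x y < jd.2 -> f y <= e + S jd.1 y.
  have [Ux|nUx] := pselect ((\bigcup_n U n) x); last first.
    have [d d0 dP] := (continuous_distP f).1 cf x e e0.
    exists (0%N, d); split => // y /dP; rewrite f0// sub0r normrN => fy.
    rewrite /S big_ord0 addr0 (le_trans (ler_norm _))//; exact: ltW.
  have [n _ Unx] := Ux; have [j hj] : exists j, h n j x = 1.
    by case: (hP n) => _ _ _ _; apply.
  (* Large enough both for [h n] to have reached 1 at [x] and for the index [n] to occur in the sum
     [S J]. *)
  pose J := maxn n.+1 j.
  have S1 : 1 <= S J x.
    rewrite -hj (@le_trans _ _ (h n J x))//; first exact/hmono/leq_maxr.
    have nJ : (n < J)%N by exact: leq_maxl.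
    by rewrite /S (bigD1 (Ordinal nJ))//= lerDl sumr_ge0.
  have [d d0 dP] := (continuous_distP (S J)).1 (cS J) x e e0.
  exists (J, d); split => // y /dP; rewrite ltr_norml => /andP[_].
  by case/andP: (f01 y) => _ f1; lra.
have /choice[jd jdP] := loc.
have [s sP] := finite_cover X_compact (fun x => (jdP x).1).
pose N := (\sum_(x <- s) (jd x).1)%N.
exists N; have fN y : f y <= e + S N y.
  have [x [xs xy]] := sP y.
  rewrite (le_trans ((jdP x).2 y xy))// lerD2l Smono// /N (big_rem x)//=.
  exact: leq_addr.
rewrite (@le_trans _ _ (L (fun y => e + S N y)))//.
  by apply: L_le => //; apply: cD => //; exact: ccst.
rewrite LD; [|exact: ccst|exact: cS].
rewrite Lcst lerD2l; have [_ ->] := @L_sum N (h^~ N) (hc^~ N).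
apply: ler_sum => i _; apply: content_ge.
by case: (hP i) => ? h1 h2 _ _; split => // x; exact: h2.
Qed.

Definition outer_content (A : set X) : R :=
  inf [set open_content U | U in [set U | open U /\ A `<=` U]].

Let outer_inf A : has_inf [set open_content U | U in [set U | open U /\ A `<=` U]].
Proof.
split; first by exists (open_content setT), setT => //; split => //; exact: openT.
by exists 0 => _ [U _ <-]; exact: content_ge0.
Qed.

Let outer_le A U : open U -> A `<=` U -> outer_content A <= open_content U.
Proof. by move=> oU AU; apply: ge_inf; [case: (outer_inf A)|exists U]. Qed.

Let outer_ge A (c : R) :
  (forall U, open U -> A `<=` U -> c <= open_content U) -> c <= outer_content A.
Proof.
by move=> H; apply: lb_le_inf; [case: (outer_inf A)|move=> _ [U [oU AU] <-]; exact: H].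
Qed.

Let outer_adh A (e : R) : 0 < e ->
  exists U, [/\ open U, A `<=` U & open_content U < outer_content A + e].
Proof.
move=> e0; have [_ [U [oU AU] <-] H] := inf_adherent e0 (outer_inf A).
by exists U.
Qed.

Let outer_open U : open U -> outer_content U = open_content U.
Proof.
move=> oU; apply/eqP; rewrite eq_le outer_le//=.
by apply: outer_ge => V _; exact: content_mono.
Qed.

Definition riesz_outer (A : set X) : \bar R := (outer_content A)%:E.

Let riesz_outer0 : riesz_outer set0 = 0%E.
Proof.
rewrite /riesz_outer outer_open; last exact: open0.
congr EFin; apply/eqP; rewrite eq_le content_ge0 andbT.
apply: content_le => f [cf _ f0]; rewrite (_ : f = fun=> 0) ?Lcst//.
by apply/funext => x; exact: f0.
Qed.

Let riesz_outer_ge0 A : (0 <= riesz_outer A)%E.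
Proof. by rewrite lee_fin; apply: outer_ge => U _ _; exact: content_ge0. Qed.

Let riesz_outer_le : {homo riesz_outer : A B / A `<=` B >-> (A <= B)%E}.
Proof.
move=> A B AB; rewrite lee_fin; apply: outer_ge => U oU BU.
by apply: outer_le => // x /AB /BU.
Qed.

Let riesz_outer_subadd : sigma_subadditive riesz_outer.
Proof.
move=> F; apply/lee_addgt0Pr => e e0.
have e20 : 0 < e / 2 by rewrite divr_gt0.
have en0 n : 0 < e / 2 / (2 ^ n.+1)%:R by rewrite !divr_gt0// ltr0n expn_gt0.
have /choice[U UP] := fun n => outer_adh (F n) (en0 n).
have oU n : open (U n) by case: (UP n).
rewrite [e]splitr EFinD addeA.
apply: (@le_trans _ _ (\sum_(0 <= n <oo) (riesz_outer (F n) +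
    (e / 2 / (2 ^ n.+1)%:R)%:E) + (e / 2)%:E)%E); last first.
  rewrite leeD2r//; apply: (@epsilon_trick _ (riesz_outer \o F) _ xpredT) => [n|].
    exact: riesz_outer_ge0.
  exact: ltW.
have oUU : open (\bigcup_n U n) by apply: bigcup_open.
apply: (@le_trans _ _ (open_content (\bigcup_n U n))%:E).
  rewrite lee_fin; apply: outer_le => // x [n _ Fx]; exists n => //.
  by case: (UP n) => _ FU _; exact: FU.
have e40 : 0 < e / 4 by rewrite divr_gt0.
have [f [fU fL]] := content_adh (\bigcup_n U n) e40.
have [N NP] := content_subadd e40 oU fU.
apply: (@le_trans _ _ ((\sum_(0 <= n < N) (riesz_outer (F n) +
    (e / 2 / (2 ^ n.+1)%:R)%:E) + (e / 2)%:E)%E)); last first.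
  rewrite leeD2r//; apply: nneseries_lim_ge => n _ _.
  by rewrite adde_ge0// lee_fin ltW.
rewrite /riesz_outer big_mkord.
under eq_bigr do rewrite -EFinD.
rewrite sumEFin -EFinD lee_fin.
apply: (@le_trans _ _ (\sum_(n < N) open_content (U n) + e / 2)); first by lra.
by rewrite lerD2r; apply: ler_sum => n _; case: (UP n) => _ _ /ltW.
Qed.

HB.instance Definition _ := isOuterMeasure.Build R X riesz_outer
  riesz_outer0 riesz_outer_ge0 riesz_outer_le riesz_outer_subadd.

(** Let [V] be an open set around [B], let [f] nearly realise the content of the part of [V] in [U],
    and let [K] be the closed set [e / 4 <= f], which lies in [U]. If [h] nearly realises the
    content of [V] minus [K], then [h] and the truncation [f' = max (f - e / 4) 0] are never both
    nonzero, so [f' + h] is still a test function for [V]. *)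
Let cara_open U : open U -> riesz_outer.-caratheodory U.
Proof.
move=> oU; apply: le_caratheodory_measurable => B.
rewrite /= -EFinD lee_fin; apply/ler_addgt0Pr => e e0.
have e40 : 0 < e / 4 by rewrite divr_gt0.
have [V [oV BV VB]] := outer_adh B e40.
have [f [[cf f01 f0] fL]] := content_adh (V `&` U) e40.
pose K := [set x | e / 4 <= f x].
have oVK : open (V `\` K).
  apply/openP => x [Vx /negP]; rewrite -ltNge => fx.
  have [d1 d10 d1P] := (openP V).1 oV x Vx.
  have fe : 0 < e / 4 - f x by rewrite subr_gt0.
  have [d2 d20 d2P] := (continuous_distP f).1 cf x _ fe.
  exists (Num.min d1 d2); first by rewrite lt_min d10.
  move=> y; rewrite lt_min => /andP[/d1P Vy /d2P]; rewrite ltr_norml => /andP[fy _].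
  by split => //; apply/negP; rewrite -ltNge; lra.
have [h [[ch h01 h0] hL]] := content_adh (V `\` K) e40.
have VKU : B `&` ~` U `<=` V `\` K.
  move=> x [Bx nUx]; split; first exact: BV.
  by rewrite /K /= f0 => [|[]//]; apply/negP; rewrite -ltNge.
have i1 : outer_content (B `&` U) <= open_content (V `&` U).
  by apply: outer_le; [exact: openI|move=> x [/BV]].
have i2 : outer_content (B `&` ~` U) <= open_content (V `\` K) by exact: outer_le.
pose f' x := Num.max (f x + - (e / 4)) 0.
have cf' : continuous f'.
  exact: (cmax (cD cf (@ccst _)) (@ccst _)).
have i3 : L f - e / 4 <= L f'.
  rewrite (_ : L f - e / 4 = L (fun x => f x + - (e / 4))); last first.
    by rewrite LD ?Lcst//; exact: ccst.
  by apply: L_le => // [|x]; [apply: cD => //; exact: ccst|rewrite le_max lexx].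
have i4 : L f' + L h <= open_content V.
  rewrite -LD//; apply: content_ge; split; first exact: cD.
    move=> x; case/andP: (f01 x) => fx0 fx1; case/andP: (h01 x) => hx0 hx1.
    have [Kx|nKx] := pselect (K x).
      rewrite h0 ?addr0; last by case.
      by rewrite /f' le_max lexx orbT /= ge_max ler01 andbT; lra.
    have : f x < e / 4 by rewrite ltNge; exact/negP.
    move=> fxe; rewrite /f' (_ : Num.max _ _ = 0); last by apply/max_idPr; lra.
    by rewrite add0r hx0.
  move=> x nVx; rewrite h0 ?addr0; last by case.
  rewrite /f' f0; last by case.
  by apply/max_idPr; lra.
by lra.
Qed.

Let cara_borel (A : set (borel X)) : measurable A -> riesz_outer.-caratheodory A.
Proof.
move: A; suff: @measurable _ (borel X) `<=` riesz_outer.-caratheodory by [].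
apply: smallest_sub; last by move=> U; exact: cara_open.
split.
- exact: (@measurable0 _ (caratheodory_type riesz_outer)).
- move=> A mA; rewrite setTD.
  exact: (@measurableC _ (caratheodory_type riesz_outer)).
- move=> F mF; exact: (@bigcupT_measurable _ (caratheodory_type riesz_outer)).
Qed.

Definition riesz_measure : set (borel X) -> \bar R := riesz_outer.

Let riesz_measure0 : riesz_measure set0 = 0%E.
Proof. exact: riesz_outer0. Qed.

Let riesz_measure_ge0 A : (0 <= riesz_measure A)%E.
Proof. exact: riesz_outer_ge0. Qed.

Let riesz_measure_sigma : semi_sigma_additive riesz_measure.
Proof.
move=> F mF tF mUF.
apply: (@caratheodory_measure_sigma_additive _ _ riesz_outer) => //.
- by move=> n; exact: cara_borel.
- exact: cara_borel.
Qed.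

HB.instance Definition _ := isMeasure.Build _ (borel X) R riesz_measure
  riesz_measure0 riesz_measure_ge0 riesz_measure_sigma.

Let riesz_measureT : riesz_measure setT = 1%E.
Proof.
rewrite /riesz_measure /riesz_outer outer_open; last exact: openT.
congr EFin; apply/eqP; rewrite eq_le; apply/andP; split.
  apply: content_le => f [cf f01 _]; rewrite -L1; apply: L_le => // x.
  by case/andP: (f01 x).
rewrite -L1; apply: content_ge; split; [exact: ccst| |by move=> x /(_ I)].
by move=> x; rewrite ler01 lexx.
Qed.

HB.instance Definition _ := Measure_isProbability.Build _ (borel X) R riesz_measure
  riesz_measureT.

(* Layer cake: [f] is within [1/N] above the sum of the indicators of
   [f > i/N], each of which dominates a slice [N f_i] of [f]. *)
Let riesz_le f : continuous f -> (forall x, 0 <= f x <= 1) ->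
  L f <= \int[riesz_measure : probability (borel X) R]_x f x.
Proof.
move=> cf f01; apply/ler_addgt0Pr => e e0.
pose m : probability (borel X) R := riesz_measure.
have [N N0 Ne] : exists2 N : nat, 0 < N%:R :> R & N%:R^-1 <= e.
  exists (Num.truncn e^-1).+1; rewrite ?ltr0n//.
  by rewrite invf_ple ?posrE// ltW// truncnS_gt.
pose s (i : nat) x := Num.min (Num.max (N%:R * f x + - i%:R) 0) 1.
have cs i : continuous (s i).
  have c1 := cD (cZ (c := N%:R) cf) (@ccst (- i%:R)).
  exact: (cmin (cmax c1 (@ccst 0)) (@ccst 1)).
have sumS (t : R) n : 0 <= t -> t <= n%:R ->
    \sum_(i < n) Num.min (Num.max (t + - i%:R) 0) 1 = t.
  elim: n t => [|n IH] t t0 tn.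
    by rewrite big_ord0; apply/eqP; rewrite eq_le t0 tn.
  rewrite big_ord_recr/=; have [tn'|tn'] := leP t n%:R.
    have -> : Num.max (t + - n%:R) 0 = 0 by apply/max_idPr; rewrite subr_le0.
    by rewrite IH// (_ : Num.min _ _ = 0) ?addr0//; exact/min_idPl/ler01.
  rewrite (eq_bigr (fun=> 1)); last first.
    move=> [i /= ilt] _; apply/min_idPr; rewrite le_max; apply/orP; left.
    by rewrite lerBrDr addrC natr1 (le_trans _ (ltW tn'))// ler_nat.
  have -> : Num.max (t + - n%:R) 0 = t - n%:R.
    by apply/max_idPl; rewrite subr_ge0 ltW.
  have -> : Num.min (t - n%:R) 1 = t - n%:R.
    by apply/min_idPl; rewrite lerBlDr addrC natr1.
  by rewrite sumr_const card_ord addrC subrK.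
pose U i : set X := [set x | i%:R < N%:R * f x].
have oU i : open (U i).
  apply/openP => x Ux; have d0 : 0 < N%:R * f x - i%:R by rewrite subr_gt0.
  have [d d0' dP] := (continuous_distP _).1 (@cZ N%:R _ cf) x _ d0.
  exists d => // y /dP; rewrite ltr_norml => /andP[_].
  by rewrite /U /= ltrD2l ltrN2.
have mU i : measurable (U i : set (borel X)) by exact: open_borel.
have sU i : L (s i) <= pr m (U i : set (borel X)).
  rewrite /pr /m/= /riesz_measure /riesz_outer/= outer_open//.
  apply: content_ge; split => // [x|x].
    by rewrite le_min ler01 le_max lexx orbT /= ge_min lexx orbT.
  rewrite /U/= => /negP; rewrite -leNgt => h.
  rewrite /s; have -> : Num.max (N%:R * f x + - i%:R) 0 = 0.
    by apply/max_idPr; rewrite subr_le0.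
  exact/min_idPl/ler01.
have -> : L f = N%:R^-1 * \sum_(i < N) L (s i).
  have [cS <-] := @L_sum N s cs; rewrite -LZ//; congr L; apply/funext => x.
  have /andP[fx0 fx1] := f01 x.
  rewrite /s sumS ?mulKf ?gt_eqF// ?mulr_ge0//.
  by rewrite -[leRHS]mulr1 ler_wpM2l.
have bf := continuous_bmf X_compact cf.
have bU i : bmf (\1_(U i) : borel X -> R) by exact: bmf_indic.
apply: (@le_trans _ _ (\int[m]_x (N%:R^-1 * \sum_(i < N) \1_(U i) x))).
  rewrite RintZ; last by apply: bmf_sum => i _; exact: bU.
  rewrite ler_wpM2l ?invr_ge0//.
  rewrite Rint_sum; last by move=> i _; exact: bU.
  by apply: ler_sum => i _; rewrite Rint_indic.
rewrite (le_trans _ (_ : \int[m]_x (f x + N%:R^-1) <= _))//; last first.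
  rewrite RintD//; last exact: bmf_cst.
  by rewrite Rint_cst lerD2l.
apply: Rint_le.
- by apply: bmfZ; apply: bmf_sum => i _; exact: bU.
- by apply: bmfD => //; exact: bmf_cst.
move=> x; rewrite -(ler_pM2l N0) mulVKf ?gt_eqF// mulrDr mulfV ?gt_eqF//.
have /andP[fx0 fx1] := f01 x.
have NN : N%:R * f x <= N%:R by rewrite -[leRHS]mulr1 ler_wpM2l.
rewrite -[X in _ <= X + _](sumS _ N)//; last by rewrite mulr_ge0.
(* The number of levels below [t] exceeds the sum of the slices by at most one; after division by
   [N] this is the error [1 / N]. *)
have cnt (t : R) n : 0 <= t -> \sum_(i < n) ((i%:R < t)%R)%:R <=
    \sum_(i < n) Num.min (Num.max (t + - i%:R) 0) 1 + 1 :> R.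
  move=> t0; elim: n => [|n IH]; first by rewrite !big_ord0 add0r ler01.
  rewrite !big_ord_recr/=.
  have [nt|nt] := leP t n%:R.
    rewrite addr0 (le_trans IH)// lerD2r lerDl.
    by rewrite le_min ler01 le_max lexx orbT.
  have -> : \sum_(i < n) ((i%:R < t)%R)%:R = n%:R :> R.
    rewrite (eq_bigr (fun=> 1)) ?sumr_const ?card_ord// => -[i /= ilt] _.
    by rewrite (lt_trans _ nt) ?ltr_nat.
  have -> : \sum_(i < n) Num.min (Num.max (t + - i%:R) 0) 1 = n%:R.
    rewrite (eq_bigr (fun=> 1)) ?sumr_const ?card_ord// => -[i /= ilt] _.
    apply/min_idPr; rewrite le_max; apply/orP; left.
    by rewrite lerBrDr addrC natr1 (le_trans _ (ltW nt))// ler_nat.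
  by rewrite lerD2r lerDl le_min ler01 le_max lexx orbT.
rewrite (le_trans _ (cnt _ N _)) ?mulr_ge0//.
apply: ler_sum => i _; rewrite indicE /U.
case: (boolP (_ \in _)) => [|_]; last by case: ltP.
by rewrite inE /= => ->.
Qed.

Lemma riesz_representation : exists m : probability (borel X) R,
  forall f, continuous f -> \int[m]_x f x = L f.
Proof.
pose m : probability (borel X) R := riesz_measure.
exists m.
(* The reverse inequality is [riesz_le] for [1 - f], both sides being affine and equal on
   constants. *)
have H01 f : continuous f -> (forall x, 0 <= f x <= 1) -> \int[m]_x f x = L f.
  move=> cf f01; apply/eqP; rewrite eq_le riesz_le// andbT.
  have c1f : continuous (fun x => 1 + (-1) * f x) by apply: cD; [exact: ccst|exact: cZ].
  have bf := continuous_bmf X_compact cf.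
  have : L (fun x => 1 + (-1) * f x) <= \int[m]_x (1 + (-1) * f x).
    by apply: riesz_le => // x; case/andP: (f01 x) => ? ?; lra.
  rewrite LD; [|exact: ccst|exact: (cZ cf)].
  rewrite LZ// Lcst RintD; [|exact: bmf_cst|exact: bmfZ].
  by rewrite RintZ// Rint_cst; lra.
move=> f cf; have [M fM] := continuous_bounded X_compact cf.
have M0 : 0 <= M by rewrite (le_trans _ (fM point)).
(* An affine change brings [f] into the interval [0, 1]; the [+ 1] covers the case [M = 0]. *)
pose c := (2 * M + 1)^-1; have c0 : 0 < c by rewrite invr_gt0; lra.
have ch : continuous (fun x => c * (f x + M)).
  exact: (cZ (cD cf (@ccst M))).
have cfM : continuous (fun x => f x + M) by exact: (cD cf (@ccst M)).
have bf := continuous_bmf X_compact cf.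
have := H01 _ ch; rewrite LZ// RintZ; last exact: continuous_bmf.
rewrite LD//.
rewrite RintD//; last exact: bmf_cst.
rewrite Rint_cst Lcst => H.
have /H/(mulfI (lt0r_neq0 c0))/addIr// : forall x, 0 <= c * (f x + M) <= 1.
move=> x; have := fM x; rewrite ler_norml => /andP[? ?].
rewrite mulr_ge0 ?(ltW c0)//=; last by lra.
by rewrite /c mulrC ler_pdivrMr; lra.
Qed.

End riesz.

(** * Densities and products *)

Section simple_approximation.
Context {R : realType} d {T : measurableType d}.

Lemma sum_nat_lt_trunc (t : R) n : 0 <= t -> t <= n%:R ->
  t - 1 <= \sum_(i < n) ((i.+1%:R <= t)%R)%:R <= t.
Proof.
move=> t0 tn; rewrite (_ : \sum_(i < n) _ = (Num.truncn t)%:R).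
  have /andP[? ?] := truncn_itv t0.
  apply/andP; split=> //; rewrite lerBlDr natr1; exact: ltW.
have tle : (Num.truncn t <= n)%N.
  by rewrite -(ler_nat R) (le_trans _ tn)// truncn_le.
rewrite -[in LHS](subnKC tle) big_split_ord/= [X in X + _](eq_bigr (fun=> 1)).
  rewrite [X in _ + X]big1 ?addr0 ?sumr_const ?card_ord// => -[i /= ilt] _.
  by rewrite leNgt (lt_le_trans (truncnS_gt t))// ler_nat ltnS leq_addr.
move=> [i /= ilt] _; rewrite (le_trans _ (_ : (Num.truncn t)%:R <= _))//.
  by rewrite ler_nat.
by rewrite truncn_le.
Qed.

Lemma bmf_approx (f : T -> R) : bmf f -> forall e : R, 0 < e ->
  exists (b : R) n (A : 'I_n -> set T), (forall i, measurable (A i)) /\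
    forall x, `|f x - (b + \sum_(i < n) e * \1_(A i) x)| <= e.
Proof.
move=> [mf [M fM]] e e0.
have fM' x : - M <= f x <= M by rewrite -ler_norml.
pose g x := (f x + M) / e.
have g0 x : 0 <= g x.
  by rewrite divr_ge0 ?(ltW e0)//; case/andP: (fM' x) => ? ?; lra.
have [n gn] : exists n : nat, forall x, g x <= n%:R.
  exists (Num.truncn (2 * M / e)).+1 => x.
  rewrite (le_trans _ (ltW (truncnS_gt _)))// ler_pM2r ?invr_gt0//.
  by case/andP: (fM' x) => ? ?; lra.
have mg : measurable_fun setT g.
  by apply: measurable_funM => //; apply: measurable_funD.
exists (- M), n, (fun i => [set x | i.+1%:R <= g x]); split.
  move=> i; rewrite (_ : mkset _ = g @^-1` [set` `[i.+1%:R, +oo[]); last first.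
    by apply/seteqP; split=> x /=; rewrite in_itv/= andbT.
  by rewrite -[X in measurable X]setTI; apply: mg => //; exact: measurable_itv.
move=> x; rewrite -big_distrr/=.
rewrite (eq_bigr (fun i : 'I_n => ((i.+1%:R <= g x)%R)%:R)); last first.
  move=> i _; rewrite indicE; congr (nat_of_bool _)%:R.
  by apply/idP/idP; rewrite inE.
have /andP[s1 s2] := sum_nat_lt_trunc (g0 x) (gn x).
set S := \sum_(i < n) _ in s1 s2 *.
have fg : f x = e * g x - M by rewrite /g mulrC divfK ?gt_eqF// addrK.
have -> : f x - (- M + e * S) = e * (g x - S) by rewrite fg; ring.
rewrite normrM gtr0_norm// -[leRHS]mulr1 ler_pM2l//.
by rewrite ger0_norm; lra.
Qed.

End simple_approximation.

Section density.
Context {R : realType} d {T : measurableType d} d' {Y : measurableType d'}.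
Variables (P : probability T R) (F : T -> Y) (k : T -> R).
Hypothesis mF : measurable_fun setT F.
Hypothesis bk : bmf k.
Hypothesis k0 : forall x, 0 <= k x.
Hypothesis k1 : \int[P]_x k x = 1.

Definition density_measure (A : set Y) : \bar R :=
  (\int[P]_(x in F @^-1` A) (k x)%:E)%E.

Let mFA A : measurable A -> measurable (F @^-1` A).
Proof. by move=> mA; rewrite -[X in measurable X]setTI; exact: mF. Qed.

Let mk D : measurable_fun D (EFin \o k).
Proof. by apply/measurable_EFinP/measurable_funTS; case: bk. Qed.

Let density0 : density_measure set0 = 0%E.
Proof. by rewrite /density_measure preimage_set0 integral_set0. Qed.

Let density_ge0 A : (0 <= density_measure A)%E.
Proof. by apply: integral_ge0 => x _; rewrite lee_fin. Qed.

Let density_sigma : semi_sigma_additive density_measure.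
Proof.
move=> /= G mG tG mUG; rewrite /density_measure preimage_bigcup.
rewrite ge0_integral_bigcup//=.
- apply: is_cvg_ereal_nneg_natsum_cond => n _ _.
  by apply: integral_ge0 => x _; rewrite lee_fin.
- by move=> n; exact: mFA.
- by move=> x _; rewrite lee_fin.
- apply/trivIsetP => i j _ _ ij; rewrite -preimage_setI.
  by move/trivIsetP : tG => /(_ _ _ I I ij) ->; rewrite preimage_set0.
Qed.

HB.instance Definition _ := isMeasure.Build _ Y R density_measure
  density0 density_ge0 density_sigma.

Let densityT : density_measure setT = 1%E.
Proof.
rewrite /density_measure preimage_setT.
have := bmf_integrable P bk => /integrable_fin_num.
by move=> /(_ measurableT)/fineK <-; congr EFin.
Qed.

HB.instance Definition _ := Measure_isProbability.Build _ Y R density_measure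
  densityT.

(** The source of the constructed couplings: [k = 1] gives images of measures, such as a coupling
    with its coordinates exchanged, and a nonconstant [k] on a product of measures gives glued and
    reweighted couplings. The formula holds for indicators by definition and extends by uniform
    approximation with simple functions. *)
Lemma density_probability : exists Q : probability Y R,
  forall f, bmf f -> \int[Q]_y f y = \int[P]_x (f (F x) * k x).
Proof.
pose Q : probability Y R := density_measure; exists Q.
have bcomp (f : Y -> R) : bmf f -> bmf (f \o F).
  by move=> [mf [M fM]]; split; [exact: measurableT_comp|exists M => x /=].
have Qind A : measurable A -> \int[Q]_y \1_A y = \int[P]_x (\1_A (F x) * k x).
  move=> mA; rewrite Rint_indic// /pr /Q/= /density_measure.
  rewrite -[LHS]/(\int[P]_(x in F @^-1` A) k x) Rintegral_mkcond.
  apply: Rint_eq => x; rewrite patchE indicE.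
  have -> : (x \in F @^-1` A) = (F x \in A) by apply/idP/idP; rewrite !inE.
  by case: (_ \in _); rewrite ?mul1r ?mul0r.
move=> f bf; apply/eqP; rewrite -subr_eq0 -normr_eq0; apply/eqP.
apply/eqP; rewrite eq_le normr_ge0 andbT; apply/ler_addgt0Pr => e e0; rewrite add0r.
have e20 : 0 < e / 2 by rewrite divr_gt0.
have [b [n [A [mA fA]]]] := bmf_approx bf e20.
pose s y := b + \sum_(i < n) e / 2 * \1_(A i) y.
have bA i : bmf (\1_(A i) : Y -> R) by exact: bmf_indic.
have bAF i : bmf (fun x => \1_(A i) (F x) * k x).
  by apply: bmfM => //; exact: (bcomp _ (bA i)).
have bsum : bmf (fun y => \sum_(i < n) e / 2 * \1_(A i) y).
  by apply: bmf_sum => i _; exact: bmfZ.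
have bs : bmf s by apply: bmfD => //; exact: bmf_cst.
have sE : \int[Q]_y s y = \int[P]_x (s (F x) * k x).
  rewrite RintD//; last exact: bmf_cst.
  rewrite Rint_cst Rint_sum; last by move=> i _; exact: bmfZ.
  rewrite [RHS](_ : _ = \int[P]_x (b * k x +
      \sum_(i < n) (e / 2) * (\1_(A i) (F x) * k x))); last first.
    apply: Rint_eq => x; rewrite mulrDl mulr_suml; congr (_ + _).
    by apply: eq_bigr => i _; rewrite mulrA.
  rewrite RintD; [|exact: bmfZ|by apply: bmf_sum => i _; exact: bmfZ].
  rewrite RintZ// k1 mulr1 Rint_sum; last by move=> i _; exact: bmfZ.
  congr (_ + _); apply: eq_bigr => i _.
  by rewrite !RintZ// Qind.
have h1 : `|\int[Q]_y f y - \int[Q]_y s y| <= e / 2.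
  by apply: Rint_dist.
have bfk : bmf (fun x => f (F x) * k x) by apply: bmfM => //; exact: (bcomp f).
have bsk : bmf (fun x => s (F x) * k x) by apply: bmfM => //; exact: (bcomp s).
have h2 : `|\int[P]_x (f (F x) * k x) - \int[P]_x (s (F x) * k x)| <= e / 2.
  rewrite -RintB// ler_norml.
  have fsn x : - (e / 2) <= f (F x) - s (F x) <= e / 2 by rewrite -ler_norml; exact: fA.
  have -> : - (e / 2) = \int[P]_x (- (e / 2) * k x) by rewrite RintZ// k1 mulr1.
  have -> : \int[P]_x (f (F x) * k x - s (F x) * k x) =
      \int[P]_x ((f (F x) - s (F x)) * k x) by apply: Rint_eq => x; ring.
  have bfs : bmf (fun x => (f (F x) - s (F x)) * k x).
    by apply: bmfM => //; apply: bmfB; [exact: (bcomp f)|exact: (bcomp s)].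
  apply/andP; split.
    apply: Rint_le => //; first exact: bmfZ.
    by move=> x; rewrite ler_wpM2r//; case/andP: (fsn x).
  apply: (@le_trans _ _ (\int[P]_x (e / 2 * k x))); last by rewrite RintZ// k1 mulr1.
  apply: Rint_le => //; first exact: bmfZ.
  by move=> x; rewrite ler_wpM2r//; case/andP: (fsn x).
rewrite -(subrK (\int[Q]_y s y) (\int[Q]_y f y)) {2}sE -addrA.
rewrite (le_trans (ler_normD _ _))// [e]splitr lerD//.
by rewrite distrC.
Qed.

End density.

Section product_prob.
Context {R : realType} d {T : measurableType d} d' {Y : measurableType d'}.
Variables (P : probability T R) (Q : probability Y R).

Definition product_prob : probability (T * Y)%type R := (P \x Q)%E.

Lemma bmf_fst (u : T -> R) : bmf u -> bmf (fun z : T * Y => u z.1).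
Proof.
move=> [mu [M uM]]; split; last by exists M => z.
by apply: measurableT_comp => //; exact: measurable_fst.
Qed.

Lemma bmf_snd (u : Y -> R) : bmf u -> bmf (fun z : T * Y => u z.2).
Proof.
move=> [mu [M uM]]; split; last by exists M => z.
by apply: measurableT_comp => //; exact: measurable_snd.
Qed.

Lemma Rint_product (u : T -> R) (v : Y -> R) : bmf u -> bmf v ->
  \int[product_prob]_z (u z.1 * v z.2) = (\int[P]_x u x) * \int[Q]_y v y.
Proof.
move=> bu bv; rewrite mulrC -RintZ//.
have buv : bmf (fun z : T * Y => u z.1 * v z.2).
  by apply: bmfM; [exact: bmf_fst|exact: bmf_snd].
rewrite {1}/Rintegral.
have /= <- := integral12_prod_meas1 (bmf_integrable product_prob buv).
rewrite [RHS]/Rintegral; congr fine; apply: eq_integral => x _.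
rewrite /fubini_F/=.
have bux : bmf (fun y => u x * v y) by exact: bmfZ.
rewrite -[LHS]fineK; last first.
  exact: (integrable_fin_num measurableT (bmf_integrable Q bux)).
by congr EFin; rewrite -/(Rintegral Q setT (fun y => u x * v y)) RintZ// mulrC.
Qed.

End product_prob.

Section image.
Context {R : realType} d {T : measurableType d} d' {Y : measurableType d'}.

Lemma Rint_image (P : probability T R) (Q : probability Y R) (F : T -> Y) :
  measurable_fun setT F ->
  (forall A, measurable A -> pr P (F @^-1` A) = pr Q A) ->
  forall f, bmf f -> bmf (f \o F) /\ \int[P]_x f (F x) = \int[Q]_y f y.
Proof.
move=> mF PQ f bf.
have bcomp (h : Y -> R) : bmf h -> bmf (h \o F).
  by move=> [mh [M hM]]; split; [exact: measurableT_comp|exists M => x /=].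
split; first exact: bcomp.
apply/eqP; rewrite -subr_eq0 -normr_eq0 eq_le normr_ge0 andbT.
apply/ler_addgt0Pr => e e0; rewrite add0r.
have e20 : 0 < e / 2 by rewrite divr_gt0.
have [b [n [A [mA fA]]]] := bmf_approx bf e20.
pose s y := b + \sum_(i < n) e / 2 * \1_(A i) y.
have bA i : bmf (\1_(A i) : Y -> R) by exact: bmf_indic.
have bAF i : bmf (fun x => \1_(A i) (F x) : R) by exact: (bcomp _ (bA i)).
have bsum : bmf (fun y => \sum_(i < n) e / 2 * \1_(A i) y).
  by apply: bmf_sum => i _; exact: bmfZ.
have bs : bmf s by apply: bmfD => //; exact: bmf_cst.
have sE : \int[P]_x s (F x) = \int[Q]_y s y.
  rewrite (RintD P (bmf_cst b) (bcomp _ bsum)) (RintD Q (bmf_cst b) bsum).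
  rewrite !Rint_cst !Rint_sum; [|by move=> i _; exact: bmfZ|by move=> i _; exact: bmfZ].
  congr (_ + _); apply: eq_bigr => i _; rewrite !RintZ//.
  rewrite [in RHS]Rint_indic// -PQ// -Rint_indic; last first.
    by rewrite -[X in measurable X]setTI; exact: mF.
  congr (_ * _); apply: Rint_eq => x; rewrite !indicE.
rewrite -(subrK (\int[P]_x s (F x)) (\int[P]_x f (F x))) {2}sE -addrA.
rewrite (le_trans (ler_normD _ _))// [e]splitr lerD//.
  by apply: Rint_dist; [exact: (bcomp _ bf)|exact: (bcomp _ bs)|move=> x; exact: fA].
by rewrite distrC; apply: Rint_dist.
Qed.

End image.

(** * Measurability of the distance for the product of the Borel sigma-algebras *)

Section measurable_dist.
Context {R : realType} {X : pmetricType R}.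
Hypothesis X_compact : compact [set: X].

(* On a compact space the distance is the pointwise limit of
   [min_q (d(x, q) + d(q, y))], [q] ranging over finer and finer nets. *)
Lemma measurable_mdist :
  measurable_fun setT (fun z : borel X * borel X => (mdist z.1 z.2 : R)).
Proof.
have n0 n : 0 < n.+1%:R^-1 :> R by rewrite invr_gt0 ltr0n.
have /choice[net netP] := fun n => finite_net X_compact (n0 n).
have [D DP] : exists D : R, forall x y : X, mdist x y <= D.
  have [M MP] := continuous_bounded X_compact (@set_dist_continuous _ _ [set point]).
  have Mp (x : X) : mdist x point <= M.
    have := MP x; rewrite ger0_norm ?set_dist_ge0//; apply: le_trans.
    apply: lb_le_inf; first by exists (mdist x point), point.
    by move=> _ [y -> <-].
  exists (M + M) => x y; rewrite (le_trans (metric_triangle x point y))// lerD//.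
  by rewrite metric_sym.
pose h n (z : borel X * borel X) : R :=
  \big[Num.min/D]_(q <- net n) (mdist (z.1 : X) q + mdist q (z.2 : X)).
have mq (q : X) : measurable_fun setT (fun x : borel X => (mdist (x : X) q : R)).
  apply: continuous_borel; apply: (@continuous_lip _ _ _ 1) => x y.
  rewrite mul1r ler_norml; apply/andP; split.
    by rewrite lerBrDr addrC lerBlDr addrC (metric_sym x y) metric_triangle.
  by rewrite lerBlDr metric_triangle.
apply: (@measurable_fun_cvg _ _ _ _ h).
  move=> n; rewrite /h; elim: (net n) => [|q s IH].
    apply: (eq_measurable_fun (fun=> D)) => [z _|]; first by rewrite big_nil.
    exact: measurable_cst.
  apply: (eq_measurable_fun (fun z : borel X * borel X =>
      Num.min (mdist (z.1 : X) q + mdist q (z.2 : X))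
      (\big[Num.min/D]_(q <- s) (mdist (z.1 : X) q + mdist q (z.2 : X))))).
    by move=> z _; rewrite big_cons.
  apply: measurable_minr => //; apply: measurable_funD.
    by apply: (measurableT_comp (mq q)); exact: measurable_fst.
  apply: (eq_measurable_fun (fun z : borel X * borel X => (mdist (z.2 : X) q : R))).
    by move=> z _; rewrite metric_sym.
  by apply: (measurableT_comp (mq q)); exact: measurable_snd.
move=> [x y] _ /=.
have hge n : mdist (x : X) (y : X) <= h n (x, y).
  rewrite /h; elim/big_ind : _ => //= [u v ? ?|q _]; first by rewrite le_min; apply/andP.
  exact: metric_triangle.
have hle n : h n (x, y) <= mdist (x : X) (y : X) + 2 * n.+1%:R^-1.
  have [q [qs qx]] := netP n (x : X).
  rewrite /h (le_trans (@ge_bigmin_seq _ _ _ _ _ q _ _ qs isT))//=.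
  have := metric_triangle q (x : X) (y : X); rewrite (metric_sym q x) => tri.
  move: qx; rewrite (metric_sym q x) => qx.
  by move: (mdist _ _) (mdist _ _) (n.+1%:R^-1) (mdist _ _) tri qx => a b c e; lra.
apply/cvgrPdist_le => e e0; near=> n.
rewrite distrC ger0_norm ?subr_ge0//.
rewrite lerBlDl (le_trans (hle n))// lerD2l -ler_pdivlMl//.
near: n; have [N _ NP] := near_infty_natSinv_lt (PosNum (divr_gt0 e0 (ltr0n R 2))).
exists N => // n /NP /= /ltW; rewrite mulrC; exact.
Unshelve. all: by end_near. Qed.

End measurable_dist.

(** * The Wasserstein distance *)

Section partitions.
Context {R : realType} {X : pmetricType R}.
Hypothesis X_compact : compact [set: X].

Lemma small_partition (r : R) : 0 < r -> exists n (xi : X -> 'I_n),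
  (forall i, measurable (xi @^-1` [set i] : set (borel X))) /\
  forall x y, xi x = xi y -> mdist x y < r.
Proof.
move=> r0; have [|s sP] := @finite_net _ _ X_compact (r / 2).
  by rewrite divr_gt0.
pose p (x q : X) := mdist q x < r / 2.
have hs x : (find (p x) s < size s)%N.
  by rewrite -has_find; apply/hasP; have [q [qs qx]] := sP x; exists q.
exists (size s), (fun x => Ordinal (hs x)); split.
  move=> i; pose B j : set (borel X) := [set x | p x (nth point s j)].
  have mB j : measurable (B j) by apply: open_borel; exact: open_mball.
  rewrite (_ : _ @^-1` _ = B i `&` ~` \bigcup_(j in [set j | (j < i)%N]) B j).
    by apply: measurableI => //; apply: measurableC; exact: bigcup_measurable.
  apply/seteqP; split=> x /=.
    move=> /(congr1 val)/= fi; split.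
      by rewrite /B/= -fi; apply: nth_find; rewrite has_find.
    by move=> [j /= ji]; rewrite /B/= before_find// fi.
  move=> [Bi nB]; apply/val_inj => /=; apply/eqP; rewrite eqn_leq; apply/andP; split.
    by rewrite leqNgt; apply/negP => /(before_find point); rewrite [p _ _]Bi.
  rewrite leqNgt; apply/negP => fi; apply: nB; exists (find (p x) s) => //.
  by apply: nth_find; rewrite has_find.
move=> x y /(congr1 val)/= xy.
have px : p x (nth point s (find (p x) s)) by apply: nth_find; rewrite has_find.
have py : p y (nth point s (find (p x) s)) by rewrite xy; apply: nth_find; rewrite has_find.
rewrite (le_lt_trans (metric_triangle _ (nth point s (find (p x) s)) _))//.
by rewrite [r]splitr ltrD// metric_sym.
Qed.

(** Tents of radius [2 * r] over a net of mesh [r] have sum at least 1/2, and dividing by this sum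
    at most doubles the Lipschitz bounds of the numerator and of the sum. The Lipschitz constant is
    recorded explicitly, as [W_holder_bound] has to weigh the size of the net against the scale. *)
Lemma partition_of_unity (s : seq X) (r : R) : 0 < r ->
  (forall y, exists x, x \in s /\ mdist x y < r) ->
  exists f : 'I_(size s) -> X -> R,
    [/\ forall i x, 0 <= f i x, forall x, \sum_i f i x = 1,
        forall i x, f i x != 0 -> mdist (nth point s i) x < 2 * r,
        forall i x, f i x <= 1 &
        forall i x y, `|f i x - f i y| <= (1 + (size s)%:R) / r * mdist x y].
Proof.
move=> r0 sP.
have r20 : 0 < 2 * r by rewrite mulr_gt0.
pose b (i : 'I_(size s)) x := Num.max 0 (1 - mdist (nth point s i) x / (2 * r)).
have b0 i x : 0 <= b i x by rewrite le_max lexx.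
have b1 i x : b i x <= 1.
  by rewrite ge_max ler01 /= lerBlDr lerDl divr_ge0 ?mdist_ge0// ltW.
pose S x := \sum_i b i x.
have S12 x : 2^-1 <= S x.
  have [q [qs qx]] := sP x; have si : (index q s < size s)%N by rewrite index_mem.
  rewrite /S (bigD1 (Ordinal si))//= (@le_trans _ _ (b (Ordinal si) x))//.
    rewrite /b /= nth_index// le_max; apply/orP; right.
    rewrite lerBrDr -lerBrDl ler_pdivrMr// mulrA.
    rewrite (_ : (1 - 2^-1) * 2 = 1 :> R); last by lra.
    by rewrite mul1r ltW.
  by rewrite lerDl sumr_ge0.
have S0 x : 0 < S x by apply: lt_le_trans (S12 x); rewrite invr_gt0.
have bS i x : b i x <= S x by rewrite /S (bigD1 i)//= lerDl sumr_ge0.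
have blip i x y : `|b i x - b i y| <= mdist x y / (2 * r).
  have tri (u v w : X) : mdist u v / (2 * r) - mdist u w / (2 * r) <= mdist v w / (2 * r).
    rewrite -mulrBl ler_pM2r ?invr_gt0// lerBlDl (metric_sym v w).
    exact: metric_triangle.
  have := tri (nth point s i) x y; have := tri (nth point s i) y x.
  rewrite (metric_sym y x) /b; move: (mdist (nth point s i) x / (2 * r))
    (mdist (nth point s i) y / (2 * r)) (mdist x y / (2 * r)) => A B C h1 h2.
  by rewrite /Num.max; case: ltP => ?; case: ltP => ?; rewrite ler_norml;
    apply/andP; split; lra.
have Slip x y : `|S x - S y| <= (size s)%:R * (mdist x y / (2 * r)).
  rewrite /S -sumrB (le_trans (ler_norm_sum _ _ _))//.
  rewrite (le_trans (ler_sum _ (fun i _ => blip i x y)))//.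
  by rewrite sumr_const card_ord -[leLHS]mulr_natl.
exists (fun i x => b i x / S x); split.
- by move=> i x; rewrite divr_ge0// ltW.
- by move=> x; rewrite -mulr_suml -/(S x) divff ?gt_eqF.
- move=> i x; apply: contraNT; rewrite -leNgt => h; rewrite mulf_eq0; apply/orP; left.
  by apply/eqP/max_idPl; rewrite subr_le0 ler_pdivlMr// mul1r.
- by move=> i x; rewrite ler_pdivrMr// mul1r.
move=> i x y.
have -> : b i x / S x - b i y / S y =
    (b i x - b i y) / S x + (b i y / S y) * ((S y - S x) / S x).
  by field; rewrite !gt_eqF.
have Sinv : (S x)^-1 <= 2.
  by rewrite -[leRHS]invrK lef_pV2 ?posrE ?invr_gt0.
rewrite (le_trans (ler_normD _ _))//.
have -> : (1 + (size s)%:R) / r * mdist x y =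
    mdist x y / (2 * r) * 2 + 1 * ((size s)%:R * (mdist x y / (2 * r)) * 2).
  by field; rewrite gt_eqF.
rewrite lerD// !normrM.
  by rewrite ler_pM// gtr0_norm// invr_gt0.
rewrite !normfV !ler_pM// ?mulr_ge0 ?invr_ge0//.
- rewrite (gtr0_norm (S0 y)) ger0_norm//; by rewrite ler_pdivrMr// mul1r.
- by rewrite distrC.
- by rewrite gtr0_norm.
Qed.

End partitions.

Section wasserstein.
Context {R : realType} {X : pmetricType R}.
Hypothesis X_compact : compact [set: X].
Local Notation prob := (probability (borel X) R).
Local Notation XX := (borel X * borel X)%type.
Variable delta : X -> X -> R.
Hypothesis delta_meas : measurable_fun setT (fun z : XX => delta z.1 z.2).
Hypothesis delta01 : forall x y, 0 <= delta x y <= 1.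
Hypothesis delta_sym : forall x y, delta x y = delta y x.
Hypothesis delta_tri : forall x y z, delta x z <= delta x y + delta y z.
Hypothesis delta_cont : forall e : R, 0 < e -> exists2 r : R, 0 < r &
  forall x y, mdist x y < r -> delta x y <= e.

Local Notation W := (wasserstein delta).

Let bdelta : bmf (fun z : XX => delta z.1 z.2).
Proof.
split => //; exists 1 => z; have /andP[d0 d1] := delta01 z.1 z.2.
by rewrite ger0_norm.
Qed.

Lemma coupling_pr (m nu : prob) (P : probability XX R) :
  (forall A : set (borel X), measurable A -> \int[P]_z \1_A z.1 = pr m A) ->
  (forall A : set (borel X), measurable A -> \int[P]_z \1_A z.2 = pr nu A) ->
  is_coupling m nu P.
Proof.
move=> H1 H2 A mA; split.
  rewrite (pr_fin m mA) -H1// (pr_fin P (measurableX mA measurableT)).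
  congr EFin; rewrite -Rint_indic; last exact: measurableX.
  apply: Rint_eq => z; rewrite !indicE; congr (nat_of_bool _)%:R.
  by apply/idP/idP; rewrite !inE => h; [case: h|split].
rewrite (pr_fin nu mA) -H2// (pr_fin P (measurableX measurableT mA)).
congr EFin; rewrite -Rint_indic; last exact: measurableX.
apply: Rint_eq => z; rewrite !indicE; congr (nat_of_bool _)%:R.
by apply/idP/idP; rewrite !inE => h; [case: h|split].
Qed.

Lemma coupling_fst (m nu : prob) P : is_coupling m nu P ->
  forall f : borel X -> R, bmf f -> \int[P]_z f z.1 = \int[m]_x f x.
Proof.
move=> cP f bf; apply: (Rint_image (F := fst) _ _ bf).2 => //.
move=> A mA; have [+ _] := cP A mA; rewrite /pr => <-; congr (fine (P _)).
by apply/seteqP; split=> [z|z []].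
Qed.

Lemma coupling_snd (m nu : prob) P : is_coupling m nu P ->
  forall f : borel X -> R, bmf f -> \int[P]_z f z.2 = \int[nu]_x f x.
Proof.
move=> cP f bf; apply: (Rint_image (F := snd) _ _ bf).2 => //.
move=> A mA; have [_ +] := cP A mA; rewrite /pr => <-; congr (fine (P _)).
by apply/seteqP; split=> [z|z []].
Qed.

Lemma coupling_product (m nu : prob) : is_coupling m nu (product_prob m nu).
Proof.
apply: coupling_pr => A mA.
  have := Rint_product m nu (bmf_indic mA) (@bmf_cst R _ (borel X) 1).
  rewrite Rint_cst mulr1 Rint_indic// => <-.
  by apply: Rint_eq => z; rewrite mulr1.
have := Rint_product m nu (@bmf_cst R _ (borel X) 1) (bmf_indic mA).
rewrite Rint_cst mul1r Rint_indic// => <-.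
by apply: Rint_eq => z; rewrite mul1r.
Qed.

Let W_has_inf (m nu : prob) :
  has_inf [set \int[P]_z delta z.1 z.2 | P in is_coupling m nu].
Proof.
split.
  by exists (\int[product_prob m nu]_z delta z.1 z.2), (product_prob m nu) => //;
    exact: coupling_product.
exists 0 => _ [P _ <-]; apply: Rint_ge0 => z.
by case/andP: (delta01 z.1 z.2).
Qed.

Lemma W_le (m nu : prob) P : is_coupling m nu P ->
  W m nu <= \int[P]_z delta z.1 z.2.
Proof. by move=> cP; apply: ge_inf; [case: (W_has_inf m nu)|exists P]. Qed.

Lemma W_adh (m nu : prob) (e : R) : 0 < e ->
  exists2 P, is_coupling m nu P & \int[P]_z delta z.1 z.2 < W m nu + e.
Proof.
move=> e0; have [_ [P cP <-] H] := inf_adherent e0 (W_has_inf m nu).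
by exists P.
Qed.

Lemma W_ge0 (m nu : prob) : 0 <= W m nu.
Proof.
apply: lb_le_inf; first by case: (W_has_inf m nu).
move=> _ [P _ <-]; apply: Rint_ge0 => z.
by case/andP: (delta01 z.1 z.2).
Qed.

Lemma W_sym (m nu : prob) : W m nu = W nu m.
Proof.
suff H (m1 m2 : prob) : W m1 m2 <= W m2 m1 by apply/eqP; rewrite eq_le !H.
apply/ler_addgt0Pr => e e0; have [P cP PW] := W_adh m2 m1 e0.
apply: le_trans (ltW PW).
have mswap : measurable_fun setT (fun z : XX => (z.2, z.1)).
  by apply: measurable_fun_pair; [exact: measurable_snd|exact: measurable_fst].
have [//|||Q QE] := @density_probability _ _ _ _ _ P _ (fun=> 1) mswap.
- exact: bmf_cst.
- by move=> _; exact: ler01.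
- by rewrite Rint_cst.
have cQ : is_coupling m1 m2 Q.
  apply: coupling_pr => A mA.
    rewrite (QE (fun z => \1_A z.1)); last exact: (bmf_fst (bmf_indic mA)).
    rewrite -Rint_indic// -(coupling_snd cP (bmf_indic mA)).
    by apply: Rint_eq => z /=; rewrite mulr1.
  rewrite (QE (fun z => \1_A z.2)); last exact: (bmf_snd (bmf_indic mA)).
  rewrite -Rint_indic// -(coupling_fst cP (bmf_indic mA)).
  by apply: Rint_eq => z /=; rewrite mulr1.
rewrite (le_trans (W_le cQ))// (QE _ bdelta).
rewrite le_eqVlt; apply/orP; left; apply/eqP; apply: Rint_eq => z /=.
by rewrite mulr1 delta_sym.
Qed.

(* Two couplings are glued along a finite partition [xi] into small cells,
   with density [sum_i 1_(A_i)(y) 1_(A_i)(y') / nu(A_i)] with respect to their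
   product. *)
Lemma W_triangle (m nu rho : prob) : W m rho <= W m nu + W nu rho.
Proof.
apply/ler_addgt0Pr => e e0.
have e30 : 0 < e / 3 by rewrite divr_gt0.
have [P cP PW] := W_adh m nu e30; have [Q cQ QW] := W_adh nu rho e30.
have [r r0 rP] := delta_cont e30.
have [n [xi [mxi xiP]]] := small_partition X_compact r0.
pose A i : set (borel X) := xi @^-1` [set i].
have mA i : measurable (A i) by exact: mxi.
have bA i : bmf (\1_(A i) : borel X -> R) by exact: bmf_indic.
(* For a null cell the inverse is 0 by convention. Nothing is lost: such a cell carries no mass of
   [P] or [Q], whose common marginal is [nu]. *)
pose c i := (pr nu (A i))^-1.
have c0 i : 0 <= c i by rewrite invr_ge0 pr_ge0.
have cA i : c i * pr nu (A i) <= 1.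
  rewrite /c; have [->|nz] := eqVneq (pr nu (A i)) 0; first by rewrite mulr0 ler01.
  by rewrite mulVf.
have Ax i (x : borel X) : \1_(A i) x = (xi x == i)%:R :> R.
  by rewrite indicE; congr (nat_of_bool _)%:R; apply/idP/idP; rewrite inE => /eqP.
pose PQ := product_prob P Q.
pose k (w : XX * XX) : R := \sum_i c i * (\1_(A i) w.1.2 * \1_(A i) w.2.1).
have bk1 i : bmf (fun w : XX * XX => \1_(A i) w.1.2 * \1_(A i) w.2.1 : R).
  by apply: bmfM; [exact: (bmf_fst (bmf_snd (bA i)))|exact: (bmf_snd (bmf_fst (bA i)))].
have bk : bmf k by apply: bmf_sum => i _; exact: bmfZ.
have k0 w : 0 <= k w by apply: sumr_ge0 => i _; rewrite !mulr_ge0 ?Ax.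
have PA i : \int[P]_z \1_(A i) z.2 = pr nu (A i).
  by rewrite (coupling_snd cP (bA i)) Rint_indic.
have QA i : \int[Q]_z \1_(A i) z.1 = pr nu (A i).
  by rewrite (coupling_fst cQ (bA i)) Rint_indic.
have fib (u : XX -> R) (v : XX -> R) i : bmf u -> bmf v ->
    \int[PQ]_w ((u w.1 * v w.2) * (c i * (\1_(A i) w.1.2 * \1_(A i) w.2.1))) =
    c i * ((\int[P]_z (u z * \1_(A i) z.2)) * \int[Q]_z (v z * \1_(A i) z.1)).
  move=> bu bv.
  have b1 : bmf (fun z : XX => u z * \1_(A i) z.2) by apply: bmfM => //; exact: bmf_snd.
  have b2 : bmf (fun z : XX => v z * \1_(A i) z.1) by apply: bmfM => //; exact: bmf_fst.
  rewrite -(Rint_product P Q b1 b2) -RintZ; last first.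
    by apply: bmfM; [exact: (bmf_fst b1)|exact: (bmf_snd b2)].
  by apply: Rint_eq => w /=; ring.
have fibk (u : XX -> R) (v : XX -> R) : bmf u -> bmf v ->
    \int[PQ]_w ((u w.1 * v w.2) * k w) =
    \sum_i c i * ((\int[P]_z (u z * \1_(A i) z.2)) * \int[Q]_z (v z * \1_(A i) z.1)).
  move=> bu bv; under eq_bigr do rewrite -fib//.
  rewrite -Rint_sum; last first.
    move=> i _; apply: bmfM; last by exact: bmfZ.
    by apply: bmfM; [exact: bmf_fst|exact: bmf_snd].
  by apply: Rint_eq => w; rewrite mulr_sumr.
have b1 d (T : measurableType d) : bmf ((fun=> 1) : T -> R) by exact: bmf_cst.
have sumA (z : borel X) : \sum_i \1_(A i) z = 1 :> R.
  rewrite (bigD1 (xi z))//= big1 ?Ax ?eqxx ?addr0// => i iz.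
  by rewrite Ax eq_sym (negbTE iz).
have fibl (u : XX -> R) : bmf u -> (forall z, 0 <= u z <= 1) ->
    \int[PQ]_w (u w.1 * k w) = \int[P]_z u z.
  move=> bu u01; have := fibk u (fun=> 1) bu (b1 _ _).
  rewrite (_ : \int[PQ]_w _ = \int[PQ]_w (u w.1 * k w)); last first.
    by apply: Rint_eq => w; rewrite mulr1.
  move=> ->; rewrite (_ : \int[P]_z u z = \sum_i \int[P]_z (u z * \1_(A i) z.2)).
    apply: eq_bigr => i _.
    rewrite [X in _ * (_ * X)](_ : _ = pr nu (A i)); last first.
      by rewrite -QA; apply: Rint_eq => z; rewrite mul1r.
    rewrite mulrCA /c; have [nuA|nz] := eqVneq (pr nu (A i)) 0; last first.
      by rewrite mulVf// mulr1.
    rewrite nuA !mulr0; apply/esym/eqP; rewrite eq_le; apply/andP; split.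
      rewrite -nuA -PA; apply: Rint_le; [|exact: (bmf_snd (bA i))|].
        by apply: bmfM => //; exact: (bmf_snd (bA i)).
      by move=> z; rewrite ler_piMl ?Ax//; case/andP: (u01 z).
    by apply: Rint_ge0 => z; rewrite mulr_ge0 ?Ax//; case/andP: (u01 z).
  rewrite -Rint_sum; last by move=> i _; apply: bmfM => //; exact: (bmf_snd (bA i)).
  by apply: Rint_eq => z; rewrite -mulr_sumr sumA mulr1.
have fibr (v : XX -> R) : bmf v -> (forall z, 0 <= v z <= 1) ->
    \int[PQ]_w (v w.2 * k w) = \int[Q]_z v z.
  move=> bv v01; have := fibk (fun=> 1) v (b1 _ _) bv.
  rewrite (_ : \int[PQ]_w _ = \int[PQ]_w (v w.2 * k w)); last first.
    by apply: Rint_eq => w; rewrite mul1r.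
  move=> ->; rewrite (_ : \int[Q]_z v z = \sum_i \int[Q]_z (v z * \1_(A i) z.1)).
    apply: eq_bigr => i _.
    rewrite [X in _ * (X * _)](_ : _ = pr nu (A i)); last first.
      by rewrite -PA; apply: Rint_eq => z; rewrite mul1r.
    rewrite mulrA /c; have [nuA|nz] := eqVneq (pr nu (A i)) 0; last first.
      by rewrite mulVf// mul1r.
    rewrite nuA mulr0 mul0r; apply/esym/eqP; rewrite eq_le; apply/andP; split.
      rewrite -nuA -QA; apply: Rint_le; [|exact: (bmf_fst (bA i))|].
        by apply: bmfM => //; exact: (bmf_fst (bA i)).
      by move=> z; rewrite ler_piMl ?Ax//; case/andP: (v01 z).
    by apply: Rint_ge0 => z; rewrite mulr_ge0 ?Ax//; case/andP: (v01 z).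
  rewrite -Rint_sum; last by move=> i _; apply: bmfM => //; exact: (bmf_fst (bA i)).
  by apply: Rint_eq => z; rewrite -mulr_sumr sumA mulr1.
have k1 : \int[PQ]_w k w = 1.
  rewrite -[RHS](Rint_cst P) -(fibl (fun=> 1) (b1 _ _)); last first.
    by move=> z; rewrite ler01 lexx.
  by apply: Rint_eq => w; rewrite mul1r.
have mF : measurable_fun setT (fun w : XX * XX => (w.1.1, w.2.2) : XX).
  apply: measurable_fun_pair.
    by apply: (measurableT_comp measurable_fst measurable_fst).
  by apply: (measurableT_comp measurable_snd measurable_snd).
have [S SE] := density_probability mF bk k0 k1.
have ind01 (B : set (borel X)) (x : borel X) : (0 : R) <= \1_B x <= 1.
  by rewrite indicE ler0n -[leRHS]/(1%:R) ler_nat leq_b1.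
have cS : is_coupling m rho S.
  apply: coupling_pr => B mB; have bB := @bmf_indic R _ _ _ mB.
    rewrite (SE (fun z => \1_B z.1)); last exact: (bmf_fst bB).
    rewrite -Rint_indic// -(coupling_fst cP bB).
    by rewrite -(fibl (fun z => \1_B z.1)) => [//||z]; [exact: bmf_fst|exact: ind01].
  rewrite (SE (fun z => \1_B z.2)); last exact: (bmf_snd bB).
  rewrite -Rint_indic// -(coupling_snd cQ bB).
  by rewrite -(fibr (fun z => \1_B z.2)) => [//||z]; [exact: bmf_snd|exact: ind01].
rewrite (le_trans (W_le cS))// (SE _ bdelta) /=.
have bd1 : bmf (fun w : XX * XX => delta w.1.1 w.1.2 * k w).
  by apply: bmfM => //; exact: (bmf_fst bdelta).
have bd2 : bmf (fun w : XX * XX => delta w.2.1 w.2.2 * k w).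
  by apply: bmfM => //; exact: (bmf_snd bdelta).
have bek : bmf (fun w => e / 3 * k w) by exact: bmfZ.
apply: (@le_trans _ _ (\int[PQ]_w (delta w.1.1 w.1.2 * k w +
    delta w.2.1 w.2.2 * k w + e / 3 * k w))); last first.
  rewrite RintD//; last exact: bmfD.
  rewrite RintD// RintZ// k1 mulr1.
  rewrite (fibl (fun z => delta z.1 z.2))// (fibr (fun z => delta z.1 z.2))//.
  by lra.
apply: Rint_le.
- apply: bmfM => //; split; last first.
    exists 1 => w; have /andP[d0 d1] := delta01 w.1.1 w.2.2.
    by rewrite ger0_norm.
  exact: (measurableT_comp delta_meas mF).
- by apply: bmfD => //; exact: bmfD.
(* Where the density [k] is nonzero the two middle points share a cell, hence are at
   [delta]-distance at most [e / 3], and the triangle inequality applies twice; elsewhere both sides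
   are 0. *)
move=> w; rewrite -!mulrDl; have [eqw|neqw] := eqVneq (xi w.1.2) (xi w.2.1).
  rewrite ler_wpM2r//.
  have := rP _ _ (xiP _ _ eqw); have := delta_tri w.1.1 w.1.2 w.2.2.
  by have := delta_tri w.1.2 w.2.1 w.2.2; lra.
rewrite (_ : k w = 0) ?mulr0// /k big1// => i _; rewrite !Ax.
have [<-|] := eqVneq (xi w.1.2) i; last by rewrite mul0r mulr0.
by rewrite eq_sym (negbTE neqw) !mulr0.
Qed.

(** The easy half of Kantorovich duality. The additive [e] admits functions that are not Lipschitz
    for [delta] and are only controlled by a modulus of continuity. *)
Lemma W_integral (m nu : prob) (f : X -> R) (e K : R) : continuous f -> 0 <= K ->
  (forall x y, `|f x - f y| <= e + K * delta x y) ->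
  `|\int[m]_x f x - \int[nu]_x f x| <= e + K * W m nu.
Proof.
move=> cf K0 fe; have bf := continuous_bmf X_compact cf.
apply/ler_addgt0Pr => t t0.
have tK : 0 < t / (K + 1) by rewrite divr_gt0// ltr_wpDl.
have [P cP PW] := W_adh m nu tK.
rewrite -(coupling_fst cP bf) -(coupling_snd cP bf).
rewrite -RintB; [|exact: (bmf_fst bf)|exact: (bmf_snd bf)].
have bd : bmf (fun z : XX => e + K * delta z.1 z.2).
  by apply: bmfD; [exact: bmf_cst|exact: bmfZ].
have bff : bmf (fun z : XX => f z.1 - f z.2).
  by apply: bmfB; [exact: (bmf_fst bf)|exact: (bmf_snd bf)].
have Ie : \int[P]_z (e + K * delta z.1 z.2) = e + K * \int[P]_z delta z.1 z.2.
  by rewrite RintD ?Rint_cst ?RintZ//; [exact: bmf_cst|exact: bmfZ].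
have le1 : e + K * \int[P]_z delta z.1 z.2 <= e + K * W m nu + t.
  rewrite -addrA lerD2l (@le_trans _ _ (K * (W m nu + t / (K + 1))))//.
    by rewrite ler_wpM2l// ltW.
  rewrite mulrDr lerD2l mulrCA ler_piMr// ?(ltW t0)//.
  by rewrite ler_pdivrMr ?mul1r ?lerDl// ltr_wpDl.
have fen z : - (e + K * delta z.1 z.2) <= f z.1 - f z.2 <= e + K * delta z.1 z.2.
  by rewrite -ler_norml.
rewrite ler_norml; apply/andP; split; last first.
  apply: le_trans le1; rewrite -Ie; apply: Rint_le => // z.
  by case/andP: (fen z).
rewrite lerNl (le_trans _ le1)// -Ie -[leLHS]mulN1r -RintZ//.
apply: Rint_le => //; first exact: bmfZ.
by move=> z; rewrite mulN1r lerNl; case/andP: (fen z).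
Qed.

(* The common mass [min (c_i, c'_i)] of the two measures on the [i]-th member of
   a partition of unity is coupled there; the remainders are coupled
   independently. *)
Lemma W_partition_bound (m nu : prob) (I : finType) (f : I -> X -> R) (r : R) :
  (forall i, continuous (f i)) -> (forall i x, 0 <= f i x) ->
  (forall x, \sum_i f i x = 1) ->
  (forall i x y, f i x != 0 -> f i y != 0 -> delta x y <= r) -> 0 <= r ->
  W m nu <= r + \sum_i `|\int[m]_x f i x - \int[nu]_x f i x|.
Proof.
move=> cf f0 f1 fr r0.
have bf i : bmf (f i : borel X -> R) by exact: continuous_bmf.
pose c i := \int[m]_x f i x; pose c' i := \int[nu]_x f i x.
have c0 i : 0 <= c i by apply: Rint_ge0.
have c'0 i : 0 <= c' i by apply: Rint_ge0.
have sc : \sum_i c i = 1.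
  rewrite -Rint_sum// -[RHS](Rint_cst m); exact: Rint_eq.
have sc' : \sum_i c' i = 1.
  rewrite -Rint_sum// -[RHS](Rint_cst nu); exact: Rint_eq.
pose mi i := Num.min (c i) (c' i).
have mi0 i : 0 <= mi i by rewrite le_min c0 c'0.
have mic i : mi i <= c i by rewrite ge_min lexx.
have mic' i : mi i <= c' i by rewrite ge_min lexx orbT.
pose w i := mi i / (c i * c' i).
have w0 i : 0 <= w i by rewrite divr_ge0// mulr_ge0.
(* The mass left once the common part is coupled. Both remainders [rho] and [rho'] below have
   integral [tau], hence the factor [tau^-1] in front of their product. *)
pose tau := 1 - \sum_i mi i.
pose q i := 1 - mi i / c i; pose q' i := 1 - mi i / c' i.
have ratio (x y : R) : 0 <= y -> y <= x -> 0 <= y / x <= 1 /\ x * (1 - y / x) = x - y.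
  move=> y0 yx; have x0 := le_trans y0 yx.
  have [xz|xn] := eqVneq x 0.
    have -> : y = 0 by apply/eqP; rewrite eq_le y0 -xz yx.
    by rewrite xz mul0r mul0r subrr lexx ler01.
  have xp : 0 < x by rewrite lt_neqAle eq_sym xn.
  split; first by rewrite divr_ge0//= ler_pdivrMr// mul1r.
  by field.
have q0 i : 0 <= q i by rewrite subr_ge0; case: (ratio _ _ (mi0 i) (mic i)) => /andP[].
have q'0 i : 0 <= q' i by rewrite subr_ge0; case: (ratio _ _ (mi0 i) (mic' i)) => /andP[].
have cq i : c i * q i = c i - mi i by case: (ratio _ _ (mi0 i) (mic i)).
have cq' i : c' i * q' i = c' i - mi i by case: (ratio _ _ (mi0 i) (mic' i)).
pose rho x := \sum_i q i * f i x; pose rho' x := \sum_i q' i * f i x.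
have brho : bmf (rho : borel X -> R) by apply: bmf_sum => i _; exact: bmfZ.
have brho' : bmf (rho' : borel X -> R) by apply: bmf_sum => i _; exact: bmfZ.
have rho0 x : 0 <= rho x by apply: sumr_ge0 => i _; rewrite mulr_ge0.
have rho'0 x : 0 <= rho' x by apply: sumr_ge0 => i _; rewrite mulr_ge0.
have Irho : \int[m]_x rho x = tau.
  rewrite Rint_sum; last by move=> i _; exact: bmfZ.
  rewrite /tau -sc -sumrB; apply: eq_bigr => i _.
  by rewrite RintZ// mulrC cq.
have Irho' : \int[nu]_x rho' x = tau.
  rewrite Rint_sum; last by move=> i _; exact: bmfZ.
  rewrite /tau -sc' -sumrB; apply: eq_bigr => i _.
  by rewrite RintZ// mulrC cq'.
have tau0 : 0 <= tau by rewrite -Irho; exact: Rint_ge0.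
pose PQ := product_prob m nu.
pose k (z : XX) : R := \sum_i w i * (f i z.1 * f i z.2) + tau^-1 * (rho z.1 * rho' z.2).
have bff i : bmf (fun z : XX => f i z.1 * f i z.2).
  by apply: bmfM; [exact: (bmf_fst (bf i))|exact: (bmf_snd (bf i))].
have brr : bmf (fun z : XX => rho z.1 * rho' z.2).
  by apply: bmfM; [exact: (bmf_fst brho)|exact: (bmf_snd brho')].
have bs : bmf (fun z : XX => \sum_i w i * (f i z.1 * f i z.2)).
  by apply: bmf_sum => i _; exact: bmfZ.
have bk : bmf k by apply: bmfD => //; exact: bmfZ.
have k0 z : 0 <= k z.
  rewrite addr_ge0//; last by rewrite mulr_ge0 ?invr_ge0// mulr_ge0.
  by apply: sumr_ge0 => i _; rewrite mulr_ge0// mulr_ge0.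
have marg (u v : borel X -> R) : bmf u -> bmf v ->
    \int[PQ]_z (u z.1 * v z.2 * k z) =
    \sum_i w i * ((\int[m]_x (u x * f i x)) * \int[nu]_x (v x * f i x)) +
    tau^-1 * ((\int[m]_x (u x * rho x)) * \int[nu]_x (v x * rho' x)).
  move=> bu bv.
  have buf i : bmf (fun x => u x * f i x) by apply: bmfM.
  have bvf i : bmf (fun x => v x * f i x) by apply: bmfM.
  have bur : bmf (fun x => u x * rho x) by apply: bmfM.
  have bvr : bmf (fun x => v x * rho' x) by apply: bmfM.
  have buvf i : bmf (fun z : XX => (u z.1 * f i z.1) * (v z.2 * f i z.2)).
    by apply: bmfM; [exact: (bmf_fst (buf i))|exact: (bmf_snd (bvf i))].
  have buvr : bmf (fun z : XX => (u z.1 * rho z.1) * (v z.2 * rho' z.2)).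
    by apply: bmfM; [exact: (bmf_fst bur)|exact: (bmf_snd bvr)].
  rewrite -(Rint_product m nu bur bvr) -RintZ//.
  under [in RHS]eq_bigr do rewrite -(Rint_product m nu (buf _) (bvf _)) -RintZ//.
  rewrite -Rint_sum; last by move=> i _; exact: bmfZ.
  rewrite -RintD; [|by apply: bmf_sum => i _; exact: bmfZ|exact: bmfZ].
  apply: Rint_eq => z; rewrite /k mulrDr mulr_sumr; congr (_ + _); last by ring.
  by apply: eq_bigr => i _; ring.
have b1 d (T : measurableType d) : bmf ((fun=> 1) : T -> R) by exact: bmf_cst.
(* This sum is the factor with which [f i] enters the first marginal, and it has to be 1. If
   [c i = 0], then [f i] has integral 0 for [m] and the term vanishes whatever its factor is. *)
have coef i : w i * c' i + q i = 1 \/ c i = 0.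
  have [ci|ci] := eqVneq (c i) 0; [by right|left].
  rewrite /w /q; have [c'i|c'i] := eqVneq (c' i) 0.
    rewrite c'i !mulr0 add0r (_ : mi i = 0) ?mul0r ?subr0//.
    by apply/eqP; rewrite eq_le mi0 -c'i mic'.
  by field; rewrite ci c'i.
have coef' i : w i * c i + q' i = 1 \/ c' i = 0.
  have [ci|ci] := eqVneq (c' i) 0; [by right|left].
  rewrite /w /q'; have [c'i|c'i] := eqVneq (c i) 0.
    rewrite c'i mulr0 add0r (_ : mi i = 0) ?mul0r ?subr0//.
    by apply/eqP; rewrite eq_le mi0 -c'i mic.
  by field; rewrite ci c'i.
(* If [tau = 0] its inverse is 0, but then [t] is 0 as well. *)
have taur (t : R) : 0 <= t -> t <= tau -> tau^-1 * (t * tau) = t.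
  move=> t0 tt; have [tz|tz] := eqVneq tau 0; last by rewrite mulrC mulfK.
  by rewrite tz mulr0 mulr0; apply/eqP; rewrite eq_le t0 /= -tz.
have m1 (u : borel X -> R) : bmf u -> (forall x, 0 <= u x <= 1) ->
    \int[PQ]_z (u z.1 * k z) = \int[m]_x u x.
  move=> bu u01; have := marg u (fun=> 1) bu (b1 _ _).
  rewrite (_ : \int[PQ]_z _ = \int[PQ]_z (u z.1 * k z)); last first.
    by apply: Rint_eq => z; rewrite mulr1.
  move=> ->.
  rewrite (_ : \int[nu]_x (1 * rho' x) = tau); last first.
    by rewrite -Irho'; apply: Rint_eq => x; rewrite mul1r.
  have bur : bmf (fun x => u x * rho x) by apply: bmfM.
  rewrite taur; first last.
  - rewrite -Irho; apply: Rint_le => // x.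
    by rewrite ler_piMl//; case/andP: (u01 x).
  - by apply: Rint_ge0 => x; rewrite mulr_ge0//; case/andP: (u01 x).
  have -> : \int[m]_x (u x * rho x) = \sum_i q i * \int[m]_x (u x * f i x).
    rewrite (eq_bigr (fun i => \int[m]_x (q i * (u x * f i x)))); last first.
      by move=> i _; rewrite RintZ//; exact: bmfM.
    rewrite -Rint_sum; last by move=> i _; apply: bmfZ; exact: bmfM.
    apply: Rint_eq => x; rewrite /rho mulr_sumr; apply: eq_bigr => i _.
    by rewrite mulrCA.
  rewrite -big_split/=.
  have -> : \int[m]_x u x = \sum_i \int[m]_x (u x * f i x).
    rewrite -Rint_sum; last by move=> i _; exact: bmfM.
    by apply: Rint_eq => x; rewrite -mulr_sumr f1 mulr1.
  apply: eq_bigr => i _.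
  rewrite (_ : \int[nu]_x (1 * f i x) = c' i); last first.
    by apply: Rint_eq => x; rewrite mul1r.
  have ui : 0 <= \int[m]_x (u x * f i x) <= c i.
    rewrite Rint_ge0/= ?Rint_le// => [|x|x].
    - exact: bmfM.
    - by rewrite ler_piMl//; case/andP: (u01 x).
    - by rewrite mulr_ge0//; case/andP: (u01 x).
  have [cf'|ci] := coef i; last first.
    move: ui; rewrite ci => /andP[u0 ule].
    have -> : \int[m]_x (u x * f i x) = 0 by apply/eqP; rewrite eq_le ule u0.
    by rewrite mul0r !mulr0 addr0.
  by rewrite [X in w i * X]mulrC mulrA -mulrDl cf' mul1r.
have m2 (v : borel X -> R) : bmf v -> (forall x, 0 <= v x <= 1) ->
    \int[PQ]_z (v z.2 * k z) = \int[nu]_x v x.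
  move=> bv v01; have := marg (fun=> 1) v (b1 _ _) bv.
  rewrite (_ : \int[PQ]_z _ = \int[PQ]_z (v z.2 * k z)); last first.
    by apply: Rint_eq => z; rewrite mul1r.
  move=> ->.
  rewrite (_ : \int[m]_x (1 * rho x) = tau); last first.
    by rewrite -Irho; apply: Rint_eq => x; rewrite mul1r.
  have bvr : bmf (fun x => v x * rho' x) by apply: bmfM.
  rewrite [tau * _]mulrC taur; first last.
  - rewrite -Irho'; apply: Rint_le => // x.
    by rewrite ler_piMl//; case/andP: (v01 x).
  - by apply: Rint_ge0 => x; rewrite mulr_ge0//; case/andP: (v01 x).
  have -> : \int[nu]_x (v x * rho' x) = \sum_i q' i * \int[nu]_x (v x * f i x).
    rewrite (eq_bigr (fun i => \int[nu]_x (q' i * (v x * f i x)))); last first.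
      by move=> i _; rewrite RintZ//; exact: bmfM.
    rewrite -Rint_sum; last by move=> i _; apply: bmfZ; exact: bmfM.
    apply: Rint_eq => x; rewrite /rho' mulr_sumr; apply: eq_bigr => i _.
    by rewrite mulrCA.
  rewrite -big_split/=.
  have -> : \int[nu]_x v x = \sum_i \int[nu]_x (v x * f i x).
    rewrite -Rint_sum; last by move=> i _; exact: bmfM.
    by apply: Rint_eq => x; rewrite -mulr_sumr f1 mulr1.
  apply: eq_bigr => i _.
  rewrite (_ : \int[m]_x (1 * f i x) = c i); last first.
    by apply: Rint_eq => x; rewrite mul1r.
  have vi : 0 <= \int[nu]_x (v x * f i x) <= c' i.
    rewrite Rint_ge0/= ?Rint_le// => [|x|x].
    - exact: bmfM.
    - by rewrite ler_piMl//; case/andP: (v01 x).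
    - by rewrite mulr_ge0//; case/andP: (v01 x).
  have [cf'|ci] := coef' i; last first.
    move: vi; rewrite ci => /andP[v0 vle].
    have -> : \int[nu]_x (v x * f i x) = 0 by apply/eqP; rewrite eq_le vle v0.
    by rewrite !mulr0 addr0.
  by rewrite mulrA -mulrDl cf' mul1r.
have k1 : \int[PQ]_z k z = 1.
  rewrite -[RHS](Rint_cst m) -(m1 (fun=> 1) (b1 _ _)); last first.
    by move=> z; rewrite ler01 lexx.
  by apply: Rint_eq => z; rewrite mul1r.
have mid : measurable_fun setT (fun z : XX => z) by exact: measurable_id.
have [S SE] := density_probability mid bk k0 k1.
have ind01 (B : set (borel X)) (x : borel X) : (0 : R) <= \1_B x <= 1.
  by rewrite indicE ler0n -[leRHS]/(1%:R) ler_nat leq_b1.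
have cS : is_coupling m nu S.
  apply: coupling_pr => B mB; have bB := @bmf_indic R _ _ _ mB.
    rewrite (SE (fun z => \1_B z.1)); last exact: (bmf_fst bB).
    by rewrite -Rint_indic// -(m1 _ bB) => [//|z]; exact: ind01.
  rewrite (SE (fun z => \1_B z.2)); last exact: (bmf_snd bB).
  by rewrite -Rint_indic// -(m2 _ bB) => [//|z]; exact: ind01.
rewrite (le_trans (W_le cS))// (SE _ bdelta) /=.
apply: (@le_trans _ _ (\int[PQ]_z (r * (\sum_i w i * (f i z.1 * f i z.2)) +
    tau^-1 * (rho z.1 * rho' z.2)))).
  apply: Rint_le; [exact: bmfM|by apply: bmfD; exact: bmfZ|].
  move=> z; rewrite /k mulrDr lerD//; last first.
    rewrite ler_piMl//; last by case/andP: (delta01 z.1 z.2).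
    by rewrite mulr_ge0 ?invr_ge0// mulr_ge0.
  rewrite !mulr_sumr; apply: ler_sum => i _.
  have [fz1|fz1] := eqVneq (f i z.1) 0; first by rewrite fz1 mul0r !mulr0.
  have [fz2|fz2] := eqVneq (f i z.2) 0; first by rewrite fz2 !mulr0.
  by rewrite ler_wpM2r ?(fr i)// mulr_ge0// mulr_ge0.
rewrite RintD; [|exact: bmfZ|exact: bmfZ].
rewrite !RintZ// Rint_product// Irho Irho' Rint_sum; last by move=> i _; exact: bmfZ.
have t1 : tau^-1 * (tau * tau) <= tau by rewrite taur.
rewrite lerD//.
  rewrite ler_piMr//.
  have mi1 : \sum_i mi i <= 1 by rewrite -sc; apply: ler_sum.
  apply: le_trans mi1; apply: ler_sum => i _; rewrite RintZ// Rint_product//.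
  rewrite -/(c i) -/(c' i) /w; have [->|nz] := eqVneq (c i * c' i) 0; first by rewrite mulr0.
  by rewrite divfK.
rewrite (le_trans t1)// /tau -sc -sumrB; apply: ler_sum => i _.
rewrite -/(c i) -/(c' i) /mi /Num.min; case: ltP => h.
  by rewrite subrr.
exact: ler_norm.
Qed.

End wasserstein.

(** * Snowflake metrics *)

Section powR_facts.
Context {R : realType}.
Variable alpha : R.
Hypothesis alpha_gt0 : 0 < alpha.
Hypothesis alpha_le1 : alpha <= 1.

(** A number of the unit interval is at most its [alpha]-th power; apply this to the fractions
    [x / (x + y)] and [y / (x + y)], which add up to 1. *)
Lemma powR_le_add (x y : R) : 0 <= x -> 0 <= y ->
  (x + y) `^ alpha <= x `^ alpha + y `^ alpha.
Proof.
move=> x0 y0; have [s0|s0] := leP (x + y) 0.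
  have -> : x + y = 0 by apply/eqP; rewrite eq_le s0 addr_ge0.
  by rewrite powR0 ?gt_eqF// addr_ge0// powR_ge0.
have sn : x + y != 0 by rewrite gt_eqF.
have H (z : R) : 0 <= z -> z <= x + y -> z / (x + y) * (x + y) `^ alpha <= z `^ alpha.
  move=> z0 zs; have [->|zn] := eqVneq z 0; first by rewrite !mul0r powR_ge0.
  have zp : 0 < z by rewrite lt_neqAle eq_sym zn.
  rewrite -[in leRHS](divfK sn z) powRM ?divr_ge0 ?(ltW s0)//.
  rewrite ler_wpM2r ?powR_ge0// ger1_powR//.
  by rewrite divr_gt0//= ler_pdivrMr// mul1r.
have := H x x0; have := H y y0; rewrite lerDl lerDr => /(_ x0) hy /(_ y0) hx.
apply: le_trans (lerD hx hy).
by rewrite -mulrDl -mulrDl divff// mul1r.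
Qed.

Lemma powR_le_id (x : R) : 0 <= x -> x <= 1 -> x <= x `^ alpha.
Proof.
move=> x0 x1; have [->|xn] := eqVneq x 0; first exact: powR_ge0.
by rewrite ger1_powR// lt_neqAle eq_sym xn x0.
Qed.

Lemma powR_lt_small (e : R) : 0 < e ->
  exists2 r : R, 0 < r & forall x, 0 <= x -> x < r -> x `^ alpha < e.
Proof.
move=> e0; exists (e `^ alpha^-1); first exact: powR_gt0.
move=> x x0 xr; rewrite -[ltRHS]powRr1 ?ltW//.
rewrite -[X in e `^ X](@mulVf _ alpha) ?gt_eqF// powRrM.
by rewrite gt0_ltr_powR// nnegrE// powR_ge0.
Qed.

End powR_facts.

Section dstar_metric.
Context {R : realType} {X : pmetricType R}.
Hypothesis X_compact : compact [set: X].
Local Notation prob := (probability (borel X) R).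
Local Notation XX := (borel X * borel X)%type.
Variables (alpha D : R).
Hypothesis alpha_gt0 : 0 < alpha.
Hypothesis alpha_le1 : alpha <= 1.
Hypothesis D_gt0 : 0 < D.

(** [dstar] with its constant left free, since the metric and coupling arguments ask only that it be
    positive. *)
Definition snow (x y : X) : R := Num.min 1 (D * mdist x y `^ alpha).

Lemma snow_meas : measurable_fun setT (fun z : XX => snow z.1 z.2).
Proof.
apply: measurable_minr; first exact: measurable_cst.
apply: measurable_funM; first exact: measurable_cst.
apply: (@measurableT_comp _ _ _ _ _ _ (@powR R ^~ alpha)).
  exact: measurable_powR.
exact: measurable_mdist.
Qed.

Lemma snow01 x y : 0 <= snow x y <= 1.
Proof.
rewrite le_min ler01 ge_min lexx /= andbT.
by rewrite mulr_ge0 ?powR_ge0// ltW.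
Qed.

Lemma snow_sym x y : snow x y = snow y x.
Proof. by rewrite /snow metric_sym. Qed.

Lemma snow_le x y : snow x y <= D * mdist x y `^ alpha.
Proof. by rewrite ge_min lexx orbT. Qed.

Lemma snow_tri x y z : snow x z <= snow x y + snow y z.
Proof.
have tri : D * mdist x z `^ alpha <= D * mdist x y `^ alpha + D * mdist y z `^ alpha.
  rewrite -mulrDr ler_wpM2l ?(ltW D_gt0)//.
  apply: le_trans (powR_le_add alpha_gt0 alpha_le1 (mdist_ge0 _ _) (mdist_ge0 _ _)).
  rewrite ge0_ler_powR ?(ltW alpha_gt0) ?nnegrE ?addr_ge0 ?mdist_ge0//.
  exact: metric_triangle.
have /andP[xy0 xy1] := snow01 x y; have /andP[yz0 yz1] := snow01 y z.
have /andP[xz0 xz1] := snow01 x z.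
move: tri xy0 xy1 yz0 yz1 xz0 xz1; rewrite /snow.
move: (D * _) (D * _) (D * _) => A B C.
by rewrite /Num.min; case: ltP => ?; case: ltP => ?; case: ltP => ? *; lra.
Qed.

Lemma snow_cont (e : R) : 0 < e -> exists2 r : R, 0 < r &
  forall x y, mdist x y < r -> snow x y <= e.
Proof.
move=> e0; have [r r0 rP] := powR_lt_small alpha_gt0 (divr_gt0 e0 D_gt0).
exists r => // x y xy; rewrite (le_trans (snow_le x y))//.
by rewrite mulrC -ler_pdivlMr// ltW// rP// mdist_ge0.
Qed.

Local Notation W := (wasserstein snow).

Let Wle := W_le snow01.
Definition snow_W_ge0 := @W_ge0 R X snow snow01.
Definition snow_W_sym := W_sym snow_meas snow01 snow_sym.
Definition snow_W_triangle := W_triangle X_compact snow_meas snow01 snow_tri snow_cont.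

Lemma W_integral_continuous (f : X -> R) : continuous f -> forall e : R, 0 < e ->
  exists2 K : R, 0 <= K & forall m nu : prob,
    `|\int[m]_x f x - \int[nu]_x f x| <= e + K * W m nu.
Proof.
move=> cf e e0; have [d d0 dP] := continuous_unif X_compact cf e0.
have [M MP] := continuous_bounded X_compact cf.
have M0 : 0 <= M by rewrite (le_trans _ (MP point)).
(* Points at distance at least [d] have [snow] at least [t], so that [2 * M / t * snow] dominates
   the range of [f] there; closer points are covered by uniform continuity. *)
pose t := Num.min 1 (D * d `^ alpha).
have t0 : 0 < t by rewrite lt_min ltr01 mulr_gt0// powR_gt0.
exists (2 * M / t); first by rewrite divr_ge0 ?mulr_ge0// ltW.
move=> m nu; apply: (W_integral X_compact snow_meas snow01) => //.
  by rewrite divr_ge0 ?mulr_ge0// ltW.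
move=> x y; have /andP[s0 s1] := snow01 x y.
have [xy|xy] := ltP (mdist x y) d.
  by rewrite (le_trans (ltW (dP _ _ xy)))// lerDl mulr_ge0// divr_ge0 ?mulr_ge0// ltW.
have ts : t <= snow x y.
  rewrite /t /snow le_min ge_min lexx /= ge_min; apply/orP; right.
  rewrite ler_pM2l// ge0_ler_powR ?(ltW alpha_gt0) ?nnegrE ?mdist_ge0//.
  by rewrite ltW.
rewrite (le_trans (ler_normB _ _))// (@le_trans _ _ (2 * M))//.
  by have := MP x; have := MP y; lra.
rewrite (@le_trans _ _ (2 * M / t * snow x y))//; last by rewrite lerDr ltW.
by rewrite mulrAC ler_pdivlMr// ler_wpM2l// mulr_ge0.
Qed.

Lemma W_weak_cvg (m_ : nat -> prob) (m : prob) :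
  W (m_ n) m @[n --> \oo] --> (0 : R) -> weak_cvg m_ m.
Proof.
move=> Wm f cf; apply/cvgrPdist_lt => e e0.
have e20 : 0 < e / 2 by rewrite divr_gt0.
have [K K0 KP] := W_integral_continuous cf e20.
have K1 : 0 < e / 2 / (K + 1) by rewrite divr_gt0// ltr_wpDl.
move/cvgrPdist_lt : Wm => /(_ _ K1); apply: filterS => n.
rewrite sub0r normrN ger0_norm ?snow_W_ge0// => h.
rewrite distrC (le_lt_trans (KP _ _))// [ltRHS]splitr ltrD2l.
apply: (@le_lt_trans _ _ ((K + 1) * W (m_ n) m)).
  by rewrite ler_wpM2r ?snow_W_ge0// lerDl.
by rewrite mulrC -ltr_pdivlMr// ltr_wpDl.
Qed.

Lemma W_eq0_integral (m nu : prob) : W m nu = 0 ->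
  forall f : X -> R, continuous f -> \int[m]_x f x = \int[nu]_x f x.
Proof.
move=> W0 f cf; apply/eqP; rewrite -subr_eq0 -normr_eq0 eq_le normr_ge0 andbT.
apply/ler_addgt0Pr => e e0; rewrite add0r.
have [K K0 KP] := W_integral_continuous cf e0.
by rewrite (le_trans (KP m nu))// W0 mulr0 addr0.
Qed.

Let net_bound (s : seq X) (r : R) (m nu : prob) (f : 'I_(size s) -> X -> R) :
  0 < r -> (forall i, continuous (f i)) -> (forall i x, 0 <= f i x) ->
  (forall x, \sum_i f i x = 1) ->
  (forall i x, f i x != 0 -> mdist (nth point s i) x < 2 * r) ->
  W m nu <= D * (4 * r) `^ alpha + \sum_i `|\int[m]_x f i x - \int[nu]_x f i x|.
Proof.
move=> r0 cf f0 f1 fr.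
apply: (W_partition_bound X_compact snow_meas snow01) => //; last first.
  by rewrite mulr_ge0 ?powR_ge0// ltW.
move=> i x y /fr fx /fr fy; rewrite (le_trans (snow_le x y))//.
rewrite ler_pM2l// ge0_ler_powR ?(ltW alpha_gt0) ?nnegrE ?mdist_ge0//.
  by rewrite mulr_ge0// ltW.
rewrite (le_trans (metric_triangle x (nth point s i) y))// metric_sym.
by move: fx fy; lra.
Qed.

Lemma weak_cvg_W (m_ : nat -> prob) (m : prob) :
  weak_cvg m_ m -> W (m_ n) m @[n --> \oo] --> (0 : R).
Proof.
move=> wm; apply/cvgrPdist_lt => e e0.
have e20 : 0 < e / 2 by rewrite divr_gt0.
have [r4 r40 r4P] := powR_lt_small alpha_gt0 (divr_gt0 e20 D_gt0).
have r80 : 0 < r4 / 8 by rewrite divr_gt0.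
have [s sP] := finite_net X_compact r80.
have [f [f0 f1 fr fle flip]] := partition_of_unity r80 sP.
have cf i : continuous (f i) by exact: continuous_lip (flip i).
have small : D * (4 * (r4 / 8)) `^ alpha < e / 2.
  rewrite mulrC -ltr_pdivlMr// r4P//; first by rewrite mulr_ge0// ltW.
  by move: r40; lra.
have : \sum_i `|\int[m_ n]_x f i x - \int[m]_x f i x| @[n --> \oo] --> (0 : R).
  rewrite -[X in _ --> X](_ : \sum_(i < size s) 0 = 0); last by rewrite big1.
  apply: cvg_big => [|i _]; first exact: add_continuous.
  rewrite -[X in _ --> X](@normr0 _ R).
  apply: cvg_norm; rewrite -[X in _ --> X](subrr (\int[m]_x f i x)).
  by apply: cvgB; [exact: wm|exact: cvg_cst].
move/cvgrPdist_lt/(_ _ e20); apply: filterS => n.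
rewrite distrC subr0 ger0_norm ?sumr_ge0// => h.
rewrite distrC subr0 ger0_norm; last exact: snow_W_ge0.
rewrite (le_lt_trans (net_bound _ _ r80 cf f0 f1 fr))// [ltRHS]splitr.
by rewrite ltrD.
Qed.

(** A substitute for Kantorovich duality: the hypothesis is tested only on the members of a
    partition of unity at scale [r]. The first term is the cost of transport inside one member; the
    second sums the discrepancies over the net. The scale [r] stays free and is optimised in
    [mu_so_W]. *)
Lemma W_holder_bound (s : seq X) (r eps : R) (m nu : prob) :
  0 < r -> r <= 1 -> (forall y, exists x, x \in s /\ mdist x y < r) ->
  (forall (f : X -> R) (H : R), 0 <= H -> (forall x, 0 <= f x <= 1) ->
    (forall x y, `|f x - f y| <= H * mdist x y `^ alpha) ->
    `|\int[m]_x f x - \int[nu]_x f x| <= eps * (1 + H)) ->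
  W m nu <= D * (4 * r) `^ alpha + (size s)%:R * (eps * (1 + (1 + (size s)%:R) / r)).
Proof.
move=> r0 r1 sP H.
have [f [f0 f1 fr fle flip]] := partition_of_unity r0 sP.
have cf i : continuous (f i) by exact: continuous_lip (flip i).
rewrite (le_trans (net_bound _ _ r0 cf f0 f1 fr))// lerD2l.
set L := (1 + (size s)%:R) / r.
(* With [L >= 1] the Lipschitz bound is also a Holder bound with the same constant: up to distance 1
   because a power [alpha <= 1] only increases numbers below 1, and beyond it because the values lie
   in [0, 1]. *)
have L1 : 1 <= L by rewrite ler_pdivlMr// mul1r (le_trans r1)// lerDl.
have L0 : 0 <= L by exact: le_trans L1.
rewrite -[(size s)%:R]/((size s)%:R) mulr_natl -[X in _ *+ X](card_ord (size s)).
rewrite -sumr_const; apply: ler_sum => i _; apply: H => //.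
  by move=> x; rewrite f0 fle.
move=> x y; have [xy|xy] := leP (mdist x y) 1.
  rewrite (le_trans (flip i x y))// ler_wpM2l//.
  by apply: powR_le_id => //; exact: mdist_ge0.
have p1 : 1 <= mdist x y `^ alpha.
  have -> : 1 = 1 `^ alpha :> R by rewrite powR1.
  by rewrite ge0_ler_powR ?(ltW alpha_gt0) ?nnegrE ?mdist_ge0// ltW.
apply: (@le_trans _ _ 1); last by rewrite -[leLHS]mulr1 ler_pM.
have := f0 i x; have := f0 i y; have := fle i x; have := fle i y.
by rewrite ler_norml => *; apply/andP; split; lra.
Qed.

End dstar_metric.

(** * Preimages and branches of expanding maps *)

Section preimages.
Context {R : realType} {X : pmetricType R}.
Implicit Types (T : X -> X) (psi f : X -> R).

Definition finpre T := forall x, finite_set (T @^-1` [set x]).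

Definition pre T x : seq X := fset_set (T @^-1` [set x]).

Lemma mem_pre T x y : finpre T -> (y \in pre T x) = (T y == x).
Proof. by move=> fT; rewrite /pre in_fset_set//; apply/idP/eqP; rewrite inE. Qed.

Lemma pre_uniq T x : uniq (pre T x).
Proof. exact: fset_uniq. Qed.

Definition tr T psi f x : R := \sum_(y <- pre T x) expR (psi y) * f y.

Lemma tr_fsbig T psi f x : finpre T ->
  \sum_(y \in T @^-1` [set x]) expR (psi y) * f y = tr T psi f x.
Proof. by move=> fT; rewrite fsbig_finite. Qed.

Lemma tr_le T psi f h x : (forall y, T y = x -> f y <= h y) -> finpre T ->
  tr T psi f x <= tr T psi h x.
Proof.
move=> fh fT; rewrite /tr !big_seq; apply: ler_sum => y.
by rewrite mem_pre// => /eqP/fh; rewrite ler_pM2l// expR_gt0.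
Qed.

Lemma trZ T psi (c : R) f x : tr T psi (fun y => c * f y) x = c * tr T psi f x.
Proof. by rewrite /tr mulr_sumr; apply: eq_bigr => y _; rewrite mulrCA. Qed.

Lemma trD T psi f h x :
  tr T psi (fun y => f y + h y) x = tr T psi f x + tr T psi h x.
Proof. by rewrite /tr -big_split; apply: eq_bigr => y _; rewrite mulrDr. Qed.

Lemma tr_ge_term T psi f x : finpre T -> (forall y, 0 <= f y) ->
  forall y, T y = x -> expR (psi y) * f y <= tr T psi f x.
Proof.
move=> fT f0 y Ty; rewrite /tr (big_rem y)/=; last by rewrite mem_pre// Ty.
by rewrite lerDl sumr_ge0// => z _; rewrite mulr_ge0// expR_ge0.
Qed.

Lemma tr_gt0 T psi f x : finpre T -> (forall y, exists z, T z = y) ->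
  (forall y, 0 < f y) -> 0 < tr T psi f x.
Proof.
move=> fT sT f0; have [y Ty] := sT x.
apply: (lt_le_trans _ (tr_ge_term psi fT (fun y => ltW (f0 y)) Ty)).
by rewrite mulr_gt0// expR_gt0.
Qed.

Lemma pre_comp T1 T2 (F : X -> R) x : finpre T1 -> finpre T2 -> finpre (T2 \o T1) ->
  \sum_(y <- pre (T2 \o T1) x) F y = \sum_(z <- pre T2 x) \sum_(y <- pre T1 z) F y.
Proof.
move=> f1 f2 f12.
transitivity (\sum_(y <- pre (T2 \o T1) x) \sum_(z <- pre T2 x | z == T1 y) F y).
  rewrite !big_seq; apply: eq_bigr => y; rewrite mem_pre// => /eqP Ty.
  rewrite big_mkcond/= (bigD1_seq (T1 y)) ?pre_uniq//=; last first.
    by rewrite mem_pre// -Ty.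
  by rewrite eqxx big1 ?addr0// => z /negbTE ->.
rewrite (exchange_big_dep xpredT)//= !big_seq; apply: eq_bigr => z.
rewrite mem_pre// => /eqP Tz; rewrite -[LHS]big_filter; apply: perm_big.
apply: uniq_perm; [by rewrite filter_uniq// pre_uniq|exact: pre_uniq|].
move=> y; rewrite mem_filter !mem_pre//=; apply/andP/idP => [[/eqP <- _]//|/eqP ->].
by rewrite eqxx Tz eqxx.
Qed.

Lemma finpre_comp T1 T2 : finpre T1 -> finpre T2 -> finpre (T2 \o T1).
Proof.
move=> f1 f2 x; rewrite (_ : _ @^-1` _ =
    \bigcup_(z in T2 @^-1` [set x]) (T1 @^-1` [set z])).
  exact: bigcup_finite.
by apply/seteqP; split=> [y /= <-|y [z /= <- <-]//]; exists (T1 y).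
Qed.

Lemma tr_comp T1 T2 psi1 psi2 f x : finpre T1 -> finpre T2 ->
  tr (T2 \o T1) (fun y => psi1 y + psi2 (T1 y)) f x = tr T2 psi2 (tr T1 psi1 f) x.
Proof.
move=> f1 f2; rewrite /tr pre_comp//; last exact: finpre_comp.
apply: eq_bigr => z _; rewrite mulr_sumr !big_seq; apply: eq_bigr => y.
by rewrite mem_pre// => /eqP ->; rewrite expRD; ring.
Qed.

End preimages.

(** * One expanding map: inverse branches, number of preimages, transfer operator *)

Section expanding_map.
Context {R : realType} {X : pmetricType R}.
Variables (T : X -> X) (a lambda : R).
Hypothesis a_gt0 : 0 < a.
Hypothesis lambda_gt0 : 0 < lambda.
Hypothesis lambda_lt1 : lambda < 1.
Hypothesis T_exp : ruelle_expanding a lambda T.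

(** Take the two nearby points of the expansion property equal: [p] and [q] are then both the unique
    preimage close to [p]. *)
Lemma expanding_inj p q : T p = T q -> mdist p q < a -> p = q.
Proof.
move=> Tpq pq; have [|y [[_ yu] _]] := @T_exp (T p) (T p) p _ erefl.
  by rewrite mdistxx.
transitivity y; [apply/esym/yu|apply: yu]; split => //.
by rewrite mdistxx.
Qed.

Lemma expanding_branch (x y : X) x' : mdist x y < a -> T x' = x ->
  exists y', T y' = y /\ mdist x' y' <= lambda * mdist x y.
Proof. by move=> xy Tx; have [y' [[[? _] _] ?]] := T_exp xy Tx; exists y'. Qed.

Lemma lambda_dist_lt (x y : X) : mdist x y < a -> lambda * mdist x y < a.
Proof.
by apply: le_lt_trans; rewrite ler_piMl ?mdist_ge0// ltW.
Qed.

Lemma expanding_contract (x y : X) : mdist x y < a -> mdist (T x) (T y) < a ->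
  mdist x y <= lambda * mdist (T x) (T y).
Proof.
move=> xy Txy; have [y' [[[Ty' xy'] yu] H]] := T_exp Txy erefl.
have E : y' = y by exact: yu.
by rewrite E in H.
Qed.

(** Sending each preimage of [x] to the preimage of [y] close to it is a bijection, whose inverse is
    given by the expansion property from [y] to [x]. Sums over the preimages of nearby points can
    thus be compared term by term, which is the basis of all distortion estimates. *)
Lemma pre_branch (x y : X) : finpre T -> mdist x y < a -> exists br : X -> X,
  (forall x', T x' = x -> T (br x') = y /\ mdist x' (br x') <= lambda * mdist x y) /\
  forall F : X -> R, \sum_(y' <- pre T y) F y' = \sum_(x' <- pre T x) F (br x').
Proof.
move=> fT xy.
have /choice[br brP] : forall x', exists y', T x' = x ->
    T y' = y /\ mdist x' y' <= lambda * mdist x y.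
  move=> x'; have [Tx|nTx] := pselect (T x' = x); last by exists x'.
  by have [y' H] := expanding_branch xy Tx; exists y'.
exists br; split=> // F; rewrite -(big_map br predT).
have br_near x' : T x' = x -> mdist x' (br x') < a.
  by move=> /brP[_ H]; apply: le_lt_trans H _; exact: lambda_dist_lt.
apply: perm_big; apply: uniq_perm; first exact: pre_uniq.
  rewrite map_inj_in_uniq ?pre_uniq// => x1 x2.
  rewrite !mem_pre// => /eqP T1 /eqP T2 b12.
  have [Tb _] := brP _ T1; have yx : mdist y x < a by rewrite metric_sym.
  have [z [[_ zu] _]] := T_exp yx Tb.
  rewrite -(zu x1); last by split => //; rewrite metric_sym br_near.
  by rewrite -(zu x2)//; split => //; rewrite b12 metric_sym br_near.
move=> y'; rewrite mem_pre//; apply/eqP/mapP => [Ty'|[x' + ->]]; last first.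
  by rewrite mem_pre// => /eqP/brP[].
have yx : mdist y x < a by rewrite metric_sym.
have [x' [Tx' H]] := expanding_branch yx Ty'.
exists x'; first by rewrite mem_pre//; apply/eqP.
have [z [[_ zu] _]] := T_exp xy Tx'.
rewrite -(zu y'); last first.
  split=> //; rewrite metric_sym; apply: le_lt_trans H _; exact: lambda_dist_lt.
by rewrite -(zu (br x'))//; split; [case: (brP _ Tx')|exact: br_near].
Qed.

Hypothesis X_compact : compact [set: X].

(** Two preimages of one point cannot lie in the same ball of radius [a / 2], so the size of an
    [a / 2]-net bounds their number, uniformly in the point. *)
Lemma pre_card : exists N : nat, finpre T /\ forall x, (size (pre T x) <= N)%N.
Proof.
have [|s sP] := finite_net X_compact (_ : 0 < a / 2); first by rewrite divr_gt0.
exists (size s).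
have H x : exists t : seq X, (size t <= size s)%N /\ forall y, T y = x -> y \in t.
  have /choice[c cP] : forall q, exists z, forall y, T y = x -> mdist q y < a / 2 -> y = z.
    move=> q; have [[z [Tz qz]]|nz] := pselect (exists z, T z = x /\ mdist q z < a / 2).
      exists z => y Ty qy; apply: expanding_inj; first by rewrite Ty Tz.
      rewrite (le_lt_trans (metric_triangle _ q _))// [ltRHS]splitr ltrD//.
      by rewrite metric_sym.
    by exists q => y Ty qy; exfalso; apply: nz; exists y.
  exists (map c s); rewrite size_map; split => // y Ty.
  by have [q [qs qy]] := sP y; apply/mapP; exists q => //; exact: cP.
have fT : finpre T.
  move=> x; have [t [_ tP]] := H x; apply: (sub_finite_set _ (finite_seq t)).
  by move=> y /= /tP.
split=> // x; have [t [ts tP]] := H x; apply: leq_trans ts.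
by apply: uniq_leq_size; [exact: pre_uniq|move=> y; rewrite mem_pre// => /eqP/tP].
Qed.

Lemma tr_continuous (psi f : X -> R) : continuous psi -> continuous f ->
  continuous (tr T psi f).
Proof.
move=> cpsi cf; have [N [fT _]] := pre_card.
pose h y := expR (psi y) * f y.
have ch : continuous h.
  move=> y; apply: cvgM; last exact: cf.
  by apply: continuous_comp; [exact: cpsi|exact: continuous_expR].
apply/continuous_distP => x e e0.
pose n := (size (pre T x)).+1%:R : R.
have n0 : 0 < n by rewrite ltr0n.
have [d d0 dP] := continuous_unif X_compact ch (divr_gt0 e0 n0).
exists (Num.min a d); first by rewrite lt_min a_gt0.
move=> y; rewrite lt_min => /andP[xya xyd].
have [br [brP brS]] := pre_branch fT xya.
rewrite /tr (brS (fun y => expR (psi y) * f y)) -sumrB.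
rewrite (le_lt_trans (ler_norm_sum _ _ _))//.
apply: (@le_lt_trans _ _ (\sum_(z <- pre T x) e / n)).
  rewrite big_seq [leRHS]big_seq; apply: ler_sum => z.
  rewrite mem_pre// => /eqP/brP[_ zb]; apply: ltW; apply: dP.
  by rewrite (le_lt_trans zb)// (le_lt_trans _ xyd)// ler_piMl ?mdist_ge0// ltW.
rewrite big_const_seq count_predT iter_addr_0 -[ltLHS]mulr_natl mulrCA gtr_pMr//.
by rewrite ltr_pdivrMr// mul1r ltr_nat.
Qed.

End expanding_map.

(** Contraction keeps the preimage inside the smaller radius. This allows [a <= 1] to be assumed in
    the estimates. *)
Lemma ruelle_expanding_le (R : realType) (X : pmetricType R) (a b lambda : R)
    (T : X -> X) : lambda < 1 -> 0 < lambda -> b <= a ->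
  ruelle_expanding a lambda T -> ruelle_expanding b lambda T.
Proof.
move=> l1 l0 ba HT x y x' xy Tx'.
have [y' [[[Ty' xy'] yu] H]] := HT x y x' (lt_le_trans xy ba) Tx'.
exists y'; split=> //; split.
  by split=> //; apply: le_lt_trans H _; apply: le_lt_trans xy;
    rewrite ler_piMl ?mdist_ge0// ltW.
by move=> z [Tz xz]; apply: yu; split => //; exact: lt_le_trans xz ba.
Qed.

(** * Transfer operators along words *)

Section words.
Context {R : realType} {X : pmetricType R} {k : nat}.
Variables (g : 'I_k -> X -> X) (phi : X -> R).
Implicit Types (u v w : seq 'I_k) (f h : X -> R).

Lemma word_map_cat u v x : word_map g (u ++ v) x = word_map g v (word_map g u x).
Proof. by elim: u x => //= i u IH x; rewrite IH. Qed.

Lemma word_pot_nil x : word_pot g phi [::] x = 0.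
Proof. by rewrite /word_pot big_geq. Qed.

Lemma word_pot_cons i w x :
  word_pot g phi (i :: w) x = phi x + word_pot g phi w (g i x).
Proof. by rewrite /word_pot /= big_nat_recl. Qed.

Lemma word_pot_cat u v x : word_pot g phi (u ++ v) x =
  word_pot g phi u x + word_pot g phi v (word_map g u x).
Proof.
elim: u x => [x|i u IH x]; first by rewrite word_pot_nil add0r.
by rewrite cat_cons !word_pot_cons IH addrA.
Qed.

(** Built letter by letter, so that concatenation of words is composition of operators; [Lw_tr] and
    [transferE] identify it with the sum over the preimages under the whole word. *)
Fixpoint Lw w f : X -> R := if w is i :: w' then Lw w' (tr (g i) phi f) else f.

Lemma Lw_cat u v f : Lw (u ++ v) f = Lw v (Lw u f).
Proof. by elim: u f => //= i u IH f; rewrite IH. Qed.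

Hypothesis fing : forall i, finpre (g i).
Hypothesis surg : forall i y, exists x, g i x = y.

Lemma word_finpre w : finpre (word_map g w).
Proof.
elim: w => [x|i w IH] /=; last exact: finpre_comp.
rewrite (_ : id @^-1` [set x] = [set x])//; exact: finite_set1.
Qed.

Lemma word_surj w y : exists x, word_map g w x = y.
Proof.
elim: w => [|i w [z <-]] /=; first by exists y.
by have [x <-] := surg i z; exists x.
Qed.

Lemma Lw_tr w f x : Lw w f x = tr (word_map g w) (word_pot g phi w) f x.
Proof.
elim: w f x => [|i w IH] f x.
  rewrite -tr_fsbig; last exact: word_finpre.
  rewrite (_ : word_map g [::] @^-1` [set x] = [set x])// fsbig_set1.
  by rewrite word_pot_nil expR0 mul1r.
have := tr_comp phi (word_pot g phi w) f x (fing i) (@word_finpre w).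
rewrite -IH => H; rewrite [LHS]/= -H /=.
congr (tr _ _ f x); apply/funext => y.
by rewrite word_pot_cons.
Qed.

Lemma transferE w f x : transfer g phi w f x = Lw w f x.
Proof. by rewrite Lw_tr -tr_fsbig//; exact: word_finpre. Qed.

Lemma Lw_le w f h : (forall y, f y <= h y) -> forall x, Lw w f x <= Lw w h x.
Proof.
by elim: w f h => [//|i w IH] f h fh x /=; apply: IH => y; exact: tr_le.
Qed.

Lemma LwZ w (c : R) f x : Lw w (fun y => c * f y) x = c * Lw w f x.
Proof. by rewrite !Lw_tr trZ. Qed.

Lemma LwD w f h x : Lw w (fun y => f y + h y) x = Lw w f x + Lw w h x.
Proof. by rewrite !Lw_tr trD. Qed.

Lemma Lw_gt0 w f x : (forall y, 0 < f y) -> 0 < Lw w f x.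
Proof.
by move=> f0; rewrite Lw_tr; apply: tr_gt0 => //; [exact: word_finpre|exact: word_surj].
Qed.

Definition Fw u : X -> R := Lw u (fun=> 1).

Lemma Fw_gt0 u x : 0 < Fw u x.
Proof. by apply: Lw_gt0 => y; exact: ltr01. Qed.

Lemma Fw_neq0 u x : Fw u x != 0. Proof. by rewrite gt_eqF// Fw_gt0. Qed.

Lemma Fw_cat u v : Fw (u ++ v) = Lw v (Fw u). Proof. exact: Lw_cat. Qed.

Definition Qw u v f x : R := Lw v (fun y => f y * Fw u y) x / Fw (u ++ v) x.

Lemma transfer_quotE u v f x : transfer_quot g phi u v f x = Qw u v f x.
Proof.
rewrite /transfer_quot !transferE; congr (Lw v _ x / _).
by apply/funext => y; rewrite transferE.
Qed.

Lemma Qw_le u v f h : (forall y, f y <= h y) -> forall x, Qw u v f x <= Qw u v h x.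
Proof.
move=> fh x; rewrite /Qw ler_pM2r ?invr_gt0 ?Fw_gt0//; apply: Lw_le => y.
by rewrite ler_pM2r ?Fw_gt0.
Qed.

Lemma Qw_cst u v (c : R) x : Qw u v (fun=> c) x = c.
Proof. by rewrite /Qw LwZ Fw_cat mulfK// -Fw_cat Fw_neq0. Qed.

Lemma QwD u v f h x : Qw u v (fun y => f y + h y) x = Qw u v f x + Qw u v h x.
Proof.
rewrite /Qw -mulrDl -LwD; congr (Lw v _ x / _).
by apply/funext => y; rewrite mulrDl.
Qed.

Lemma QwZ u v (c : R) f x : Qw u v (fun y => c * f y) x = c * Qw u v f x.
Proof.
rewrite /Qw mulrA -LwZ; congr (Lw v _ x / _).
by apply/funext => y; rewrite mulrA.
Qed.

Lemma QwB u v f h x : Qw u v (fun y => f y - h y) x = Qw u v f x - Qw u v h x.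
Proof.
rewrite -[- Qw u v h x]mulN1r -QwZ -QwD; congr (Qw u v _ x).
by apply/funext => y; rewrite mulN1r.
Qed.

Lemma Qw_nil u f : Qw u [::] f = f.
Proof. by apply/funext => x; rewrite /Qw cats0 /= mulfK// Fw_neq0. Qed.

(** The normalising functions telescope. The letters already used move to the left word, so an
    estimate uniform in [u] can be iterated along [v]. *)
Lemma Qw_cat u v1 v2 f : Qw u (v1 ++ v2) f = Qw (u ++ v1) v2 (Qw u v1 f).
Proof.
apply/funext => x; rewrite /Qw Lw_cat -catA; congr (Lw v2 _ x / _).
by apply/funext => y; rewrite divfK// Fw_neq0.
Qed.

(** The oscillation bound is stated as an enclosing interval of length [N], since the averaging
    operators [Qw] preserve intervals. *)
Definition oscb (N : R) f := exists c, forall z, c <= f z <= c + N.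

Lemma Qw_range u v (c d : R) f : (forall z, c <= f z <= d) ->
  forall x, c <= Qw u v f x <= d.
Proof.
move=> H x; rewrite -[X in X <= _ <= _](Qw_cst u v c x) -[X in _ <= _ <= X](Qw_cst u v d x).
by rewrite !Qw_le// => y; case/andP: (H y).
Qed.

Lemma Qw_oscb u v N f : oscb N f -> oscb N (Qw u v f).
Proof. by move=> [c H]; exists c; exact: Qw_range. Qed.

Lemma Qw_dist u v f h (e : R) : (forall y, `|f y - h y| <= e) ->
  forall x, `|Qw u v f x - Qw u v h x| <= e.
Proof.
move=> H x; rewrite -QwB ler_norml; apply: Qw_range => z.
by rewrite -ler_norml.
Qed.

Lemma Qw1E u i f x : Qw u [:: i] f x =
  \sum_(y <- pre (g i) x) (expR (phi y) * Fw u y / Fw (u ++ [:: i]) x) * f y.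
Proof.
rewrite /Qw /= /tr mulr_suml; apply: eq_bigr => y _.
by rewrite -!mulrA; congr (_ * _); rewrite mulrC -!mulrA.
Qed.

Lemma Lw_continuous w f : (forall i h, continuous h -> continuous (tr (g i) phi h)) ->
  continuous f -> continuous (Lw w f).
Proof.
by move=> trc; elim: w f => [//|i w IH] f cf /=; apply: IH; exact: trc.
Qed.

Lemma Qw_continuous u v f : (forall i h, continuous h -> continuous (tr (g i) phi h)) ->
  continuous f -> continuous (Qw u v f).
Proof.
move=> trc cf; have cF w : continuous (Fw w).
  by apply: Lw_continuous => // x; exact: cvg_cst.
move=> x; apply: cvgM; last by apply: cvgV; [exact: Fw_neq0|exact: cF].
apply: (@Lw_continuous v _ trc) => y; apply: cvgM; [exact: cf|exact: cF].
Qed.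

End words.

(** * Distortion, mixing and contraction for the operators along words *)

Section contraction.
Context {R : realType} {X : pmetricType R} {k : nat}.
Variables (g : 'I_k -> X -> X) (phi : X -> R) (a lambda alpha D : R).
Hypothesis X_compact : compact [set: X].
Hypothesis a_gt0 : 0 < a.
Hypothesis a_le1 : a <= 1.
Hypothesis lambda_gt0 : 0 < lambda.
Hypothesis lambda_lt1 : lambda < 1.
Hypothesis alpha_gt0 : 0 < alpha.
Hypothesis alpha_le1 : alpha <= 1.
Hypothesis g_surj : forall i y, exists x, g i x = y.
Hypothesis g_exp : forall i, ruelle_expanding a lambda (g i).
Hypothesis g_mix : jointly_mixing g.
Hypothesis D_ge0 : 0 <= D.
Hypothesis phi_hol : forall x y, `|phi x - phi y| <= D * mdist x y `^ alpha.
Implicit Types (u v w : seq 'I_k) (f h F : X -> R) (x y z : X).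

Local Notation Lw := (Lw g phi).
Local Notation Fw := (Fw g phi).
Local Notation Qw := (Qw g phi).

Lemma g_finpre i : finpre (g i).
Proof. by have [N []] := pre_card a_gt0 (@g_exp i) X_compact. Qed.

Lemma phi_continuous : continuous phi.
Proof.
apply/continuous_distP => x e e0.
have De : 0 < e / (D + 1) by rewrite divr_gt0// ltr_wpDl.
have [r r0 rP] := powR_lt_small alpha_gt0 De.
exists r => // y xy; rewrite (le_lt_trans (phi_hol x y))//.
apply: (@le_lt_trans _ _ ((D + 1) * mdist x y `^ alpha)).
  by rewrite ler_wpM2r ?powR_ge0// lerDl.
by rewrite mulrC -ltr_pdivlMr ?rP ?mdist_ge0// ltr_wpDl.
Qed.

Lemma tr_continuous_g i h : continuous h -> continuous (tr (g i) phi h).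
Proof.
move=> ch.
exact: (tr_continuous a_gt0 lambda_lt1 (@g_exp i) X_compact phi_continuous ch).
Qed.

Definition theta : R := lambda `^ alpha.

Lemma theta_gt0 : 0 < theta. Proof. exact: powR_gt0. Qed.

Lemma theta_lt1 : theta < 1.
Proof.
have -> : 1 = 1 `^ alpha :> R by rewrite powR1.
by rewrite /theta gt0_ltr_powR// nnegrE// ltW.
Qed.

Lemma branch_pow x y (d' : R) : 0 <= d' -> d' <= lambda * mdist x y ->
  d' `^ alpha <= theta * mdist x y `^ alpha.
Proof.
move=> d0 dl; rewrite /theta -powRM ?mdist_ge0// ?(ltW lambda_gt0)//.
by rewrite ge0_ler_powR// ?nnegrE ?(ltW alpha_gt0)// mulr_ge0 ?mdist_ge0// ltW.
Qed.

Lemma near_pow_le1 x y : mdist x y < a -> mdist x y `^ alpha <= 1.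
Proof.
move=> xy; have -> : 1 = 1 `^ alpha :> R by rewrite powR1.
by rewrite ge0_ler_powR ?nnegrE ?mdist_ge0 ?(ltW alpha_gt0)// ltW// (lt_le_trans xy).
Qed.

Definition lhol (C : R) F := forall x y, mdist x y < a ->
  F x <= expR (C * mdist x y `^ alpha) * F y.

(** Corresponding branches are closer by the factor [lambda], which becomes [theta] after raising to
    the power [alpha]; both the regularity [C] of [F] and the distortion [D] of the weight are
    evaluated at the branches, hence multiplied by [theta]. *)
Lemma tr_lhol i (C : R) F : 0 <= C -> (forall x, 0 < F x) -> lhol C F ->
  lhol ((C + D) * theta) (tr (g i) phi F).
Proof.
move=> C0 F0 HF x y xy.
have [br [brP brS]] := pre_branch lambda_lt1 (@g_exp i) (@g_finpre i) xy.
rewrite /tr (brS (fun y => expR (phi y) * F y)) mulr_sumr.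
rewrite big_seq [leRHS]big_seq; apply: ler_sum => x'.
rewrite mem_pre; last exact: g_finpre.
move=> /eqP/brP[_ xb].
have xba : mdist x' (br x') < a by rewrite (le_lt_trans xb)// lambda_dist_lt.
have pw := branch_pow (mdist_ge0 _ _) xb.
set d' := mdist x' (br x') `^ alpha in pw.
have e1 : expR (phi x') <= expR (D * d') * expR (phi (br x')).
  rewrite -expRD ler_expR -lerBlDr.
  by rewrite (le_trans (ler_norm _))// phi_hol.
apply: (le_trans (ler_pM (expR_ge0 _) (ltW (F0 _)) e1 (HF _ _ xba))).
rewrite -/d' mulrACA -expRD ler_wpM2r ?mulr_ge0 ?expR_ge0 ?(ltW (F0 _))//.
rewrite ler_expR -mulrDl addrC -mulrA.
by rewrite ler_wpM2l// addr_ge0.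
Qed.

(** The fixed point of [C |-> (C + D) * theta], the effect of one letter in [tr_lhol]; the cone
    [lhol Cst] of positive functions is therefore preserved by every word. *)
Definition Cst : R := D * theta / (1 - theta).

Lemma Cst_ge0 : 0 <= Cst.
Proof.
rewrite divr_ge0 ?mulr_ge0 ?(ltW theta_gt0)//.
by rewrite subr_ge0 ltW// theta_lt1.
Qed.

Lemma Cst_fix : (Cst + D) * theta = Cst.
Proof.
rewrite /Cst; have : 1 - theta != 0 by rewrite subr_eq0 gt_eqF// theta_lt1.
by move=> ?; field.
Qed.

Lemma Lw_lhol w F : (forall x, 0 < F x) -> lhol Cst F -> lhol Cst (Lw w F).
Proof.
elim: w F => [//|i w IH] F F0 HF /=; apply: IH.
  by move=> x; apply: tr_gt0 => //; exact: g_finpre.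
by rewrite -Cst_fix; apply: tr_lhol => //; exact: Cst_ge0.
Qed.

Lemma lhol1 : lhol Cst (fun=> 1).
Proof.
move=> x y _; rewrite mulr1 -expR0 ler_expR mulr_ge0 ?powR_ge0//.
exact: Cst_ge0.
Qed.

Lemma Fw_lhol u : lhol Cst (Fw u).
Proof. by apply: Lw_lhol; [move=> _; exact: ltr01|exact: lhol1]. Qed.

Definition hol (H : R) f := forall x y, mdist x y < a ->
  `|f x - f y| <= H * mdist x y `^ alpha.

Lemma expR_sub1_le (t : R) : expR t - 1 <= t * expR t.
Proof.
have := expR_ge1Dx (- t); rewrite expRN => h.
have e0 := expR_gt0 t.
have : (1 - t) * expR t <= 1 by rewrite -ler_pdivlMr// mul1r.
lra.
Qed.

(** Makes [expR (2 * Cst * t) - 1 <= C1 * t] for [0 <= t <= 1]. The 2 comes from the normalised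
    weights: numerator and denominator each have distortion [Cst]. *)
Definition C1 : R := 2 * Cst * expR (2 * Cst).

Lemma C1_ge0 : 0 <= C1.
Proof. by rewrite mulr_ge0 ?expR_ge0// mulr_ge0// Cst_ge0. Qed.

Lemma expR_dist_le x y : mdist x y < a ->
  expR (2 * Cst * mdist x y `^ alpha) - 1 <= C1 * mdist x y `^ alpha.
Proof.
move=> xy; have d1 := near_pow_le1 xy; have d0 := powR_ge0 (mdist x y) alpha.
apply: (le_trans (expR_sub1_le _)); rewrite /C1 mulrAC.
have c0 : 0 <= 2 * Cst by rewrite mulr_ge0// Cst_ge0.
rewrite ler_wpM2r// ler_wpM2l// ler_expR -[leRHS]mulr1.
by rewrite ler_wpM2l.
Qed.

(** The Lasota-Yorke inequality for one letter: the variation of [f] along the branches gives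
    [theta * H], and the variation of the normalised weights gives [C1 * O]. *)
Lemma Qw1_hol u i f (H O : R) : 0 <= H -> 0 <= O -> hol H f -> oscb O f ->
  hol (theta * H + C1 * O) (Qw u [:: i] f).
Proof.
move=> H0 O0 fH [c fc].
suff S x y : mdist x y < a ->
    Qw u [:: i] f x - Qw u [:: i] f y <= (theta * H + C1 * O) * mdist x y `^ alpha.
  move=> x y xy; rewrite ler_norml S// andbT lerNl opprB metric_sym S//.
  by rewrite metric_sym.
move=> xy.
have [br [brP brS]] := pre_branch lambda_lt1 (@g_exp i) (@g_finpre i) xy.
pose p x z := expR (phi z) * Fw u z / Fw (u ++ [:: i]) x.
have p0 x' z : 0 < p x' z by rewrite divr_gt0 ?mulr_gt0 ?expR_gt0 ?Fw_gt0//;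
  exact: g_finpre.
have p1 x' : \sum_(z <- pre (g i) x') p x' z = 1.
  have := Qw_cst phi g_finpre g_surj u [:: i] (1 : R) x'; rewrite Qw1E => <-.
  by apply: eq_bigr => z _; rewrite mulr1.
(* Both families of weights have sum 1, so a constant may be subtracted from [f]; the differences of
   weights then multiply [f - c], which lies in [0, [O]], and only the oscillation of [f] enters. *)
have -> : Qw u [:: i] f x - Qw u [:: i] f y =
    \sum_(z <- pre (g i) x) (p x z * (f z - f (br z)) +
      (p x z - p y (br z)) * (f (br z) - c)).
  transitivity (Qw u [:: i] f x - Qw u [:: i] f y - c *
      (\sum_(z <- pre (g i) x) p x z - \sum_(z <- pre (g i) y) p y z)).
    by rewrite !p1 subrr mulr0 subr0.
  rewrite !Qw1E (brS (fun z => p y z * f z)).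
  rewrite (brS (p y)) -!sumrB mulr_sumr -sumrB; apply: eq_bigr => z _.
  by rewrite -/(p x z); ring.
rewrite big_split/= mulrDl lerD//.
  apply: (@le_trans _ _ (\sum_(z <- pre (g i) x) p x z * (theta * H * mdist x y `^ alpha))).
    rewrite big_seq [leRHS]big_seq; apply: ler_sum => z.
    rewrite mem_pre; last exact: g_finpre.
    move=> /eqP/brP[_ zb]; rewrite ler_pM2l//.
    have zba : mdist z (br z) < a by rewrite (le_lt_trans zb)// lambda_dist_lt.
    rewrite (le_trans (ler_norm _))// (le_trans (fH _ _ zba))// mulrAC mulrC.
    rewrite ler_wpM2r//; exact: branch_pow (mdist_ge0 _ _) zb.
  by rewrite -mulr_suml p1 mul1r.
apply: (@le_trans _ _ (\sum_(z <- pre (g i) x)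
    p y (br z) * (C1 * O * mdist x y `^ alpha))); last first.
  by rewrite -mulr_suml -(brS (p y)) p1 mul1r.
rewrite big_seq [leRHS]big_seq; apply: ler_sum => z.
rewrite mem_pre; last exact: g_finpre.
move=> /eqP/brP[_ zb].
have zba : mdist z (br z) < a by rewrite (le_lt_trans zb)// lambda_dist_lt.
have pw := branch_pow (mdist_ge0 _ _) zb.
have pr : p x z <= expR (2 * Cst * mdist x y `^ alpha) * p y (br z).
  rewrite /p ler_pdivrMr ?Fw_gt0//; last exact: g_finpre.
  have e1 : expR (phi z) <= expR (D * mdist z (br z) `^ alpha) * expR (phi (br z)).
    rewrite -expRD ler_expR -lerBlDr.
    by rewrite (le_trans (ler_norm _))// phi_hol.
  have Fz : 0 <= Fw u z by rewrite ltW// Fw_gt0//; exact: g_finpre.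
  have Fb : 0 <= Fw u (br z) by rewrite ltW// Fw_gt0//; exact: g_finpre.
  apply: (le_trans (ler_pM (expR_ge0 _) Fz e1 (@Fw_lhol u _ _ zba))).
  have Fx : 0 < Fw (u ++ [:: i]) x by rewrite Fw_gt0//; exact: g_finpre.
  have Fy : 0 < Fw (u ++ [:: i]) y by rewrite Fw_gt0//; exact: g_finpre.
  have yx : mdist y x < a by rewrite metric_sym.
  have := @Fw_lhol (u ++ [:: i]) _ _ yx.
  rewrite [mdist y x]metric_sym => Fyx.
  rewrite mulrACA -expRD -mulrDl.
  have -> : expR (2 * Cst * mdist x y `^ alpha) *
      (expR (phi (br z)) * Fw u (br z) / Fw (u ++ [:: i]) y) * Fw (u ++ [:: i]) x =
      (expR (Cst * mdist x y `^ alpha) * (expR (Cst * mdist x y `^ alpha) *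
       (Fw (u ++ [:: i]) x / Fw (u ++ [:: i]) y))) * (expR (phi (br z)) * Fw u (br z)).
    have -> : expR (2 * Cst * mdist x y `^ alpha) =
        expR (Cst * mdist x y `^ alpha) * expR (Cst * mdist x y `^ alpha).
      by rewrite -expRD; congr expR; ring.
    by field; rewrite gt_eqF.
  rewrite ler_wpM2r ?mulr_ge0 ?expR_ge0// -[leLHS]mulr1 ler_pM ?expR_ge0//.
    rewrite ler_expR -{2}Cst_fix -mulrA addrC ler_wpM2l// addr_ge0//.
    exact: Cst_ge0.
  by rewrite mulrA ler_pdivlMr// mul1r.
apply: (@le_trans _ _ (p y (br z) * (expR (2 * Cst * mdist x y `^ alpha) - 1) *
    (f (br z) - c))).
  by rewrite ler_wpM2r ?subr_ge0; [|case/andP: (fc (br z))|lra].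
rewrite -mulrA ler_pM2l// [leRHS]mulrAC ler_pM ?subr_ge0//.
- by rewrite -expR0 ler_expR mulr_ge0 ?powR_ge0// mulr_ge0// Cst_ge0.
- by case/andP: (fc (br z)).
- exact: expR_dist_le.
- by case/andP: (fc (br z)) => _; rewrite lerBlDl.
Qed.

(** The sum of the geometric series with ratio [theta] that arises when [Qw1_hol] is iterated. *)
Definition C2 : R := C1 / (1 - theta).

Lemma theta_sub_gt0 : 0 < 1 - theta.
Proof. by rewrite subr_gt0 theta_lt1. Qed.

Lemma C2_ge0 : 0 <= C2.
Proof. by rewrite divr_ge0 ?C1_ge0// ltW// theta_sub_gt0. Qed.

Lemma theta_exp_bound n : 0 <= theta ^+ n <= 1.
Proof.
by rewrite exprn_ge0 ?exprn_ile1// ltW// ?theta_gt0// theta_lt1.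
Qed.

Lemma Qw_hol u v f (H O : R) : 0 <= H -> 0 <= O -> hol H f -> oscb O f ->
  hol (theta ^+ size v * H + C2 * (1 - theta ^+ size v) * O) (Qw u v f).
Proof.
move=> + O0; elim: v u f H => [|i v IH] u f H H0 fH fO.
  by rewrite Qw_nil//; [rewrite expr0 mul1r subrr mulr0 mul0r addr0|exact: g_finpre].
rewrite -cat1s Qw_cat//; last exact: g_finpre.
have Q1 := Qw1_hol u i H0 O0 fH fO.
have QO := Qw_oscb phi g_finpre g_surj u [:: i] fO.
have H1 : 0 <= theta * H + C1 * O.
  by apply: addr_ge0; apply: mulr_ge0 => //; [exact/ltW/theta_gt0|exact: C1_ge0].
have := IH (u ++ [:: i]) _ _ H1 Q1 QO; congr (hol _ _).
have : 1 - theta != 0 by rewrite gt_eqF// theta_sub_gt0.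
by rewrite size_cat/= add1n exprS /C2 => ?; field.
Qed.

Lemma word_branch w x0 x y0 : mdist x0 x < a -> word_map g w y0 = x0 ->
  exists y, word_map g w y = x /\ mdist y0 y <= lambda ^+ size w * mdist x0 x.
Proof.
elim: w y0 => [|i w IH] y0 xa /=.
  by move=> ->; exists x; rewrite expr0 mul1r.
move=> /IH[//|y1 [wy1 d1]].
have d1a : mdist (g i y0) y1 < a.
  apply: le_lt_trans d1 _; apply: le_lt_trans xa.
  by rewrite ler_piMl ?mdist_ge0// exprn_ile1// ltW.
have [y [gy dy]] := expanding_branch (@g_exp i) d1a erefl.
exists y; rewrite gy; split => //; apply: le_trans dy _.
by rewrite exprS -mulrA ler_wpM2l// ltW.
Qed.

(** Joint mixing is used for the finitely many pairs of balls of a net and yields a point near [z]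
    whose image is near [x]; following the inverse branch with [word_branch] makes the image equal
    to [x] without moving the point far. *)
Lemma mixing_dense (d : R) : 0 < d -> exists m0, forall w, (m0 <= size w)%N ->
  forall x z, exists y, mdist z y < d /\ word_map g w y = x.
Proof.
move=> d0; pose r := Num.min a d / 4.
have mad : 0 < Num.min a d by rewrite lt_min a_gt0.
have r0 : 0 < r by rewrite divr_gt0.
have ra : 4 * r <= a by rewrite mulrC divfK// ge_min lexx.
have rd : 4 * r <= d by rewrite mulrC divfK// ge_min lexx orbT.
have [s sP] := finite_net X_compact r0.
have /choice[m mP] : forall pq : X * X, exists m, forall w, (m <= size w)%N ->
    exists y, mdist pq.1 (word_map g w y) < r /\ mdist pq.2 y < r.
  move=> [p q] /=.
  have pU : [set y | mdist p y < r] !=set0 by exists p; rewrite /= mdistxx.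
  have qU : [set y | mdist q y < r] !=set0 by exists q; rewrite /= mdistxx.
  have [m mP] := g_mix (open_mball p r) (open_mball q r) pU qU.
  by exists m => w /mP[y [py qy]]; exists y.
exists (\sum_(p <- s) \sum_(q <- s) m (p, q))%N => w mw x z.
have [p [ps px]] := sP x; have [q [qs qz]] := sP z.
have [|y0 [/= py qy]] := mP (p, q) w.
  apply: leq_trans mw; rewrite (big_rem p)//= (big_rem q)//= -addnA.
  exact: leq_addr.
have wx : mdist (word_map g w y0) x < 2 * r.
  rewrite (le_lt_trans (metric_triangle _ p _))// metric_sym.
  by move: py px; lra.
have wxa : mdist (word_map g w y0) x < a by move: wx ra; lra.
have [y [wy dy]] := word_branch wxa erefl.
exists y; split => //.
have dy2 : mdist y0 y < 2 * r.
  apply: le_lt_trans dy _; apply: le_lt_trans wx.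
  by rewrite ler_piMl ?mdist_ge0// exprn_ile1// ltW.
have t1 := metric_triangle z q y; have t2 := metric_triangle q y0 y.
rewrite (metric_sym z q) in t1.
by move: t1 t2 qz qy dy2 rd; lra.
Qed.

Lemma potential_bound : exists2 P : R, 0 <= P &
  forall w y, - ((size w)%:R * P) <= word_pot g phi w y <= (size w)%:R * P.
Proof.
have [P PP] := continuous_bounded X_compact phi_continuous.
have P0 : 0 <= P by rewrite (le_trans _ (PP point)).
exists P => // w y; rewrite -ler_norml; elim: w y => [|i w IH] y.
  by rewrite word_pot_nil normr0 mul0r.
rewrite word_pot_cons (le_trans (ler_normD _ _))// -natr1 mulrDl mul1r addrC.
by rewrite lerD.
Qed.

Lemma transfer_one_bound : exists2 M : R, 1 <= M &
  forall i x, tr (g i) phi (fun=> 1) x <= M.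
Proof.
have /choice[N NP] := fun i => pre_card a_gt0 (@g_exp i) X_compact.
have [P PP] := continuous_bounded X_compact phi_continuous.
exists (1 + (\sum_i N i)%:R * expR P).
  by rewrite lerDl mulr_ge0// expR_ge0.
move=> i x; rewrite -[leLHS]add0r lerD// /tr.
apply: (@le_trans _ _ (\sum_(y <- pre (g i) x) expR P)).
  by apply: ler_sum => y _; rewrite mulr1 ler_expR (le_trans (ler_norm _)).
rewrite big_const_seq count_predT iter_addr_0 -[leLHS]mulr_natl.
rewrite ler_wpM2r ?expR_ge0// ler_nat (leq_trans ((NP i).2 x))//.
by rewrite (bigD1 i)//= leq_addr.
Qed.

Lemma Lw_upper (M : R) w F (c : R) : (forall i x, tr (g i) phi (fun=> 1) x <= M) ->
  0 <= M -> 0 <= c -> (forall y, F y <= c) -> forall x, Lw w F x <= c * M ^+ size w.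
Proof.
move=> MP M0; elim: w F c => [|i w IH] F c c0 Fc x; first by rewrite mulr1.
rewrite /= exprS mulrA; apply: IH; first exact: mulr_ge0.
move=> y; apply: (@le_trans _ _ (tr (g i) phi (fun z => c * 1) y)).
  by apply: tr_le; [move=> z _; rewrite mulr1|exact: g_finpre].
by rewrite trZ ler_wpM2l.
Qed.

Lemma Lw_lower (P : R) w F x y :
  (forall w y, - ((size w)%:R * P) <= word_pot g phi w y <= (size w)%:R * P) ->
  (forall y, 0 <= F y) -> word_map g w y = x ->
  expR (- ((size w)%:R * P)) * F y <= Lw w F x.
Proof.
move=> PP F0 wy; rewrite Lw_tr; last exact: g_finpre.
apply: (le_trans _ (tr_ge_term _ (word_finpre g_finpre w) F0 wy)).
by rewrite ler_wpM2r// ler_expR; case/andP: (PP w y).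
Qed.

Let Fw0 u x : 0 < Fw u x. Proof. by rewrite Fw_gt0//; exact: g_finpre. Qed.

(** Split off the last [m0] letters [u2] of a long word [u]. By mixing, [y] has a preimage under
    [u2] close to any given [z], so the log-Holder bound gives [Fw u1 z] at most a constant times
    [Fw u y], for all [z]; applying [u2] costs at most [M ^+ m0]. Short words are covered by the
    crude bounds on weights. *)
Lemma Fw_ratio : exists2 B : R, 1 <= B & forall u x y, Fw u x <= B * Fw u y.
Proof.
have [P P0 PP] := potential_bound; have [M M1 MP] := transfer_one_bound.
have M0 : 0 <= M by exact: le_trans M1.
have [m0 m0P] := mixing_dense a_gt0.
pose B := M ^+ m0 * expR (m0%:R * P) * expR Cst.
have e1 : 1 <= expR Cst by rewrite -expR0 ler_expR Cst_ge0.
have Mm : 1 <= M ^+ m0 by exact: exprn_ege1.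
have eP : 1 <= expR (m0%:R * P) by rewrite -expR0 ler_expR mulr_ge0.
have B1 : 1 <= B.
  rewrite /B -[leLHS]mulr1 ler_pM// -[leLHS]mulr1 ler_pM//.
exists B => // u x y.
have [um|um] := leqP m0 (size u); last first.
  have [z uz] := word_surj g_surj u y.
  have up : Fw u x <= M ^+ size u.
    by rewrite -[leRHS]mul1r; apply: Lw_upper.
  have lo : expR (- ((size u)%:R * P)) <= Fw u y.
    by rewrite -[leLHS]mulr1; apply: (Lw_lower (F := fun=> 1) PP) uz.
  apply: (le_trans up); apply: (@le_trans _ _ (B * expR (- ((size u)%:R * P)))).
    rewrite /B -mulrA -mulrA -[leLHS]mulr1 ler_pM ?exprn_ge0//.
      by apply: ler_weXn2l => //; exact: ltnW.
    rewrite mulrC -mulrA -expRD -[leLHS]mulr1 ler_pM//.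
    by rewrite -[X in X <= _]expR0 ler_expR addrC subr_ge0 ler_wpM2r// ler_nat ltnW.
  by rewrite ler_wpM2l// (le_trans _ B1).
pose u1 := take (size u - m0) u; pose u2 := drop (size u - m0) u.
have su2 : size u2 = m0 by rewrite size_drop subKn.
have uE : u = u1 ++ u2 by rewrite cat_take_drop.
have key z : Fw u1 z <= expR (m0%:R * P) * expR Cst * Fw u y.
  have [t [zt ut]] := m0P u2 (eq_leq (esym su2)) y z.
  have lo := Lw_lower (F := Fw u1) PP (fun y => ltW (Fw0 u1 y)) ut.
  rewrite -Fw_cat -uE su2 in lo.
  apply: (le_trans (@Fw_lhol u1 z t zt)).
  rewrite [leRHS]mulrAC; apply: (@le_trans _ _ (expR Cst * Fw u1 t)).
    rewrite ler_wpM2r ?(ltW (Fw0 _ _))// ler_expR ler_piMr ?Cst_ge0//.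
    exact: near_pow_le1.
  rewrite [leRHS]mulrC ler_wpM2l ?expR_ge0// -ler_pdivrMl ?expR_gt0//.
  by rewrite -expRN.
have c0 : 0 <= expR (m0%:R * P) * expR Cst * Fw u y.
  by rewrite mulr_ge0 ?mulr_ge0 ?expR_ge0// ltW.
have := Lw_upper u2 MP M0 c0 key x.
rewrite -Fw_cat -uE su2 => H; apply: (le_trans H).
by rewrite /B; rewrite le_eqVlt; apply/orP; left; apply/eqP; ring.
Qed.

(* Regularity comes from the Lasota-Yorke inequality [Qw_hol]; the oscillation drops
   because, by mixing, every point has for each long word a preimage close to any
   prescribed point, carrying a fixed share of the weight. *)
Lemma contraction_step : exists K rho : R, exists m0 : nat,
  [/\ 0 < K, 0 < rho < 1, (0 < m0)%N &
  forall u v f (N : R), size v = m0 -> 0 <= N -> hol (K * N) f -> oscb N f ->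
    hol (K * (rho * N)) (Qw u v f) /\ oscb (rho * N) (Qw u v f)].
Proof.
have [P P0 PP] := potential_bound; have [M M1 MP] := transfer_one_bound.
have M0 : 0 <= M by exact: le_trans M1.
have [B B1 BP] := Fw_ratio.
have B0 : 0 < B by exact: lt_le_trans B1.
(* Once [theta ^+ m0 <= 1/4], the bound of [Qw_hol] is at most [K * N / 4 + C2 * N], and
   [C2 <= K / 4] turns this into [K * N / 2]: the Holder part is halved. *)
pose K := 4 * C2 + 1.
have K0 : 0 < K by apply: ltr_wpDl => //; apply: mulr_ge0 => //; exact: C2_ge0.
have [d' d'0 d'P] := powR_lt_small alpha_gt0 (divr_gt0 (divr_gt0 (@ltr01 R) (ltr0n R 4)) K0).
pose d := Num.min a d'.
have d0 : 0 < d by rewrite lt_min a_gt0.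
have [m1 m1P] := mixing_dense d0.
have [m2 m2P] : exists m2, theta ^+ m2 <= 4^-1.
  have th1 : `|theta| < 1 by rewrite gtr0_norm ?theta_gt0// theta_lt1.
  have := cvg_expr th1; move/cvgrPdist_lt/(_ _ (divr_gt0 (@ltr01 R) (ltr0n R 4))).
  move=> [n _ /(_ n (leqnn n))] /=; rewrite sub0r normrN div1r => h.
  by exists n; rewrite (le_trans (ler_norm _))// ltW.
pose m0 := (maxn m1 m2).+1.
(* The least share of the total weight carried by one branch of a word of length [m0]: the branch at
   [y] contributes at least [expR (- (m0%:R * P)) * Fw u y], and the total is at most
   [B * Fw u y * M ^+ m0]. *)
pose kap := (expR (m0%:R * P) * M ^+ m0 * B)^-1.
have kd : 0 < expR (m0%:R * P) * M ^+ m0 * B.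
  by rewrite !mulr_gt0 ?expR_gt0 ?exprn_gt0// (lt_le_trans ltr01).
have kap0 : 0 < kap by rewrite invr_gt0.
have kap1 : kap <= 1.
  rewrite invf_le1// -[leLHS]mulr1 ler_pM// -[leLHS]mulr1 ler_pM//.
    by rewrite -expR0 ler_expR mulr_ge0.
  exact: exprn_ege1.
pose rho := Num.max 2^-1 (1 - kap / 4).
have rho2 : 2^-1 <= rho by rewrite le_max lexx.
have rhok : 1 - kap / 4 <= rho by rewrite le_max lexx orbT.
have rho0 : 0 < rho by apply: lt_le_trans rho2; rewrite invr_gt0.
exists K, rho, m0; split => //.
  by rewrite rho0/= gt_max; apply/andP; split; [rewrite invf_lt1 ?ltr1n|lra].
move=> u v f N sv N0 fK fO; split.
  have KN : 0 <= K * N by rewrite mulr_ge0// ltW.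
  have := Qw_hol u v KN N0 fK fO; rewrite sv => Qh x y xy.
  rewrite (le_trans (Qh x y xy))// ler_wpM2r ?powR_ge0//.
  have th4 : theta ^+ m0 <= 4^-1.
    apply: le_trans m2P; apply: ler_wiXn2l; rewrite ?(ltW theta_gt0) ?(ltW theta_lt1)//.
    by rewrite /m0 ltnW// ltnS leq_maxr.
  have /andP[t0 t1] := theta_exp_bound m0.
  apply: (@le_trans _ _ (4^-1 * (K * N) + C2 * 1 * N)).
    rewrite lerD ?ler_wpM2r// ler_wpM2l ?C2_ge0//; lra.
  apply: (@le_trans _ _ (K * (2^-1 * N))); last by rewrite ler_pM2l// ler_wpM2r.
  have CN : 0 <= C2 * N by rewrite mulr_ge0 ?C2_ge0.
  by rewrite /K; move: CN N0; set C := C2; move: C => C *; nra.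
move: fO => [c fc].
(* Either [f] stays below the middle of its range, and its oscillation is already halved, or it
   reaches the middle at some [z]. By the choice of [d'] it then exceeds [c] by at least [N / 4]
   near [z], where every point has a preimage of share at least [kap], so the lower bound [c] rises
   by [kap * (N / 4)]. These two cases explain the two members of [rho]. *)
have [[z fz]|nz] := pselect (exists z, c + N / 2 <= f z); last first.
  exists c => x; apply: (@Qw_range _ _ _ _ phi g_finpre g_surj) => y.
  case/andP: (fc y) => -> _ /=; rewrite leNgt; apply/negP => fy; apply: nz; exists y.
  rewrite ltW// (le_lt_trans _ fy)// lerD2l mulrC ler_wpM2r//.
exists (c + kap * (N / 4)) => x; apply/andP; split; last first.
  have /andP[_ up] := @Qw_range _ _ _ _ phi g_finpre g_surj u v _ _ _ fc x.
  apply: (le_trans up); rewrite -addrA lerD2l.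
  have : (1 - kap / 4) * N <= rho * N by rewrite ler_wpM2r.
  by lra.
have mv : (m1 <= size v)%N by rewrite sv /m0 leqW// leq_maxl.
have [y [zy vy]] := m1P v mv x z.
have fy : N / 4 <= f y - c.
  have za : mdist z y < a by apply: lt_le_trans zy _; rewrite ge_min lexx.
  have zd : mdist z y < d' by apply: lt_le_trans zy _; rewrite ge_min lexx orbT.
  have := fK z y za; have := d'P _ (mdist_ge0 z y) zd.
  rewrite div1r => /ltW h1; rewrite ler_norml => /andP[_ h2].
  have h3 : K * N * mdist z y `^ alpha <= N / 4.
    rewrite mulrAC mulrC ler_wpM2l// mulrC -ler_pdivlMr//.
  by move: h2 h3 fz; lra.
rewrite addrC -lerBrDr.
have -> : Qw u v f x - c = Qw u v (fun y => f y - c) x.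
  by rewrite QwB ?Qw_cst//; exact: g_finpre.
have fc0 t : 0 <= f t - c by case/andP: (fc t) => ? _; rewrite subr_ge0.
have lo := Lw_lower (F := fun y => (f y - c) * Fw u y) PP
  (fun t => mulr_ge0 (fc0 t) (ltW (Fw0 u t))) vy.
rewrite /Qw ler_pdivlMr//; apply: le_trans lo; rewrite sv.
have up : Fw (u ++ v) x <= B * Fw u y * M ^+ m0.
  rewrite Fw_cat -sv; apply: Lw_upper => //.
  by rewrite mulr_ge0 ?(ltW B0)// ltW.
apply: (@le_trans _ _ (kap * (f y - c) * (B * Fw u y * M ^+ m0))).
  rewrite ler_pM// ?(ltW (Fw0 _ _))//.
    by rewrite mulr_ge0 ?divr_ge0// ltW.
  by rewrite ler_wpM2l// ltW.
have Mn0 : M ^+ m0 != 0 by rewrite gt_eqF// exprn_gt0// (lt_le_trans ltr01).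
rewrite le_eqVlt; apply/orP; left; apply/eqP.
by rewrite /kap expRN; field; rewrite Mn0 !gt_eqF// expR_gt0.
Qed.

End contraction.

(** * Convergence of quotients of transfer operators *)

Section quotient_convergence.
Context {R : realType} {X : pmetricType R} {k : nat}.
Variables (g : 'I_k -> X -> X) (phi : X -> R) (a lambda alpha D : R).
Hypothesis X_compact : compact [set: X].
Hypothesis a_gt0 : 0 < a.
Hypothesis a_le1 : a <= 1.
Hypothesis lambda_gt0 : 0 < lambda.
Hypothesis lambda_lt1 : lambda < 1.
Hypothesis alpha_gt0 : 0 < alpha.
Hypothesis alpha_le1 : alpha <= 1.
Hypothesis g_surj : forall i y, exists x, g i x = y.
Hypothesis g_exp : forall i, ruelle_expanding a lambda (g i).
Hypothesis g_mix : jointly_mixing g.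
Hypothesis D_ge0 : 0 <= D.
Hypothesis phi_hol : forall x y, `|phi x - phi y| <= D * mdist x y `^ alpha.
Implicit Types (u v w : seq 'I_k) (f h F : X -> R) (x y z : X).

Local Notation Lw := (Lw g phi).
Local Notation Fw := (Fw g phi).
Local Notation Qw := (Qw g phi).
Local Notation hol := (hol a alpha).
Local Notation Cst := (Cst lambda alpha D).
Local Notation C1 := (C1 lambda alpha D).

Let g_fin i : finpre (g i).
Proof. exact: (g_finpre X_compact a_gt0 (@g_exp)). Qed.

Let Qr u v (c d : R) f : (forall z, c <= f z <= d) -> forall x, c <= Qw u v f x <= d.
Proof. exact: Qw_range. Qed.

Let Fw0 u x : 0 < Fw u x. Proof. by rewrite Fw_gt0. Qed.

Let trc i h : continuous h -> continuous (tr (g i) phi h).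
Proof. by move=> ch; apply: (tr_continuous_g X_compact a_gt0 lambda_lt1 alpha_gt0 (@g_exp) D_ge0 phi_hol). Qed.

(** One contraction for each complete block of [m0] letters; an incomplete block merely averages and
    does not increase the oscillation. *)
Lemma Qw_osc_decay : exists K rho : R, exists m0 : nat,
  [/\ 0 < K, 0 < rho < 1, (0 < m0)%N &
  forall u v f (N : R), 0 <= N -> hol (K * N) f -> oscb N f ->
    oscb (rho ^+ (size v %/ m0) * N) (Qw u v f)].
Proof.
have [K [rho [m0 [K0 /andP[r0 r1] m00 step]]]] :
  exists K rho : R, exists m0 : nat,
  [/\ 0 < K, 0 < rho < 1, (0 < m0)%N &
  forall u v f (N : R), size v = m0 -> 0 <= N -> hol (K * N) f -> oscb N f ->
    hol (K * (rho * N)) (Qw u v f) /\ oscb (rho * N) (Qw u v f)].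
  exact: (contraction_step X_compact a_gt0 a_le1 lambda_gt0 lambda_lt1 alpha_gt0
    g_surj (@g_exp) g_mix D_ge0 phi_hol).
exists K, rho, m0; split => //; first by rewrite r0 r1.
move=> u v f N N0 fK fO; move: {2}(size v %/ m0)%N (erefl (size v %/ m0)%N) => q.
elim: q u v f N N0 fK fO => [|q IH] u v f N N0 fK fO qE.
  by rewrite qE mul1r; apply: Qw_oscb.
have mv : (m0 <= size v)%N by rewrite leqNgt; apply/negP => /divn_small; rewrite qE.
rewrite qE -(cat_take_drop m0 v) Qw_cat// exprSr -mulrA.
have [h1 h2] := step u (take m0 v) f N (size_takel mv) N0 fK fO.
have sd : (size (drop m0 v) %/ m0 = q)%N.
  by rewrite size_drop -[m0 in (_ - m0)%N]mul1n divnBMl qE subn1.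
have rN : 0 <= rho * N by rewrite mulr_ge0// ltW.
by have := IH (u ++ take m0 v) (drop m0 v) _ _ rN h1 h2 sd; rewrite sd.
Qed.

Variables (K rho B : R) (m0 : nat).
Hypothesis K_gt0 : 0 < K.
Hypothesis rho01 : 0 < rho < 1.
Hypothesis decay : forall u v f (N : R), 0 <= N -> hol (K * N) f -> oscb N f ->
    oscb (rho ^+ (size v %/ m0) * N) (Qw u v f).
Hypothesis B_ge1 : 1 <= B.
Hypothesis Fw_B : forall u x y, Fw u x <= B * Fw u y.

Let dec n : R := rho ^+ (n %/ m0).

Let dec0 n : 0 < dec n.
Proof. by rewrite exprn_gt0//; case/andP: rho01. Qed.

Let dec1 n : dec n <= 1.
Proof. by case/andP: rho01 => r0 r1; rewrite exprn_ile1// ltW. Qed.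

(** The first factor bounds both the oscillation and, relative to [K], the Holder constant of a
    quotient [Fw u / Fw u'] normalised at one point; the last [B ^+ 2] turns an additive error into
    a relative one. *)
Definition ratio_const : R := (B ^+ 2 + C1 * B ^+ 2 / K) * B ^+ 2.

Lemma ratio_const_ge0 : 0 <= ratio_const.
Proof.
have B0 : 0 <= B by exact: le_trans B_ge1.
apply: mulr_ge0; last exact: exprn_ge0.
apply: addr_ge0; first exact: exprn_ge0.
by rewrite divr_ge0 ?(ltW K_gt0)// mulr_ge0 ?exprn_ge0//; apply: C1_ge0.
Qed.

(** The operator [Qw u' q] maps the quotient [h = Fw u / Fw u'] to the quotient of [Fw (u ++ q)] by
    [Fw (u' ++ q)]. Contraction makes the image nearly constant, so replacing [u] by [u'] in front
    of a long common [q] changes the normalising function by almost a scalar. *)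
Lemma Fw_ratio_decay u u' q x y :
  Fw (u ++ q) x * Fw (u' ++ q) y <=
  (1 + ratio_const * dec (size q)) * (Fw (u ++ q) y * Fw (u' ++ q) x).
Proof.
have B0 : 0 < B by exact: lt_le_trans B_ge1.
pose h z := Fw u z / Fw u' z.
have h0 z : 0 < h z by rewrite divr_gt0.
have hB z t : h z <= B ^+ 2 * h t.
  rewrite /h ler_pdivrMr//.
  have -> : B ^+ 2 * (Fw u t / Fw u' t) * Fw u' z = (B * Fw u t) * (B * Fw u' z / Fw u' t).
    by field; rewrite gt_eqF.
  rewrite -[leLHS]mulr1 ler_pM ?(ltW (Fw0 _ _))//.
  by rewrite ler_pdivlMr// mul1r.
pose c := h point; have c0 : 0 < c by exact: h0.
pose N := (B ^+ 2 + C1 * B ^+ 2 / K) * c.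
have CC : 0 <= C1 by apply: C1_ge0.
have N0 : 0 <= N.
  rewrite mulr_ge0 ?(ltW c0)// addr_ge0 ?exprn_ge0 ?(ltW B0)//.
  by rewrite divr_ge0 ?(ltW K_gt0)// mulr_ge0// exprn_ge0// ltW.
have hlt z : h z <= B ^+ 2 * c by exact: hB.
have hO : oscb N h.
  exists 0 => z; rewrite (ltW (h0 z)) add0r /= (le_trans (hlt z))//.
  by rewrite /N ler_pM2r// lerDl divr_ge0 ?(ltW K_gt0)// mulr_ge0// exprn_ge0// ltW.
have hH : hol (K * N) h.
  move=> z1 z2 zt.
  suff S x' y' : mdist x' y' < a -> h x' - h y' <= K * N * mdist x' y' `^ alpha.
    rewrite ler_norml S// andbT lerNl opprB metric_sym S//.
    by rewrite metric_sym.
  move=> xy; have yx : mdist y' x' < a by rewrite metric_sym.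
  have l1 : Fw u x' <= expR (Cst * mdist x' y' `^ alpha) * Fw u y'.
    exact: (Fw_lhol X_compact a_gt0 lambda_gt0 lambda_lt1 alpha_gt0 g_surj (@g_exp) D_ge0 phi_hol).
  have l2 : Fw u' y' <= expR (Cst * mdist x' y' `^ alpha) * Fw u' x'.
    rewrite metric_sym.
    exact: (Fw_lhol X_compact a_gt0 lambda_gt0 lambda_lt1 alpha_gt0 g_surj (@g_exp) D_ge0 phi_hol).
  have l3 : h x' <= expR (2 * Cst * mdist x' y' `^ alpha) * h y'.
    rewrite /h ler_pdivrMr//.
    have -> : expR (2 * Cst * mdist x' y' `^ alpha) =
        expR (Cst * mdist x' y' `^ alpha) * expR (Cst * mdist x' y' `^ alpha).
      by rewrite -expRD; congr expR; ring.
    have -> : expR (Cst * mdist x' y' `^ alpha) * expR (Cst * mdist x' y' `^ alpha) *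
      (Fw u y' / Fw u' y') * Fw u' x' = (expR (Cst * mdist x' y' `^ alpha) * Fw u y') *
      (expR (Cst * mdist x' y' `^ alpha) * Fw u' x' / Fw u' y').
      by field; rewrite gt_eqF.
    rewrite -[leLHS]mulr1 ler_pM ?(ltW (Fw0 _ _))//.
    by rewrite ler_pdivlMr// mul1r.
  have e1 : expR (2 * Cst * mdist x' y' `^ alpha) - 1 <= C1 * mdist x' y' `^ alpha.
    exact: (expR_dist_le a_le1 lambda_gt0 lambda_lt1 alpha_gt0 D_ge0).
  apply: (@le_trans _ _ ((expR (2 * Cst * mdist x' y' `^ alpha) - 1) * h y')).
    by rewrite mulrBl mul1r lerD2r.
  apply: (@le_trans _ _ (C1 * mdist x' y' `^ alpha * (B ^+ 2 * c))).
    have e0 : 0 <= expR (2 * Cst * mdist x' y' `^ alpha) - 1.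
      rewrite subr_ge0 -[X in X <= _]expR0 ler_expR mulr_ge0 ?powR_ge0// mulr_ge0//.
      by apply: Cst_ge0.
    by rewrite ler_pM// ltW.
  rewrite /N; apply: (@le_trans _ _ (K * (C1 * B ^+ 2 / K * c) * mdist x' y' `^ alpha)).
    by rewrite le_eqVlt; apply/orP; left; apply/eqP; field; rewrite gt_eqF.
  by rewrite ler_wpM2r ?powR_ge0// ler_pM2l// ler_pM2r// lerDr exprn_ge0// ltW.
have [d dP] := decay u' q N0 hH hO.
have QE z : Qw u' q h z = Fw (u ++ q) z / Fw (u' ++ q) z.
  rewrite /Qw [in RHS]Fw_cat; congr (Lw q _ z / _).
  by apply/funext => t; rewrite /h divfK// gt_eqF.
have lo z : c / B ^+ 2 <= Qw u' q h z.
  have := @Qr u' q (c / B ^+ 2) (B ^+ 2 * c) h; case/(_ _ z)/andP => // t.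
  by rewrite hlt andbT ler_pdivrMr ?exprn_gt0// mulrC; exact: hB.
have key : Qw u' q h x <= (1 + ratio_const * dec (size q)) * Qw u' q h y.
  have /andP[_ up] := dP x; have /andP[dn _] := dP y.
  rewrite mulrDl mul1r; apply: (le_trans up); rewrite lerD//.
  apply: (@le_trans _ _ (ratio_const * dec (size q) * (c / B ^+ 2))); last first.
    by rewrite ler_wpM2l// mulr_ge0 ?ratio_const_ge0// ltW.
  rewrite le_eqVlt; apply/orP; left; apply/eqP; rewrite /ratio_const /N -/(dec _).
  by field; rewrite !gt_eqF.
move: key; rewrite !QE ler_pdivrMr// => key.
apply: (le_trans (ler_wpM2r (ltW (Fw0 _ y)) key)).
rewrite le_eqVlt; apply/orP; left; apply/eqP.
by field; rewrite gt_eqF.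
Qed.

Lemma Qw_suffix_dist u u' q p f x : (forall z, 0 <= f z <= 1) ->
  `|Qw (u ++ q) p f x - Qw (u' ++ q) p f x| <= ratio_const * dec (size q).
Proof.
move=> f01; set e := ratio_const * dec (size q).
have e0 : 0 <= e by rewrite mulr_ge0 ?ratio_const_ge0// ltW.
suff S u1 u2 : Qw (u1 ++ q) p f x <= Qw (u2 ++ q) p f x + e.
  by rewrite ler_norml lerBlDl lerBrDl S lerBlDr S.
have f0 z : 0 <= f z by case/andP: (f01 z).
have Q01 : 0 <= Qw (u2 ++ q) p f x <= 1 by apply: Qr.
apply: (@le_trans _ _ ((1 + e) * Qw (u2 ++ q) p f x)); last first.
  by rewrite mulrDl mul1r lerD2l; case/andP: Q01 => ? ?; rewrite ler_piMr.
rewrite /Qw ![Fw (_ ++ p)]Fw_cat.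
set A := Lw p (fun y => f y * Fw (u1 ++ q) y) x.
set A' := Lw p (fun y => f y * Fw (u2 ++ q) y) x.
(* The ratio estimate in two points [y] and [z] is summed with [Lw p] in [y] here and in [z]
   afterwards; the scalar ambiguity between the two normalising functions cancels in the
   quotients. *)
have H z : A * Fw (u2 ++ q) z <= ((1 + e) * A') * Fw (u1 ++ q) z.
  rewrite mulrC -LwZ//.
  have -> : (1 + e) * A' * Fw (u1 ++ q) z = ((1 + e) * Fw (u1 ++ q) z) * A' by ring.
  rewrite -LwZ//; apply: Lw_le => // y.
  rewrite mulrCA [leRHS]mulrCA ler_wpM2l//.
  have := Fw_ratio_decay u1 u2 q y z; rewrite mulrC => /le_trans; apply.
  by rewrite mulrA.
have := Lw_le phi g_fin p H x; rewrite !LwZ// => HL.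
have p1 : 0 < Lw p (Fw (u1 ++ q)) x by rewrite -Fw_cat.
have p2 : 0 < Lw p (Fw (u2 ++ q)) x by rewrite -Fw_cat.
rewrite ler_pdivrMr//; set L1 := Lw p (Fw (u1 ++ q)) x in HL p1 *.
set L2 := Lw p (Fw (u2 ++ q)) x in HL p2 *.
have -> : (1 + e) * (A' / L2) * L1 = (1 + e) * A' * L1 / L2 by ring.
by rewrite ler_pdivlMr.
Qed.

(** After the common [p], all values for the left word [u ++ q] lie in a short interval, and
    changing [u] into [u'] enlarges it by the error of [Qw_suffix_dist]. The different continuations
    [s] and [s'] average values of that interval, so they cannot leave it. *)
Lemma Qw_dist_decay u u' q p s s' f (H : R) x y : 0 <= H -> (forall z, 0 <= f z <= 1) ->
  hol H f ->
  `|Qw (u ++ q) (p ++ s) f x - Qw (u' ++ q) (p ++ s') f y| <=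
  (1 + H / K) * dec (size p) + ratio_const * dec (size q).
Proof.
move=> H0 f01 fH; set N := 1 + H / K.
have N1 : 1 <= N by rewrite lerDl divr_ge0// ltW.
have N0 : 0 <= N by exact: le_trans N1.
have fK : hol (K * N) f.
  move=> z t zt; rewrite (le_trans (fH _ _ zt))// ler_wpM2r ?powR_ge0//.
  by rewrite /N mulrDr mulr1 mulrCA divff ?gt_eqF// mulr1 lerDr ltW.
have fO : oscb N f.
  exists 0 => z; rewrite add0r; case/andP: (f01 z) => -> /= f1.
  exact: le_trans N1.
have [c cP] := decay (u ++ q) p N0 fK fO.
set e := ratio_const * dec (size q).
have cP' z : c - e <= Qw (u' ++ q) p f z <= c + N * dec (size p) + e.
  have := Qw_suffix_dist u u' q p z f01; rewrite -/e ler_norml => /andP[e1 e2].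
  have /andP[c1 c2] := cP z; move: c1 c2; rewrite -/(dec _) [dec _ * N]mulrC => c1 c2.
  by apply/andP; split; lra.
rewrite !Qw_cat//.
have /andP[x1 x2] := Qr ((u ++ q) ++ p) s cP x.
have /andP[y1 y2] := Qr ((u' ++ q) ++ p) s' cP' y.
move: x2; rewrite -/(dec _) [dec _ * N]mulrC => x2.
by rewrite ler_norml; apply/andP; split; lra.
Qed.

Definition agree (n : nat) u v u' v' : Prop :=
  exists q p u0 u0' s s', [/\ size q = n, size p = n, u = u0 ++ q, u' = u0' ++ q &
    v = p ++ s /\ v' = p ++ s'].

Lemma agree_dist n u v u' v' f (H : R) x y : agree n u v u' v' ->
  0 <= H -> (forall z, 0 <= f z <= 1) -> hol H f ->
  `|Qw u v f x - Qw u' v' f y| <= (1 + H / K + ratio_const) * dec n.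
Proof.
move=> [q [p [u0 [u0' [s [s' [sq sp -> -> [-> ->]]]]]]]] H0 f01 fH.
by rewrite (le_trans (Qw_dist_decay _ _ _ _ _ _ _ _ H0 f01 fH))// sq sp -mulrDl.
Qed.

Lemma dec_small (e : R) : (0 < m0)%N -> 0 < e -> exists n0, forall n, (n0 <= n)%N -> dec n <= e.
Proof.
move=> m00 e0; have r1 : `|rho| < 1 by case/andP: rho01 => r0 r1; rewrite gtr0_norm.
have := cvg_expr r1; move/cvgrPdist_lt/(_ _ e0) => [N _ NP].
exists (N * m0)%N => n Nn; have NN : (N <= n %/ m0)%N by rewrite leq_divRL.
have := NP _ NN; rewrite /= sub0r normrN => h.
by rewrite (le_trans (ler_norm _))// ltW.
Qed.

Lemma agree_continuous f (e : R) : (0 < m0)%N -> continuous f -> 0 < e ->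
  exists n0, forall n u v u' v' x y, (n0 <= n)%N -> agree n u v u' v' ->
    `|Qw u v f x - Qw u' v' f y| <= e.
Proof.
move=> m00 cf e0; have e40 : 0 < e / 4 by rewrite divr_gt0.
have [h [C [hC fh]]] := lipschitz_dense X_compact cf e40.
have ch := continuous_lip hC.
have [M MP] := continuous_bounded X_compact ch.
have M0 : 0 <= M by rewrite (le_trans _ (MP point)).
pose c := (2 * M + 1)^-1; have c0 : 0 < c by rewrite invr_gt0; lra.
pose h1 z := c * (h z + M).
have h101 z : 0 <= h1 z <= 1.
  have := MP z; rewrite ler_norml => /andP[? ?].
  rewrite /h1 mulr_ge0 ?(ltW c0)//=; last by lra.
  by rewrite /c mulrC ler_pdivrMr; lra.
have h1H : hol (c * `|C|) h1.
  move=> z t zt; rewrite /h1 -mulrBr normrM gtr0_norm// -mulrA ler_pM2l//.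
  rewrite opprD addrACA subrr addr0 (le_trans (hC z t))//.
  apply: (@le_trans _ _ (`|C| * mdist z t)); first by rewrite ler_wpM2r ?mdist_ge0// ler_norm.
  by rewrite ler_wpM2l// powR_le_id// ?mdist_ge0// ltW// (lt_le_trans zt).
have H0 : 0 <= c * `|C| by rewrite mulr_ge0// ltW.
pose A := 1 + c * `|C| / K + ratio_const.
have A0 : 0 < A.
  by rewrite ltr_wpDr ?ratio_const_ge0// ltr_pwDl// divr_ge0// ltW.
have [n0 n0P] := dec_small m00 (divr_gt0 (mulr_gt0 c0 (divr_gt0 e0 (ltr0n R 2))) A0).
exists n0 => n u v u' v' x y nn ag.
have d1 := agree_dist x y ag H0 h101 h1H.
have hE u1 v1 z : Qw u1 v1 h1 z = c * (Qw u1 v1 h z + M).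
  have -> : Qw u1 v1 h1 z = c * Qw u1 v1 (fun t => h t + M) z by exact: QwZ.
  by rewrite QwD ?Qw_cst.
rewrite !hE -mulrBr normrM gtr0_norm// opprD addrACA subrr addr0 in d1.
have d2 : `|Qw u v h x - Qw u' v' h y| <= e / 2.
  rewrite -(ler_pM2l c0) (le_trans d1)// -/A -ler_pdivlMl// mulrC.
  exact: n0P.
have q1 := Qw_dist phi g_fin g_surj u v fh x.
have q2 := Qw_dist phi g_fin g_surj u' v' fh y.
move: d2 q1 q2; rewrite !ler_norml => /andP[? ?] /andP[? ?] /andP[? ?].
by apply/andP; split; lra.
Qed.

End quotient_convergence.

(** * The limit measures *)

(** Turns a decay per block of length [L] into a decay per letter, with [b] the [L]-th root of [t];
    the factor [t^-1] pays for the incomplete last block. *)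
Lemma expr_divn_le (R : realType) (t : R) (L : nat) : 0 < t < 1 -> (0 < L)%N ->
  exists2 b : R, 0 < b < 1 & forall n, t ^+ (n %/ L) <= t^-1 * b ^+ n.
Proof.
move=> /andP[t0 t1] L0; pose b := t `^ L%:R^-1.
have L0' : 0 < L%:R^-1 :> R by rewrite invr_gt0 ltr0n.
have b0 : 0 < b by exact: powR_gt0.
have bL : b ^+ L = t.
  rewrite -powR_mulrn ?(ltW b0)// /b -powRrM mulVf ?powRr1 ?ltW//.
  by rewrite pnatr_eq0 -lt0n.
have b1 : b < 1.
  have -> : 1 = 1 `^ L%:R^-1 :> R by rewrite powR1.
  by rewrite /b gt0_ltr_powR// nnegrE// ltW.
exists b; first by rewrite b0.
move=> n; rewrite {2}(divn_eq n L) exprD mulnC exprM bL mulrCA -[leLHS]mulr1.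
rewrite ler_wpM2l ?exprn_ge0 ?(ltW t0)// ler_pdivlMl// mulr1 -[leLHS]bL.
by rewrite ler_wiXn2l ?(ltW b0) ?(ltW b1)// ltnW// ltn_pmod.
Qed.

Lemma mkseq_add (T : Type) (f : nat -> T) n m :
  mkseq f (n + m) = mkseq f n ++ mkseq (fun i => f (n + i)%N) m.
Proof. by rewrite /mkseq iotaD map_cat add0n -{2}[n]addn0 iotaDl -map_comp. Qed.

Section limit_measures.
Context {R : realType} {X : pmetricType R} {k : nat}.
Variables (g : 'I_k -> X -> X) (phi : X -> R) (a lambda alpha D : R).
Hypothesis X_compact : compact [set: X].
Hypothesis a_gt0 : 0 < a.
Hypothesis a_le1 : a <= 1.
Hypothesis lambda_gt0 : 0 < lambda.
Hypothesis lambda_lt1 : lambda < 1.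
Hypothesis alpha_gt0 : 0 < alpha.
Hypothesis alpha_le1 : alpha <= 1.
Hypothesis g_surj : forall i y, exists x, g i x = y.
Hypothesis g_exp : forall i, ruelle_expanding a lambda (g i).
Hypothesis g_mix : jointly_mixing g.
Hypothesis D_ge0 : 0 <= D.
Hypothesis phi_hol : forall x y, `|phi x - phi y| <= D * mdist x y `^ alpha.
Implicit Types (u v w : seq 'I_k) (f h F : X -> R) (x y z : X) (s o : nat -> 'I_k).
Local Notation prob := (probability (borel X) R).

Local Notation Lw := (Lw g phi).
Local Notation Fw := (Fw g phi).
Local Notation Qw := (Qw g phi).

Let g_fin i : finpre (g i).
Proof. exact: (g_finpre X_compact a_gt0 (@g_exp)). Qed.

Let trc i h : continuous h -> continuous (tr (g i) phi h).
Proof. by move=> ch; apply: (tr_continuous_g X_compact a_gt0 lambda_lt1 alpha_gt0 (@g_exp) D_ge0 phi_hol). Qed.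

(** Fixes the constants of the contraction once. The second clause, a relative bound on normalising
    functions, serves the construction of eigenfunctions; the third has no rate, since it concerns
    functions that are merely continuous. *)
Lemma quotient_decay : exists C b : R, [/\ 0 < C, 0 < b < 1,
  forall n u v u' v' f (H : R) x y, agree n u v u' v' ->
    0 <= H -> (forall z, 0 <= f z <= 1) ->
    (forall z t, `|f z - f t| <= H * mdist z t `^ alpha) ->
    `|Qw u v f x - Qw u' v' f y| <= C * (1 + H) * b ^+ n,
  forall u u' q x y, Fw (u ++ q) x * Fw (u' ++ q) y <=
    (1 + C * b ^+ size q) * (Fw (u ++ q) y * Fw (u' ++ q) x) &
  forall f (e : R), continuous f -> 0 < e ->
    exists n0, forall n u v u' v' x y, (n0 <= n)%N -> agree n u v u' v' ->
    `|Qw u v f x - Qw u' v' f y| <= e].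
Proof.
have [K [rho [m0 [K0 rho01 m00 dec]]]] := Qw_osc_decay X_compact a_gt0 a_le1
  lambda_gt0 lambda_lt1 alpha_gt0 g_surj (@g_exp) g_mix D_ge0 phi_hol.
have [B B1 BP] := Fw_ratio X_compact a_gt0 a_le1
  lambda_gt0 lambda_lt1 alpha_gt0 g_surj (@g_exp) g_mix D_ge0 phi_hol.
have [b b01 bP] := expr_divn_le rho01 m00.
pose r0 := ratio_const lambda alpha D K B.
have r00 : 0 <= r0 by apply: ratio_const_ge0.
have rho0 : 0 < rho^-1 by rewrite invr_gt0; case/andP: rho01.
pose C := (1 + K^-1 + r0) * rho^-1.
have Ki : 0 < K^-1 by rewrite invr_gt0.
have c0 : 0 < 1 + K^-1 + r0 by lra.
have C0 : 0 < C by exact: mulr_gt0.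
have b0 n : 0 <= b ^+ n by rewrite exprn_ge0//; case/andP: b01 => /ltW.
exists C, b; split => //.
- move=> n u v u' v' f H x y ag H0 f01 fH.
  have := agree_dist X_compact a_gt0 a_le1 lambda_gt0 lambda_lt1 alpha_gt0 g_surj
    (@g_exp) D_ge0 phi_hol K0 rho01 dec B1 BP x y ag H0 f01 (fun z t _ => fH z t).
  move=> /le_trans; apply.
  apply: (@le_trans _ _ (((1 + K^-1 + r0) * (1 + H)) * (rho^-1 * b ^+ n))).
    rewrite ler_pM// ?exprn_ge0//.
    - by rewrite addr_ge0// addr_ge0// mulr_ge0// ltW.
    - by case/andP: rho01 => /ltW.
    - rewrite -/r0 (_ : (1 + K^-1 + r0) * (1 + H) =
        (1 + H / K + r0) + (K^-1 + H + r0 * H)); last by ring.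
      rewrite lerDl; apply: addr_ge0; last exact: mulr_ge0.
      by apply: addr_ge0 => //; exact: ltW.
  by rewrite /C le_eqVlt; apply/orP; left; apply/eqP; ring.
- move=> u u' q x y.
  have := Fw_ratio_decay X_compact a_gt0 a_le1 lambda_gt0 lambda_lt1 alpha_gt0 g_surj
    (@g_exp) D_ge0 phi_hol K0 rho01 dec B1 BP u u' q x y.
  move=> /le_trans; apply; rewrite ler_wpM2r ?mulr_ge0 ?(ltW (Fw_gt0 _ _ _ _ _))//.
  rewrite lerD2l (le_trans (ler_wpM2l r00 (bP _)))// /C.
  rewrite [leLHS]mulrA ler_wpM2r// ler_wpM2r ?(ltW rho0)//.
  by rewrite lerDr addr_ge0// ltW.
- move=> f e cf e0.
  exact: (agree_continuous X_compact a_gt0 a_le1 lambda_gt0 lambda_lt1 alpha_gt0 alpha_le1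
    g_surj (@g_exp) D_ge0 phi_hol K0 rho01 dec B1 BP m00 cf e0).
Qed.

Definition left_end s n u := exists u0, u = u0 ++ suffix_word s n.
Definition right_end o n v := exists v0, v = prefix_word o n ++ v0.

Lemma left_end_suffix s n m : (n <= m)%N -> left_end s n (suffix_word s m).
Proof.
move=> nm; exists (rev (mkseq (fun i => s (n + i)%N) (m - n))).
rewrite /suffix_word -rev_cat; congr rev.
by rewrite -{1}(subnKC nm) mkseq_add.
Qed.

Lemma right_end_prefix o n m : (n <= m)%N -> right_end o n (prefix_word o m).
Proof.
move=> nm; exists (mkseq (fun i => o (n + i)%N) (m - n)).
by rewrite /prefix_word -{1}(subnKC nm) mkseq_add.
Qed.

Lemma ends_agree s o n u v u' v' : left_end s n u -> left_end s n u' ->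
  right_end o n v -> right_end o n v' -> agree n u v u' v'.
Proof.
move=> [u0 ->] [u0' ->] [v0 ->] [v0' ->].
exists (suffix_word s n), (prefix_word o n), u0, u0', v0, v0'.
by rewrite /suffix_word /prefix_word size_rev !size_mkseq.
Qed.

(** Two pairs of words with the same ends agree at the junction, so the values along the diagonal
    form a Cauchy sequence whose limit is linear and positive. The convergence is uniform in the
    base point and in all letters beyond the prescribed ends. *)
Lemma limit_functional s o : exists L : (X -> R) -> R, exists m : prob,
  [/\ forall f, continuous f -> \int[m]_x f x = L f &
  forall f (e : R), continuous f -> 0 < e -> exists n0, forall n u v x, (n0 <= n)%N ->
    left_end s n u -> right_end o n v -> `|Qw u v f x - L f| <= e].
Proof.
have [C [b [C0 b01 _ _ HC]]] := quotient_decay.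
pose q n f := Qw (suffix_word s n) (prefix_word o n) f point.
have qC f : continuous f -> cvgn (q^~ f).
  move=> cf; apply/cauchy_cvgP/cauchy_exP => e e0.
  have e20 : 0 < e / 2 by rewrite divr_gt0.
  have [n0 n0P] := HC f _ cf e20; exists (q n0 f), n0 => // m /= nm.
  rewrite /ball/= (@le_lt_trans _ _ (e / 2))//; last first.
    by rewrite ltr_pdivrMr// ltr_pMr// ltr1n.
  apply: (n0P n0) => //; apply: (@ends_agree s o).
  - exact: left_end_suffix.
  - exact: left_end_suffix.
  - exact: right_end_prefix.
  - exact: right_end_prefix.
pose L f := limn (q^~ f).
have LP f (e : R) : continuous f -> 0 < e -> exists n0, forall n u v x, (n0 <= n)%N ->
    left_end s n u -> right_end o n v -> `|Qw u v f x - L f| <= e.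
  move=> cf e0; have [n0 n0P] := HC f _ cf e0.
  exists n0 => n u v x nn lu rv.
  have c1 : (fun m => `|Qw u v f x - q m f|) @ \oo --> `|Qw u v f x - L f|.
    by apply: cvg_norm; apply: cvgB; [exact: cvg_cst|exact: qC].
  apply: (cvgr_to_le c1); exists n => // m /= nm.
  apply: (n0P n) => //; apply: (ends_agree lu _ rv).
  - exact: left_end_suffix.
  - exact: right_end_prefix.
have LD f h : continuous f -> continuous h ->
    L (fun x => f x + h x) = L f + L h.
  move=> cf ch; apply/cvg_lim => //.
  have -> : q^~ (fun x => f x + h x) = (fun n => q n f + q n h).
    by apply/funext => n; rewrite /q QwD.
  by apply: cvgD; exact: qC.
have LZ (c : R) f : continuous f -> L (fun x => c * f x) = c * L f.
  move=> cf; apply/cvg_lim => //.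
  have -> : q^~ (fun x => c * f x) = (fun n => c * q n f).
    by apply/funext => n; rewrite /q QwZ.
  by apply: cvgM; [exact: cvg_cst|exact: qC].
have L0 f : continuous f -> (forall x, 0 <= f x) -> 0 <= L f.
  move=> cf f0; apply: (cvgr_to_ge (qC f cf)); apply: nearW => n.
  rewrite /q -(Qw_cst phi g_fin g_surj (suffix_word s n) (prefix_word o n) 0 point).
  exact: Qw_le.
have L1 : L (fun=> 1) = 1.
  apply/cvg_lim => //; have -> : q^~ (fun=> 1) = (fun=> 1).
    by apply/funext => n; rewrite /q Qw_cst.
  exact: cvg_cst.
have [m mP] := riesz_representation X_compact LD LZ L0 L1.
by exists L, m.
Qed.

(** [mu_so] is picked by [get], so it must be shown that some measure satisfies the predicate. The
    second clause says that the predicate depends only on integrals of continuous functions; with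
    [mu_so_unique] it characterises all candidates for [mu_so]. *)
Lemma mu_so_spec s o : (forall f (e : R), continuous f -> 0 < e ->
    exists n0, forall n u v x, (n0 <= n)%N -> left_end s n u -> right_end o n v ->
    `|Qw u v f x - \int[mu_so g phi s o]_x f x| <= e) /\
  forall m : prob, (forall f, continuous f -> \int[m]_x f x = \int[mu_so g phi s o]_x f x) ->
  forall nu f, continuous f -> dual_quot g phi (suffix_word s z.1) (prefix_word o z.2) nu f
      @[z --> filter_prod \oo \oo] --> \int[m]_x f x.
Proof.
have [L [m [mL LP]]] := limit_functional s o.
have bQ u v f : continuous f -> bmf (Qw u v f : borel X -> R).
  move=> cf; apply: continuous_bmf => //.
  by apply: (Qw_continuous g_fin g_surj) => // i h; exact: trc.
have dualE u v nu f : dual_quot g phi u v nu f = \int[nu]_x Qw u v f x.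
  by rewrite /dual_quot; apply: Rint_eq => x; rewrite transfer_quotE.
have dualL nu f : continuous f ->
    dual_quot g phi (suffix_word s z.1) (prefix_word o z.2) nu f
      @[z --> filter_prod \oo \oo] --> L f.
  move=> cf; apply/cvgrPdist_le => e e0; have [n0 n0P] := LP f e cf e0.
  exists ([set n | (n0 <= n)%N], [set n | (n0 <= n)%N]).
    by split; exact: nbhs_infty_ge.
  move=> [i j] [/= i0 j0]; rewrite dualE -[L f](Rint_cst nu) distrC.
  apply: Rint_dist; [exact: bQ|exact: bmf_cst|] => x.
  by apply: (n0P n0) => //; [exact: left_end_suffix|exact: right_end_prefix].
have mS : forall nu f, continuous f ->
    dual_quot g phi (suffix_word s z.1) (prefix_word o z.2) nu f
      @[z --> filter_prod \oo \oo] --> \int[m]_x f x.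
  by move=> nu f cf; rewrite mL//; exact: dualL.
have muS : forall nu f, continuous f ->
    dual_quot g phi (suffix_word s z.1) (prefix_word o z.2) nu f
      @[z --> filter_prod \oo \oo] --> \int[mu_so g phi s o]_x f x.
  by rewrite /mu_so; case: xgetP => [m' _ //|/(_ m)]; move/(_ mS).
have muL f : continuous f -> \int[mu_so g phi s o]_x f x = L f.
  move=> cf; apply: (@cvg_unique _ (@norm_hausdorff _ _)
    ((fun z : nat * nat =>
      dual_quot g phi (suffix_word s z.1) (prefix_word o z.2) m f) @ filter_prod \oo \oo)).
  - exact: muS.
  - exact: dualL.
split; first by move=> f e cf e0; rewrite muL//; exact: LP.
by move=> m' m'P nu f cf; rewrite m'P//; exact: muS.
Qed.

Lemma mu_so_unique s o (m : prob) :
  (forall nu f, continuous f -> dual_quot g phi (suffix_word s z.1) (prefix_word o z.2) nu f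
      @[z --> filter_prod \oo \oo] --> \int[m]_x f x) ->
  forall f, continuous f -> \int[m]_x f x = \int[mu_so g phi s o]_x f x.
Proof.
move=> mS f cf; have [_ muS] := mu_so_spec s o.
apply: (@cvg_unique _ (@norm_hausdorff _ _)
    ((fun z : nat * nat =>
      dual_quot g phi (suffix_word s z.1) (prefix_word o z.2) m f) @ filter_prod \oo \oo)).
- exact: mS.
- exact: muS.
Qed.

Lemma mu_so_holder : exists C b : R, [/\ 0 < C, 0 < b < 1 &
  forall s o s' o' n f (H : R), suffix_word s n = suffix_word s' n ->
    prefix_word o n = prefix_word o' n ->
    0 <= H -> (forall z, 0 <= f z <= 1) ->
    (forall z t, `|f z - f t| <= H * mdist z t `^ alpha) ->
    `|\int[mu_so g phi s o]_x f x - \int[mu_so g phi s' o']_x f x| <=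
      C * (1 + H) * b ^+ n].
Proof.
have [C [b [C0 b01 HC _ _]]] := quotient_decay.
exists (2 * C), b; split => //; first by rewrite mulr_gt0.
move=> s o s' o' n f H ssE ooE H0 f01 fH.
have cf : continuous f.
  apply/continuous_distP => x e e0.
  have De : 0 < e / (H + 1) by rewrite divr_gt0// ltr_wpDl.
  have [r r0 rP] := powR_lt_small alpha_gt0 De.
  exists r => // y xy; rewrite (le_lt_trans (fH x y))//.
  apply: (@le_lt_trans _ _ ((H + 1) * mdist x y `^ alpha)).
    by rewrite ler_wpM2r ?powR_ge0// lerDl.
  by rewrite mulrC -ltr_pdivlMr ?rP ?mdist_ge0// ltr_wpDl.
have key s1 o1 : `|Qw (suffix_word s1 n) (prefix_word o1 n) f point -
    \int[mu_so g phi s1 o1]_x f x| <= C * (1 + H) * b ^+ n.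
  apply/ler_addgt0Pr => e e0.
  have [n0 n0P] := (mu_so_spec s1 o1).1 f e cf e0.
  pose N := maxn n n0.
  have h1 := n0P N (suffix_word s1 N) (prefix_word o1 N) point (leq_maxr _ _)
    (left_end_suffix _ (leqnn N)) (right_end_prefix _ (leqnn N)).
  have ag : agree n (suffix_word s1 n) (prefix_word o1 n) (suffix_word s1 N) (prefix_word o1 N).
    apply: (@ends_agree s1 o1); [exact: left_end_suffix| |exact: right_end_prefix|].
      exact/left_end_suffix/leq_maxl.
    exact/right_end_prefix/leq_maxl.
  have h2 := HC _ _ _ _ _ _ _ point point ag H0 f01 fH.
  rewrite -(subrK (Qw (suffix_word s1 N) (prefix_word o1 N) f point)
    (Qw (suffix_word s1 n) (prefix_word o1 n) f point)) -addrA.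
  by rewrite (le_trans (ler_normD _ _))// lerD.
have k1 := key s o; have k2 := key s' o'; rewrite -ssE -ooE in k2.
have E : 2 * C * (1 + H) * b ^+ n = C * (1 + H) * b ^+ n + C * (1 + H) * b ^+ n by ring.
rewrite E (le_trans (ler_distD (Qw (suffix_word s n) (prefix_word o n) f point) _ _))//.
apply: lerD; last exact: k2.
rewrite distrC; exact: k1.
Qed.

(** Pulling a net back by the single map [g i] shrinks its mesh by [lambda] and multiplies its size
    by at most the number [M] of preimages. This gives finer nets with exponential control of their
    size. *)
Lemma net_count (i : 'I_k) : exists N M : nat, forall n, exists t : seq X,
  (size t <= N * M ^ n)%N /\
  forall y, exists x, x \in t /\ mdist x y < a * lambda ^+ n.
Proof.
have [M [_ MP]] := pre_card a_gt0 (@g_exp i) X_compact.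
have [t0 t0P] := finite_net X_compact a_gt0.
exists (size t0), M; elim=> [|n [t [tN tP]]].
  by exists t0; rewrite expn0 muln1; split => // y; rewrite mulr1; exact: t0P.
exists (flatten [seq pre (g i) x | x <- t]); split.
  rewrite size_flatten /shape -map_comp sumnE big_map.
  apply: (@leq_trans (\sum_(x <- t) M)); first by apply: leq_sum => x _; exact: MP.
  by rewrite big_const_seq count_predT iter_addn_0 expnS mulnCA leq_mul.
move=> y; have [x [xt xy]] := tP (g i y).
have yx : mdist (g i y) x < a.
  rewrite metric_sym; apply: lt_le_trans xy _.
  by rewrite ler_piMr ?(ltW a_gt0)// exprn_ile1// ltW.
have [z [gz zy]] := expanding_branch (@g_exp i) yx erefl.
exists z; split.
  by apply/flatten_mapP; exists x => //; rewrite mem_pre//; apply/eqP.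
rewrite metric_sym (le_lt_trans zy)// exprS mulrCA ltr_pM2l//.
by rewrite metric_sym.
Qed.

(** [W_holder_bound] at scale [a * lambda ^+ j]: the transport term decays like [theta ^+ j],
    whereas the discrepancy term is [b ^+ n] times a quantity growing exponentially in [j]. Choosing
    [j] proportional to [n] makes both exponentially small. *)
Lemma mu_so_W (Dl : R) (i : 'I_k) : 0 < Dl -> exists C b : R, [/\ 0 < C, 0 < b < 1 &
  forall s o s' o' n, suffix_word s n = suffix_word s' n ->
    prefix_word o n = prefix_word o' n ->
    wasserstein (snow alpha Dl) (mu_so g phi s o) (mu_so g phi s' o') <= C * b ^+ n].
Proof.
move=> Dl0; have [C [b [C0 /andP[b0 b1] HC]]] := mu_so_holder.
have [N [M NM]] := net_count i.
pose M1 : R := M%:R + 1; pose N1 : R := N%:R + 1.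
have M11 : 1 <= M1 by rewrite lerDr.
have N11 : 1 <= N1 by rewrite lerDr.
(* The square of the size of the net divided by its scale grows at most like [M1 ^+ 2 / lambda] to
   the power [j]; [L] is the number of letters whose decay pays for one refinement with a factor 1/2
   to spare, whence [j = n %/ L]. *)
have [L [L0 LP]] : exists L, (0 < L)%N /\ M1 ^+ 2 / lambda * b ^+ L <= 2^-1.
  have nb : `|b| < 1 by rewrite gtr0_norm.
  have c0 : 0 < M1 ^+ 2 / lambda.
    by rewrite divr_gt0// exprn_gt0// (lt_le_trans ltr01).
  have e0 : 0 < 2^-1 / (M1 ^+ 2 / lambda) by rewrite divr_gt0// invr_gt0.
  have := cvg_expr nb; move/cvgrPdist_lt/(_ _ e0) => [n _ /(_ n.+1 (leqnSn n))] /=.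
  rewrite sub0r normrN => h; exists n.+1; split => //.
  by rewrite mulrC -ler_pdivlMr// (le_trans (ler_norm _))// ltW.
have th0 : 0 < theta lambda alpha by apply: theta_gt0.
have th1 : theta lambda alpha < 1 by apply: theta_lt1.
(* The common rate in [j]: 1/2 for the discrepancy term and [theta] for the transport term. *)
pose t := Num.max 2^-1 (theta lambda alpha).
have t2 : 2^-1 <= t by rewrite le_max lexx.
have tth : theta lambda alpha <= t by rewrite le_max lexx orbT.
have t01 : 0 < t < 1.
  rewrite (lt_le_trans th0 tth)/= gt_max th1 andbT.
  by rewrite invf_lt1 ?ltr1n.
have [c c01 cP] := expr_divn_le t01 L0.
have /andP[t0 t1] := t01.
pose A := Dl * (4 * a) `^ alpha + 3 * N1 ^+ 2 / a * C.
have a4 : 0 <= (4 * a) `^ alpha by exact: powR_ge0.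
have A0 : 0 < A.
  rewrite ltr_wpDl ?mulr_ge0 ?(ltW Dl0)// mulr_gt0// divr_gt0// mulr_gt0// exprn_gt0//.
  exact: lt_le_trans N11.
exists (A * t^-1), c; split => //; first by rewrite mulr_gt0// invr_gt0.
move=> s o s' o' n ssE ooE; pose j := (n %/ L)%N.
have [net [netN netP]] := NM j.
have r0 : 0 < a * lambda ^+ j by rewrite mulr_gt0// exprn_gt0.
have lj1 : lambda ^+ j <= 1 by rewrite exprn_ile1// ltW.
have lj0 : 0 < lambda ^+ j by rewrite exprn_gt0.
have r1 : a * lambda ^+ j <= 1 by rewrite mulr_ile1// ltW.
have Hol f (H : R) : 0 <= H -> (forall x, 0 <= f x <= 1) ->
    (forall x y, `|f x - f y| <= H * mdist x y `^ alpha) ->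
    `|\int[mu_so g phi s o]_x f x - \int[mu_so g phi s' o']_x f x| <=
    C * b ^+ n * (1 + H).
  by move=> H0 f01 fH; rewrite mulrAC; exact: HC.
apply: (le_trans (W_holder_bound X_compact alpha_gt0 alpha_le1 Dl0 r0 r1 netP Hol)).
apply: (@le_trans _ _ (A * t ^+ j)).
  2: by rewrite -[leRHS]mulrA; apply: ler_wpM2l; [exact: ltW|exact: cP].
rewrite /A [leRHS]mulrDl; apply: lerD.
  rewrite mulrA powRM ?mulr_ge0 ?(ltW a_gt0) ?(ltW lj0)// mulrA.
  rewrite ler_wpM2l ?mulr_ge0 ?(ltW Dl0)//.
  rewrite -powR_mulrn ?(ltW lambda_gt0)// powRAC powR_mulrn; last exact: ltW.
  by rewrite lerXn2r// nnegrE ltW.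
set S := (size net)%:R.
have SNM : S <= N1 * M1 ^+ j.
  apply: (@le_trans _ _ ((N * M ^ j)%:R)); first by rewrite ler_nat.
  rewrite natrM natrX ler_pM ?exprn_ge0// ?lerDl// lerXn2r ?nnegrE ?lerDl//.
  exact: le_trans M11.
have NM1 : 1 <= N1 * M1 ^+ j.
  by rewrite -[leLHS]mulr1 ler_pM// exprn_ege1.
set S1 := N1 * M1 ^+ j in SNM NM1.
have S0 : 0 <= S by rewrite ler0n.
set r := a * lambda ^+ j in r0 r1 *.
have rinv : 1 <= r^-1 by rewrite invf_ge1.
apply: (@le_trans _ _ (S1 * (C * b ^+ n * (3 * S1 / r)))).
  have cb0 : 0 <= C * b ^+ n by rewrite mulr_ge0 ?exprn_ge0// ltW.
  rewrite ler_pM//.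
    rewrite mulr_ge0// addr_ge0// divr_ge0 ?(ltW r0)// addr_ge0//.
  rewrite ler_wpM2l//.
  have e1 : 1 <= S1 / r by rewrite -[leLHS]mulr1 ler_pM.
  have e2 : (1 + S) / r <= 2 * S1 / r.
    by rewrite ler_pM2r ?invr_gt0//; lra.
  have -> : 3 * S1 / r = S1 / r + 2 * S1 / r by ring.
  by rewrite lerD.
have -> : S1 * (C * b ^+ n * (3 * S1 / r)) =
    3 * N1 ^+ 2 / a * C * ((M1 ^+ 2 / lambda) ^+ j * b ^+ n).
  rewrite /S1 /r expr_div_n -exprM mulnC exprM.
  by field; rewrite !gt_eqF.
rewrite ler_wpM2l//.
  by rewrite mulr_ge0 ?(ltW C0)// divr_ge0 ?(ltW a_gt0)// mulr_ge0// exprn_ge0// (le_trans ler01).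
have bn : b ^+ n <= (b ^+ L) ^+ j.
  rewrite -exprM ler_wiXn2l ?(ltW b0) ?(ltW b1)// mulnC.
  exact: leq_trunc_div.
apply: (@le_trans _ _ ((M1 ^+ 2 / lambda) ^+ j * (b ^+ L) ^+ j)).
  by rewrite ler_wpM2l// exprn_ge0// divr_ge0 ?(ltW lambda_gt0)// exprn_ge0// (le_trans ler01).
rewrite -exprMn (le_trans _ (_ : 2^-1 ^+ j <= _))//.
  rewrite lerXn2r// nnegrE ?invr_ge0//.
  by rewrite mulr_ge0 ?exprn_ge0 ?(ltW b0)// divr_ge0 ?(ltW lambda_gt0)// exprn_ge0// (le_trans ler01).
by rewrite lerXn2r// nnegrE ?invr_ge0// ltW.
Qed.

End limit_measures.

(** * Entropy of finite partitions *)

Section partition_entropy.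
Context {R : realType} {X : pmetricType R}.
Local Notation prob := (probability (borel X) R).
Variable m : prob.
Implicit Types (I J K : finType).

Definition mpart I (xi : X -> I) :=
  forall i, measurable (xi @^-1` [set i] : set (borel X)).

Definition cellp I (xi : X -> I) i : R :=
  pr m (xi @^-1` [set i] : set (borel X)).

Definition joinp I J (xi : X -> I) (eta : X -> J) x := (xi x, eta x).

Lemma mpart_join I J (xi : X -> I) (eta : X -> J) :
  mpart xi -> mpart eta -> mpart (joinp xi eta).
Proof.
move=> mxi meta [i j]; rewrite (_ : _ @^-1` _ =
    (xi @^-1` [set i] : set (borel X)) `&` (eta @^-1` [set j] : set (borel X))).
  by apply: measurableI; [exact: mxi|exact: meta].
by apply/seteqP; split=> [x [<- <-]|x [/= <- <-]].
Qed.

Lemma mpart_refine I J (xi : X -> I) (eta : X -> J) :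
  mpart eta -> (forall x y, eta x = eta y -> xi x = xi y) -> mpart xi.
Proof.
move=> meta H i; rewrite (_ : _ @^-1` _ =
    \bigcup_(j in [set j | exists2 x, eta x = j & xi x = i])
      (eta @^-1` [set j] : set (borel X))); last first.
  apply/seteqP; split=> [x /= xi_i|x [j [y yj <-] /= xj]].
    by exists (eta x) => //; exists x.
  by apply: H; rewrite yj.
apply: fin_bigcup_measurable => [|j _]; last exact: meta.
exact: finite_finset.
Qed.

Lemma mpart_comp I (xi : X -> I) (T : X -> X) : continuous T ->
  mpart xi -> mpart (xi \o T).
Proof.
move=> cT mxi i.
have := continuous_map_borel cT measurableT (mxi i).
by rewrite setTI.
Qed.

Lemma cellp_ge0 I (xi : X -> I) i : 0 <= cellp xi i.
Proof. exact: pr_ge0. Qed.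

Lemma cellp_joinr I J (xi : X -> I) (eta : X -> J) j : mpart xi -> mpart eta ->
  cellp eta j = \sum_i cellp (joinp xi eta) (i, j).
Proof.
move=> mxi meta; rewrite /cellp (pr_partition m mxi (meta j)).
apply: eq_bigr => i _; congr (pr m _).
by apply/seteqP; split=> [x [/= <- <-]|x [<- <-]].
Qed.

Lemma cellp_joinl I J (xi : X -> I) (eta : X -> J) i : mpart xi -> mpart eta ->
  cellp xi i = \sum_j cellp (joinp xi eta) (i, j).
Proof.
move=> mxi meta; rewrite /cellp (pr_partition m meta (mxi i)).
apply: eq_bigr => j _; congr (pr m _).
by apply/seteqP; split=> [x [/= <- <-]|x [<- <-]].
Qed.

Lemma cellp_le1 I (xi : X -> I) i : mpart xi -> cellp xi i <= 1.
Proof. by move=> mxi; apply: pr_le1; exact: mxi. Qed.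

Lemma Rint_simple I (xi : X -> I) (c : I -> R) : mpart xi ->
  bmf ((fun x => c (xi x)) : borel X -> R) /\
  \int[m]_x c (xi x) = \sum_i cellp xi i * c i.
Proof.
move=> mxi.
have E : (fun x => c (xi x)) =
    (fun x : borel X => \sum_i c i * \1_(xi @^-1` [set i] : set (borel X)) x).
  apply/funext => x; rewrite (bigD1 (xi x))//= big1 => [|i ix].
    by rewrite addr0 indicE mem_set// mulr1.
  rewrite indicE memNset ?mulr0//= => xi_i.
  by move: ix; rewrite xi_i eqxx.
have b i : bmf (fun x : borel X => c i * \1_(xi @^-1` [set i] : set (borel X)) x).
  by apply: bmfZ; apply: bmf_indic; exact: mxi.
split; first by rewrite E; apply: bmf_sum.
rewrite E Rint_sum//; apply: eq_bigr => i _.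
rewrite RintZ; last by apply: bmf_indic; exact: mxi.
by rewrite Rint_indic 1?mulrC//; exact: mxi.
Qed.

Local Notation H := (partition_entropy m).

Lemma entropyE I (xi : X -> I) : H xi = - \sum_i cellp xi i * ln (cellp xi i).
Proof. by []. Qed.

(** Gibbs' inequality for the conditional entropy of [xi] given [eta], from [ln t <= t - 1] in each
    cell. The guess [q] only has to be substochastic; particular guesses yield [conditioning],
    [conditional_small] and the upper bound for the entropy rate. *)
Lemma entropy_gibbs I J (xi : X -> I) (eta : X -> J) (q : I -> J -> R) :
  mpart xi -> mpart eta -> (forall i j, 0 <= q i j) ->
  (forall j, \sum_i q i j <= 1) ->
  (forall i j, 0 < cellp (joinp xi eta) (i, j) -> 0 < q i j) ->
  H (joinp xi eta) - H eta <=
  - \sum_i \sum_j cellp (joinp xi eta) (i, j) * ln (q i j).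
Proof.
move=> mxi meta q0 q1 qpos; rewrite !entropyE opprK.
pose P i j := cellp (joinp xi eta) (i, j).
have P0 i j : 0 <= P i j by exact: cellp_ge0.
have PJ j : cellp eta j = \sum_i P i j by exact: cellp_joinr.
have PJ0 j : 0 <= cellp eta j by exact: cellp_ge0.
have -> : \sum_z cellp (joinp xi eta) z * ln (cellp (joinp xi eta) z) =
    \sum_i \sum_j P i j * ln (P i j).
  by rewrite pair_bigA; apply: eq_bigr => -[].
have -> : \sum_j cellp eta j * ln (cellp eta j) =
    \sum_i \sum_j P i j * ln (cellp eta j).
  by rewrite exchange_big; apply: eq_bigr => j _; rewrite {1}PJ mulr_suml.
rewrite addrC lerBlDr -lerBlDl opprK -!big_split /=.
apply: (@le_trans _ _ (\sum_i \sum_j (cellp eta j * q i j - P i j +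
   P i j * ln (P i j)))).
  apply: ler_sum => i _; rewrite -big_split /=; apply: ler_sum => j _.
  rewrite -/(P i j); have [Pij|] := ltP 0 (P i j); last first.
    rewrite le_eqVlt ltNge P0 orbF => /eqP ->.
    by rewrite !mul0r subr0 addr0 addr0 mulr_ge0.
  have Pj : 0 < cellp eta j.
    rewrite (lt_le_trans Pij)// PJ (bigD1 i)//= lerDl sumr_ge0//.
  have qij := qpos i j Pij.
  have t0 : 0 < cellp eta j * q i j / P i j by rewrite divr_gt0// mulr_gt0.
  have lnle : ln (cellp eta j * q i j / P i j) <= cellp eta j * q i j / P i j - 1.
    have := @le_ln1Dx _ (cellp eta j * q i j / P i j - 1).
    by rewrite [1 + _]addrC subrK; apply; rewrite ltrBrDl subrr.
  rewrite lnM ?posrE ?mulr_gt0 ?invr_gt0// lnM ?posrE// lnV ?posrE// in lnle.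
  have h := ler_wpM2l (ltW Pij) lnle.
  have e1 : P i j * (cellp eta j * q i j / P i j - 1) = cellp eta j * q i j - P i j.
    by field; rewrite gt_eqF.
  rewrite e1 in h; apply: le_trans (_ : P i j * (ln (cellp eta j) + ln (q i j) - ln (P i j)) + P i j * ln (P i j) <= _).
    by rewrite le_eqVlt; apply/orP; left; apply/eqP; ring.
  by rewrite lerD2r.
under [leLHS]eq_bigr do rewrite big_split sumrB.
rewrite [leLHS]big_split sumrB /= -[leRHS]add0r lerD2r subr_le0.
rewrite exchange_big [leRHS]exchange_big /=.
apply: ler_sum => j _; rewrite -mulr_sumr -PJ -[leRHS]mulr1.
exact: ler_wpM2l.
Qed.

Lemma entropy_refine I J (xi : X -> I) (eta : X -> J) : mpart eta ->
  (forall x y, eta x = eta y -> xi x = xi y) -> H xi <= H eta.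
Proof.
move=> meta ref; have mxi := mpart_refine meta ref.
rewrite !entropyE lerN2.
under eq_bigr do rewrite {1}(cellp_joinr _ mxi meta) mulr_suml.
rewrite exchange_big.
under [leRHS]eq_bigr do rewrite {1}(cellp_joinl _ mxi meta) mulr_suml.
apply: ler_sum => i _; apply: ler_sum => j _.
have [Pij|] := ltP 0 (cellp (joinp xi eta) (i, j)); last first.
  by rewrite le_eqVlt ltNge cellp_ge0 orbF => /eqP ->; rewrite !mul0r.
have le1 : cellp (joinp xi eta) (i, j) <= cellp eta j.
  by rewrite (cellp_joinr _ mxi meta) (bigD1 i)//= lerDl sumr_ge0// => *; exact: cellp_ge0.
have [x [xi_x eta_x]] : exists x, xi x = i /\ eta x = j.
  apply: contrapT => nx; move: Pij; rewrite /cellp.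
  rewrite (_ : _ @^-1` _ = set0) ?pr0 ?ltxx//.
  by apply/seteqP; split=> // x [xi_i eta_j]; apply: nx; exists x.
have le2 : cellp eta j <= cellp xi i.
  apply: pr_le; [exact: meta|exact: mxi|].
  by move=> y /= yj; rewrite -xi_x; apply: ref; rewrite eta_x.
rewrite ler_pM2l// ler_ln ?posrE//; first exact: lt_le_trans le1.
by apply: lt_le_trans le2; exact: lt_le_trans le1.
Qed.

Lemma entropy_equiv I J (xi : X -> I) (eta : X -> J) : mpart eta ->
  (forall x y, eta x = eta y <-> xi x = xi y) -> H xi = H eta.
Proof.
move=> meta E; apply/eqP; rewrite eq_le.
rewrite (entropy_refine meta); last by move=> x y /E.
rewrite entropy_refine//; last by move=> x y /E.
by apply: (mpart_refine meta) => x y /E.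
Qed.

(** Gibbs' inequality, with the conditional probabilities given the coarser [zeta] as a guess for
    those given [eta]. *)
Lemma conditioning I J K (xi : X -> I) (eta : X -> J) (zeta : X -> K) :
  mpart xi -> mpart eta -> (forall x y, eta x = eta y -> zeta x = zeta y) ->
  H (joinp xi eta) - H eta <= H (joinp xi zeta) - H zeta.
Proof.
move=> mxi meta ref; have mz := mpart_refine meta ref.
pose P i l := cellp (joinp xi zeta) (i, l).
(* The cell of [zeta] that contains the [j]-th cell of [eta]; labels of empty cells receive that of
   [point]. *)
have /choice[f fP] : forall j, exists l, forall x, eta x = j -> zeta x = l.
  move=> j; have [[x xj]|nx] := pselect (exists x, eta x = j).
    by exists (zeta x) => y yj; apply: ref; rewrite yj.
  by exists (zeta point) => x xj; case: nx; exists x.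
have PZ l : cellp zeta l = \sum_i P i l by exact: cellp_joinr.
have P0 i l : 0 <= P i l by exact: cellp_ge0.
have Z0 l : 0 <= cellp zeta l by exact: cellp_ge0.
pose q i j := P i (f j) / cellp zeta (f j).
have sub i j : cellp (joinp xi eta) (i, j) <= P i (f j).
  apply: pr_le; [exact: mpart_join|exact: mpart_join|].
  by move=> x [/= xi_i /fP xj]; rewrite /joinp xi_i xj.
have PZle i l : P i l <= cellp zeta l.
  by rewrite PZ (bigD1 i)//= lerDl sumr_ge0.
apply: (le_trans (@entropy_gibbs _ _ xi eta q mxi meta _ _ _)).
- by move=> i j; rewrite divr_ge0.
- move=> j; rewrite -mulr_suml -PZ.
  have [->|n0] := eqVneq (cellp zeta (f j)) 0; first by rewrite mul0r.
  by rewrite divff.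
- move=> i j p0; have p1 : 0 < P i (f j) by exact: lt_le_trans (sub i j).
  by rewrite divr_gt0// (lt_le_trans p1).
have E c : \sum_i \sum_j cellp (joinp xi eta) (i, j) * c i (f j) =
    \sum_i \sum_l P i l * c i l.
  have [_ e1] := Rint_simple (fun z => c z.1 (f z.2)) (mpart_join mxi meta).
  have [_ e2] := Rint_simple (fun z => c z.1 z.2) (mpart_join mxi mz).
  rewrite pair_bigA [RHS]pair_bigA.
  transitivity (\int[m]_x c (xi x) (f (eta x))).
    by rewrite e1; apply: eq_bigr => -[].
  transitivity (\int[m]_x c (xi x) (zeta x)); last first.
    by rewrite e2; apply: eq_bigr => -[].
  by apply: Rint_eq => x; rewrite (fP (eta x) x erefl).
rewrite (E (fun i l => ln (P i l / cellp zeta l))) !entropyE opprK.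
have -> : \sum_z cellp (joinp xi zeta) z * ln (cellp (joinp xi zeta) z) =
    \sum_i \sum_l P i l * ln (P i l).
  by rewrite pair_bigA; apply: eq_bigr => -[].
have -> : \sum_l cellp zeta l * ln (cellp zeta l) =
    \sum_i \sum_l P i l * ln (cellp zeta l).
  by rewrite exchange_big; apply: eq_bigr => l _; rewrite {1}PZ mulr_suml.
rewrite addrC -opprB lerN2 -sumrB; apply: ler_sum => i _.
rewrite -sumrB; apply: ler_sum => l _.
have [p0|] := ltP 0 (P i l); last first.
  by rewrite le_eqVlt ltNge P0 orbF => /eqP ->; rewrite !mul0r subrr.
have z0 : 0 < cellp zeta l by exact: lt_le_trans (PZle i l).
by rewrite ln_div ?posrE// mulrBr.
Qed.

Lemma entropy_lower I (xi : X -> I) (F : X -> R) : mpart xi ->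
  bmf (F : borel X -> R) -> (forall x, cellp xi (xi x) <= expR (F x)) ->
  - (\int[m]_x F x) <= H xi.
Proof.
move=> mxi bF FP; rewrite entropyE lerN2.
have [_ [M FM]] := bF.
(* On null cells, where the value does not affect the entropy, [- M] keeps the integrand below [F]
   at every point. *)
pose c i := if 0 < cellp xi i then ln (cellp xi i) else - M.
have [bc Ec] := Rint_simple c mxi.
have -> : \sum_i cellp xi i * ln (cellp xi i) = \int[m]_x c (xi x).
  rewrite Ec; apply: eq_bigr => i _; rewrite /c; case: ltP => //.
  by rewrite le_eqVlt ltNge cellp_ge0 orbF => /eqP ->; rewrite !mul0r.
apply: Rint_le => // x; rewrite /c; case: ltP => p0.
  by rewrite -[leRHS]expRK ler_ln ?posrE ?expR_gt0.
by move: (FM x); rewrite ler_norml => /andP[].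
Qed.

End partition_entropy.

(** * Entropy of invariant measures *)

Section invariance.
Context {R : realType} {X : pmetricType R}.
Local Notation prob := (probability (borel X) R).
Variables (T : X -> X) (m : prob).
Hypothesis cT : continuous T.
Hypothesis m_inv : invariant_measure T m.

Lemma invariant_pr (A : set (borel X)) : measurable A ->
  pr m (T @^-1` A) = pr m A.
Proof. by move=> mA; rewrite /pr m_inv. Qed.

Lemma invariant_integral (f : X -> R) : bmf (f : borel X -> R) ->
  bmf ((f \o T) : borel X -> R) /\ \int[m]_x f (T x) = \int[m]_x f x.
Proof.
move=> bf; exact: (Rint_image (continuous_map_borel cT) invariant_pr bf).
Qed.

Lemma invariant_integral_iter (f : X -> R) n : bmf (f : borel X -> R) ->
  bmf ((fun x => f (iter n T x)) : borel X -> R) /\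
  \int[m]_x f (iter n T x) = \int[m]_x f x.
Proof.
move=> bf; elim: n => [|n [b E]]; first by [].
have [b' E'] := invariant_integral b; rewrite -E -E'.
have -> : (fun x => f (iter n.+1 T x)) = (fun x => f (iter n T x)) \o T.
  by apply/funext => x; rewrite iterSr.
by split.
Qed.

Local Notation H := (partition_entropy m).

Lemma entropy_invariant (I : finType) (eta : X -> I) : mpart eta ->
  H (eta \o T) = H eta.
Proof.
move=> meta; rewrite !entropyE; congr (- _); apply: eq_bigr => i _.
have -> // : cellp m (eta \o T) i = cellp m eta i.
exact: (invariant_pr (meta i)).
Qed.

Variables (q : nat) (xi : X -> 'I_q).
Hypothesis mxi : mpart xi.
Local Notation itin := (itinerary T xi).

Lemma itineraryP n x y : itin n x = itin n y <->
  forall j, (j < n)%N -> xi (iter j T x) = xi (iter j T y).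
Proof.
split=> [E j jn|E]; last by apply/ffunP => j; rewrite !ffunE E.
by have := congr1 (fun f : {ffun _} => f (Ordinal jn)) E; rewrite !ffunE.
Qed.

Lemma itinerary_succP n x y : joinp xi (itin n \o T) x = joinp xi (itin n \o T) y <->
  itin n.+1 x = itin n.+1 y.
Proof.
split=> [[E0 /itineraryP E]|/itineraryP E].
  by apply/itineraryP => -[//|j] jn; rewrite !iterSr; exact: E.
congr pair; first exact: (E 0%N).
by apply/itineraryP => j jn; rewrite -!iterSr; exact: E.
Qed.

Lemma mpart_itinerary n : mpart (itin n).
Proof.
elim: n => [|n IH].
  apply: (@mpart_refine _ _ _ _ _ (fun=> tt)) => [[]|x y _]; last first.
    by apply/itineraryP => j; rewrite ltn0.
  by rewrite (_ : _ @^-1` _ = setT)//; apply/seteqP; split.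
apply: (mpart_refine (mpart_join mxi (mpart_comp cT IH))) => x y.
by move/itinerary_succP.
Qed.

Lemma entropy_increment n : H (itin n.+1) - H (itin n) =
  H (joinp xi (itin n \o T)) - H (itin n \o T).
Proof.
rewrite (entropy_invariant (@mpart_itinerary n)); congr (_ - _).
apply: entropy_equiv => [|x y].
  exact: (mpart_join mxi (mpart_comp cT (@mpart_itinerary n))).
exact: itinerary_succP.
Qed.

(** By invariance these are the conditional entropies of the first symbol given the next [n]. They
    decrease by [conditioning], and [H (itin n) / n] is their Cesaro mean; hence the entropy rate
    exists and is below each increment. *)
Let c n := H (itin n.+1) - H (itin n).

Let c_ge0 n : 0 <= c n.
Proof.
rewrite subr_ge0; apply: entropy_refine; first exact: mpart_itinerary.
by move=> x y /itineraryP E; apply/itineraryP => j jn; apply: E; exact: ltnW.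
Qed.

Let c_dec : nonincreasing_seq c.
Proof.
apply/nonincreasing_seqP => n; rewrite /c !entropy_increment.
apply: conditioning => //.
  exact: (mpart_comp cT (@mpart_itinerary n.+1)).
move=> x y /= /itineraryP E; apply/itineraryP => j jn; apply: E; exact: ltnW.
Qed.

Let c_cvg : cvgn c.
Proof.
by apply: nonincreasing_is_cvgn => //; exists 0 => _ [n _ <-].
Qed.

Lemma itinerary_entropy0 : H (itin 0) = 0.
Proof.
rewrite entropyE big1 ?oppr0// => w _.
have -> : cellp m (itin 0) w = 1.
  rewrite /cellp (_ : _ @^-1` _ = setT) ?prT//.
  by apply/seteqP; split=> // x _ /=; apply/ffunP => -[].
by rewrite ln1 mulr0.
Qed.

Lemma entropy_rate_cvg : H (itin n) / n%:R @[n --> \oo] --> limn c.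
Proof.
rewrite -cvg_shiftS; have := cesaro c_cvg; apply: cvg_trans.
apply: near_eq_cvg; apply: nearW => n /=.
rewrite /arithmetic_mean /= mulrC; congr (_ * _).
by rewrite /series/= telescope_sumr// itinerary_entropy0 subr0.
Qed.

Lemma entropy_rate_le n : limn (fun n => H (itin n) / n%:R) <=
  H (joinp xi (itin n \o T)) - H (itin n \o T).
Proof.
rewrite (cvg_lim _ entropy_rate_cvg)// -entropy_increment.
exact: nonincreasing_cvgn_ge.
Qed.

Lemma entropy_rate_ge (s : R) : (forall n, n%:R * s <= H (itin n)) ->
  s <= limn (fun n => H (itin n) / n%:R).
Proof.
move=> sH; apply: limr_ge; first by apply/cvg_ex; eexists; exact: entropy_rate_cvg.
exists 1%N => // n /= n1; rewrite ler_pdivlMr ?ltr0n//.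
by rewrite mulrC.
Qed.

End invariance.

Lemma contract_iter {R : realType} {X : pmetricType R} (T : X -> X) (a lambda : R) n x y :
  0 < a -> 0 < lambda -> lambda < 1 -> ruelle_expanding a lambda T ->
  (forall j, (j <= n)%N -> mdist (iter j T x) (iter j T y) < a) ->
  mdist x y <= lambda ^+ n * mdist (iter n T x) (iter n T y).
Proof.
move=> a0 l0 l1 TE; elim: n x y => [|n IH] x y E; first by rewrite mul1r.
have h := expanding_contract TE (E 0%N isT) (E 1%N isT).
apply: (le_trans h); rewrite exprS -mulrA ler_wpM2l ?(ltW l0)//.
rewrite !iterSr; apply: IH => j jn; rewrite -!iterSr; exact: E.
Qed.

(** * Partitions with small cells nearly determine any given partition *)

Section small_conditional_entropy.
Context {R : realType} {X : pmetricType R}.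
Hypothesis X_compact : compact [set: X].
Local Notation prob := (probability (borel X) R).

(** Around each point some ball meets only those [K i] that contain its centre; compactness makes
    the radius uniform. *)
Lemma closed_separation p (K : 'I_p -> set X) : (forall i, closed (K i)) ->
  (forall i j x, K i x -> K j x -> i = j) ->
  exists2 r : R, 0 < r & forall i j x y, mdist x y < r -> K i x -> K j y -> i = j.
Proof.
move=> cK dK.
have loc x : exists e : R, 0 < e /\ forall i y, mdist x y < 2 * e -> K i y -> K i x.
  have : \forall y \near x, forall i, K i y -> K i x.
    apply: filter_forall => i; have [Kx|nKx] := pselect (K i x).
      by apply: nearW.
    have oK : open (~` K i) by exact: closed_openC.
    have /= := open_nbhs_nbhs (conj oK nKx).
    by apply: filterS => y nKy /nKy.
  move/metricType_numDomainType.nbhs_mdistP => [d d0 dP].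
  exists (d / 2); split; first by rewrite divr_gt0.
  by move=> i y; rewrite mulrC divfK// => /dP; apply.
have /choice[e eP] := loc.
have [s sP] := finite_cover X_compact (fun x => (eP x).1).
have [r r0 rs] : exists2 r : R, 0 < r & forall x, x \in s -> r <= e x.
  elim: s {sP} => [|x s [r r0 rP]]; first by exists 1.
  exists (Num.min (e x) r); first by rewrite lt_min r0 (eP x).1.
  move=> y; rewrite inE => /predU1P[->|/rP ry]; first by rewrite ge_min lexx.
  by rewrite ge_min ry orbT.
exists r => // i j x y xy Kx Ky; have [z [zs zx]] := sP x.
have e0 := (eP z).1; apply: (dK i j z).
  by apply: ((eP z).2 i x) => //; lra.
apply: ((eP z).2 j y) => //; rewrite (le_lt_trans (metric_triangle _ x _))//.
by have := rs z zs; lra.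
Qed.

(** By regularity each cell of [eta] contains a closed core [K i] of almost full measure. The cores
    are separated, so a cell of [beta] of small diameter meets at most one of them and thereby
    predicts the cell of [eta], except on a set of small measure. *)
Lemma conditional_small (m : prob) p (eta : X -> 'I_p) (e : R) : mpart eta -> 0 < e ->
  exists2 r : R, 0 < r & forall (J : finType) (beta : X -> J), mpart beta ->
    (forall x y, beta x = beta y -> mdist x y < r) ->
    partition_entropy m (joinp eta beta) - partition_entropy m beta <= e.
Proof.
move=> meta e0; have e20 : 0 < e / 2 by rewrite divr_gt0.
pose t : R := 1 - expR (- (e / 2)).
have t0 : 0 < t by rewrite subr_gt0 expR_lt1 oppr_lt0.
have t1 : t < 1 by rewrite ltrBlDr ltrDl expR_gt0.
pose p1 : R := p%:R + 1.
have p10 : 0 < p1 by rewrite ltr_wpDl.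
pose k0 := t / p1.
have k00 : 0 < k0 by rewrite divr_gt0.
have k01 : k0 <= 1 by rewrite ler_pdivrMr// mul1r (le_trans (ltW t1))// lerDr.
pose M := - ln k0.
have M0 : 0 <= M by rewrite oppr_ge0 ln_le0.
have M10 : 0 < M + 1 by rewrite ltr_wpDl.
pose s := e / 2 / (M + 1) / p1.
have s0 : 0 < s by rewrite !divr_gt0.
have /choice[K KP] : forall i, exists K : set X, [/\ closed K, K `<=` eta @^-1` [set i] &
    pr m ((eta @^-1` [set i] : set (borel X)) `\` K) <= s].
  move=> i; have [K [U [cK oU KA AU UK]]] := prob_regular m (meta i) s0.
  exists K; split => //; apply: le_trans (ltW UK).
  apply: pr_le; [|by apply: measurableD; [exact: open_borel|exact: closed_borel]|].
    by apply: measurableD; [exact: meta|exact: closed_borel].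
  by move=> x [/AU].
have cK i : closed (K i) by case: (KP i).
have [i j x|r r0 rP] := closed_separation cK.
  by move=> Ki Kj; case: (KP i) => _ /(_ x Ki) <- _; case: (KP j) => _ /(_ x Kj).
exists r => // J beta mb bP.
have /choice[f fP] : forall j, exists i, forall i' x, beta x = j -> K i' x -> i' = i.
  move=> j; have [[i [x [bx Kx]]]|nx] := pselect (exists i x, beta x = j /\ K i x).
    exists i => i' x' bx' Kx'; apply: rP Kx' Kx; apply: bP; by rewrite bx.
  by exists (eta point) => i' x bx Kx; case: nx; exists i', x.
(* The predicted cell [f j] receives probability [expR (- (e / 2))], at cost [e / 2]. The remaining
   [t] is spread over the others, at cost [M = - ln k0], which is paid only outside the cores; [s]
   is chosen to keep the sum of these costs below [e / 2]. *)
pose q i j : R := if i == f j then expR (- (e / 2)) else k0.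
have q0 i j : 0 < q i j by rewrite /q; case: ifP => // _; exact: expR_gt0.
apply: (le_trans (@entropy_gibbs _ _ m _ _ eta beta q meta mb
  (fun i j => ltW (q0 i j)) _ _)).
- move=> j; rewrite (bigD1 (f j))//= /q eqxx.
  apply: (@le_trans _ _ (expR (- (e / 2)) + \sum_(i < p) k0)).
    rewrite lerD2l [leRHS](bigD1 (f j))//= [leLHS](eq_bigr (fun=> k0)).
      by rewrite lerDr ltW.
    by move=> i /negPf ->.
  rewrite sumr_const card_ord -[_ *+ p]mulr_natr /k0 -lerBrDl -/t mulrAC ler_pdivrMr//.
  by rewrite ler_wpM2l ?(ltW t0)// lerDl.
- by move=> i j _; exact: q0.
have [bc Ec] := Rint_simple m (fun z => - ln (q z.1 z.2)) (mpart_join meta mb).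
have -> : - (\sum_i \sum_j cellp m (joinp eta beta) (i, j) * ln (q i j)) =
    \int[m]_x - ln (q (eta x) (beta x)).
  rewrite Ec pair_bigA -sumrN; apply: eq_bigr => -[i j] _ /=.
  by rewrite mulrN.
pose A i : set (borel X) := (eta @^-1` [set i] : set (borel X)) `\` K i.
have mA i : measurable (A i).
  by apply: measurableD; [exact: meta|exact: closed_borel].
have bS : bmf (fun x : borel X => \sum_i M * \1_(A i) x).
  by apply: bmf_sum => i _; apply: bmfZ; exact: bmf_indic.
apply: (@le_trans _ _ (\int[m]_x (e / 2 + \sum_i M * \1_(A i) x))).
  apply: Rint_le => //; first exact: (bmfD (bmf_cst _) bS).
  have S0 x : 0 <= \sum_i M * \1_(A i) x.
    by apply: sumr_ge0 => i _; rewrite mulr_ge0// indicE.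
  move=> x; rewrite /q; case: eqP => [_|ne].
    by rewrite expRK opprK lerDl.
  rewrite -/M (bigD1 (eta x))//= indicE mem_set; last first.
    split => // Kx; apply: ne; exact: (fP (beta x) (eta x) x).
  rewrite mulr1 addrCA lerDl addr_ge0 ?(ltW e20)// sumr_ge0// => i _.
  by rewrite mulr_ge0// indicE.
rewrite (RintD m (bmf_cst _) bS) Rint_cst Rint_sum; last first.
  by move=> i _; apply: bmfZ; exact: bmf_indic.
apply: (@le_trans _ _ (e / 2 + \sum_(i < p) M * s)).
  rewrite lerD2l; apply: ler_sum => i _.
  rewrite RintZ; last exact: bmf_indic.
  by rewrite Rint_indic// ler_wpM2l//; case: (KP i).
rewrite sumr_const card_ord -[_ *+ p]mulr_natr {2}[e]splitr lerD2l.
have -> : M * s * p%:R = (e / 2) * ((M * p%:R) / ((M + 1) * p1)).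
  by rewrite /s; field; rewrite !gt_eqF.
rewrite ler_piMr ?(ltW e20)// ler_pdivrMr ?mulr_gt0// mul1r.
by rewrite ler_pM// lerDl.
Qed.

End small_conditional_entropy.

(** * Entropy and normalised potentials *)

Section normalised_potential.
Context {R : realType} {X : pmetricType R}.
Hypothesis X_compact : compact [set: X].
Local Notation prob := (probability (borel X) R).
Variables (T : X -> X) (a lambda : R).
Hypothesis a_gt0 : 0 < a.
Hypothesis lambda_gt0 : 0 < lambda.
Hypothesis lambda_lt1 : lambda < 1.
Hypothesis cT : continuous T.
Hypothesis T_surj : forall y, exists x, T x = y.
Hypothesis T_exp : ruelle_expanding a lambda T.

Let T_fin : finpre T.
Proof. by have [N []] := pre_card a_gt0 T_exp X_compact. Qed.

Definition normalised (lw : X -> R) := forall x, tr T lw (fun=> 1) x = 1.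

Lemma small_refinement (m : prob) q (xi : X -> 'I_q) (d : R) : mpart xi -> 0 < d ->
  exists p (eta : X -> 'I_p), [/\ mpart eta,
    forall x y, eta x = eta y -> xi x = xi y &
    forall x y, eta x = eta y -> mdist x y < d].
Proof.
move=> mxi d0; have [n [zeta [mz zP]]] := small_partition X_compact d0.
have mj := mpart_join mxi (mz : mpart zeta).
exists #|{: 'I_q * 'I_n}|, (fun x => enum_rank (joinp xi zeta x)); split.
- by apply: (mpart_refine mj) => x y ->.
- by move=> x y /enum_rank_inj[].
- by move=> x y /enum_rank_inj[_ /zP].
Qed.

(* [al x] is the preimage close to [x] of the representative of the cell of [T x].
   The entropy of [eta] given its future is at most the entropy of [al] given the
   cell of [T x], bounded by Gibbs' inequality with the weights [expR lw], plus the
   entropy of [eta] given [al] and the future, whose cells shrink. *)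
Lemma entropy_rate_upper (m : prob) (lw : X -> R) q (xi : X -> 'I_q) :
  invariant_measure T m -> continuous lw -> normalised lw -> mpart xi ->
  limn (fun n => partition_entropy m (itinerary T xi n) / n%:R) <= - \int[m]_x lw x.
Proof.
move=> m_inv clw nlw mxi; apply/ler_addgt0Pr => e e0.
have e20 : 0 < e / 2 by rewrite divr_gt0.
have [d1 d10 d1P] := continuous_unif X_compact clw e20.
pose d := Num.min d1 (a / 2).
have d0 : 0 < d by rewrite lt_min d10 divr_gt0.
have da : d <= a / 2 by rewrite ge_min lexx orbT.
have dd1 : d <= d1 by rewrite ge_min lexx.
have [p [eta [meta eta_xi eta_d]]] := small_refinement m mxi d0.
apply: (@le_trans _ _ (limn (fun n => partition_entropy m (itinerary T eta n) / n%:R))).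
  apply: ler_lim.
  - by apply/cvg_ex; eexists; exact: (entropy_rate_cvg cT m_inv mxi).
  - by apply/cvg_ex; eexists; exact: (entropy_rate_cvg cT m_inv meta).
  apply: nearW => n; rewrite ler_wpM2r ?invr_ge0//.
  apply: entropy_refine => [|x y]; first exact: (mpart_itinerary cT meta).
  by move=> /itineraryP E; apply/itineraryP => j jn; apply: eta_xi; exact: E.
have /choice[zr zrP] : forall j, exists z, forall x, eta x = j -> mdist x z < d.
  move=> j; have [[z zj]|nz] := pselect (exists z, eta z = j).
    by exists z => x xj; apply: eta_d; rewrite zj.
  by exists point => x xj; case: nz; exists x.
have /choice[al alP] : forall x, exists y, T y = zr (eta (T x)) /\ mdist x y < d.
  move=> x; have xz := zrP _ (T x) erefl.
  have xa : mdist (T x) (zr (eta (T x))) < a by rewrite (lt_le_trans xz)//; lra.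
  have [y [Ty xy]] := expanding_branch T_exp xa erefl.
  exists y; split => //; rewrite (le_lt_trans xy)// (le_lt_trans _ xz)//.
  by rewrite ler_piMl ?mdist_ge0// ltW.
pose s := undup (flatten [seq pre T (zr j) | j <- enum 'I_p]).
have sP y j : T y = zr j -> y \in s.
  move=> Ty; rewrite mem_undup; apply/flatten_mapP; exists j; first by rewrite mem_enum.
  by rewrite mem_pre// Ty.
have al_s x : (index (al x) s < size s)%N.
  by rewrite index_mem; apply: (sP _ (eta (T x))); case: (alP x).
pose ai x := Ordinal (al_s x).
have aiE x : nth point s (ai x) = al x by rewrite nth_index// -index_mem.
have mai : mpart ai.
  (* By injectivity at scale [a], [al x] is the [i]-th point exactly when [x] is within [d] of it
     and the representative of the cell of [T x] is its image; both conditions are measurable. *)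
  move=> i; pose B : set (borel X) := [set x | mdist (nth point s i) x < d].
  pose J := [set j | zr j = T (nth point s i)].
  rewrite (_ : _ @^-1` _ = B `&` \bigcup_(j in J) ((eta \o T) @^-1` [set j])).
    apply: measurableI; first by apply: open_borel; exact: open_mball.
    apply: fin_bigcup_measurable => [|j _]; first exact: finite_finset.
    exact: (mpart_comp cT meta).
  apply/seteqP; split=> [x /= xi_i|x [/= xi_x [j /= jE jx]]].
    rewrite /B/= /J/= -xi_i aiE; have [Ta xa] := alP x; split; first by rewrite metric_sym.
    by exists (eta (T x)) => //=; rewrite aiE Ta.
  rewrite -{}jx in jE; apply/val_inj => /=; have [Ta xa] := alP x.
  have -> : al x = nth point s i.
    apply: (expanding_inj a_gt0 T_exp); first by rewrite Ta.
    have h1 : mdist (al x) x < d by rewrite metric_sym.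
    have h2 : mdist x (nth point s i) < d by rewrite metric_sym.
    by rewrite (le_lt_trans (metric_triangle _ x _))//; lra.
  by rewrite index_uniq// undup_uniq.
(* The guess for [al x] when [T x] lies in the cell [j]: the weights [expR lw] on the preimages of
   the representative. Their sum is 1 by normalisation, and their logarithms integrate to nearly
   that of [lw]. *)
pose w j y : R := if T y == zr j then expR (lw y) else 0.
pose q' (i : 'I_(size s)) j := w j (nth point s i).
have q'0 i j : 0 <= q' i j by rewrite /q' /w; case: ifP => // _; exact: expR_ge0.
have q'1 j : \sum_i q' i j <= 1.
  rewrite (_ : \sum_i q' i j = \sum_(y <- s) w j y); last first.
    by rewrite (big_nth point) big_mkord.
  rewrite /w -big_mkcond -big_filter -(nlw (zr j)) /tr.
  rewrite [leRHS](eq_bigr (fun y => expR (lw y))) => [|y _]; last by rewrite mulr1.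
  rewrite le_eqVlt; apply/orP; left; apply/eqP/perm_big.
  apply: uniq_perm; [by rewrite filter_uniq// undup_uniq|exact: pre_uniq|].
  move=> y; rewrite mem_filter mem_pre//; case: eqP => //= Ty.
  by rewrite (sP _ _ Ty).
have q'E x : q' (ai x) (eta (T x)) = expR (lw (al x)).
  by rewrite /q' /w aiE; case: (alP x) => -> _; rewrite eqxx.
have al_bound : partition_entropy m (joinp ai (eta \o T)) - partition_entropy m (eta \o T) <=
    - (\int[m]_x lw x) + e / 2.
  have met := mpart_comp cT meta.
  apply: (le_trans (@entropy_gibbs _ _ m _ _ ai (eta \o T) q' mai met q'0 q'1 _)).
    move=> i j p0; have [x [<- <-]] : exists x, ai x = i /\ (eta \o T) x = j.
      apply: contrapT => nx; move: p0; rewrite /cellp.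
      rewrite (_ : _ @^-1` _ = set0) ?pr0 ?ltxx//.
      by apply/seteqP; split=> // x [xi_i eta_j]; apply: nx; exists x.
    by rewrite /= q'E expR_gt0.
  have [bc Ec] := Rint_simple m (fun z => ln (q' z.1 z.2)) (mpart_join mai met).
  have -> : \sum_i \sum_j cellp m (joinp ai (eta \o T)) (i, j) * ln (q' i j) =
      \int[m]_x ln (q' (ai x) (eta (T x))).
    by rewrite Ec pair_bigA; apply: eq_bigr => -[].
  have blw := continuous_bmf X_compact clw.
  rewrite lerNl opprD opprK lerBlDr -{1}(Rint_cst m (e / 2)).
  rewrite -(RintD m bc (bmf_cst _)); apply: Rint_le => //.
    exact: (bmfD bc (bmf_cst _)).
  move=> x; rewrite q'E expRK -lerBlDl.
  have [_ xa] := alP x; rewrite (le_trans (ler_norm _))// ltW// d1P//.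
  exact: lt_le_trans dd1.
have [r r0 rP] := conditional_small X_compact m meta e20.
have [n n0 nr] : exists2 n, (0 < n)%N & lambda ^+ n * a < r.
  have nl : `|lambda| < 1 by rewrite gtr0_norm.
  have ra : 0 < r / a by rewrite divr_gt0.
  have := cvg_expr nl; move/cvgrPdist_lt/(_ _ ra) => [n _ /(_ n.+1 (leqnSn n))] /=.
  rewrite sub0r normrN => h; exists n.+1 => //.
  by rewrite -ltr_pdivlMr// (le_lt_trans (ler_norm _)).
apply: (le_trans (entropy_rate_le cT m_inv meta n)).
pose itn := itinerary T eta n \o T.
have mitn : mpart itn by exact: (mpart_comp cT (@mpart_itinerary _ _ _ cT _ _ meta n)).
pose beta := joinp ai itn.
have mbeta : mpart beta by exact: mpart_join.
have step1 : partition_entropy m (joinp eta itn) <= partition_entropy m (joinp eta beta).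
  apply: entropy_refine; first exact: mpart_join.
  by move=> x y; rewrite /joinp/= => -[-> _ ->].
(* Equal values of [al] put two points within [a] of each other, and equal future cells keep their
   next [n] images within [a]; contraction along the orbit then makes the cells of [beta] smaller
   than [r]. *)
have step2 : partition_entropy m (joinp eta beta) - partition_entropy m beta <= e / 2.
  apply: rP => // x y [aixy].
  move=> /itineraryP E; rewrite (le_lt_trans _ nr)//.
  have axy : al x = al y by rewrite -!aiE /= aixy.
  have near0 : mdist x y < a.
    rewrite (le_lt_trans (metric_triangle _ (al x) _))//.
    have [_ h1] := alP x; have [_ h2] := alP y.
    rewrite metric_sym -axy in h2; lra.
  have nearj j : (j <= n)%N -> mdist (iter j T x) (iter j T y) < a.
    case: j => [//|j] jn; rewrite !iterSr.
    by have := eta_d _ _ (E j jn); lra.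
  apply: (le_trans (contract_iter a_gt0 lambda_gt0 lambda_lt1 T_exp nearj)).
  by rewrite ler_wpM2l ?exprn_ge0 ?(ltW lambda_gt0)// ltW// nearj.
have step3 : partition_entropy m beta - partition_entropy m itn <=
    - (\int[m]_x lw x) + e / 2.
  apply: (le_trans _ al_bound); apply: conditioning => // x y.
  move=> /itineraryP E; exact: (E 0%N).
rewrite -/itn [e in leRHS]splitr; lra.
Qed.

Lemma measure_entropy_upper (m : prob) (lw : X -> R) :
  invariant_measure T m -> continuous lw -> normalised lw ->
  (measure_entropy m T <= (- \int[m]_x lw x)%:E)%E.
Proof.
move=> m_inv clw nlw; apply: ge_ereal_sup => _ [q [xi [mxi ->]]].
by rewrite lee_fin; exact: entropy_rate_upper.
Qed.

Section eigenmeasure.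
Variables (m : prob) (lw : X -> R).
Hypothesis clw : continuous lw.
Hypothesis nlw : normalised lw.
Hypothesis m_fix : forall f : X -> R, continuous f ->
  \int[m]_x tr T lw f x = \int[m]_x f x.

(** For a normalised potential the operator takes [f \o T] back to [f], so a fixed measure gives
    both functions the same integral. *)
Lemma fixed_invariant : invariant_measure T m.
Proof.
have cf (f : X -> R) : continuous f -> continuous (f \o T).
  by move=> cf x; apply: continuous_comp; [exact: cT|exact: cf].
have E (f : X -> R) : continuous f -> \int[m]_x f (T x) = \int[m]_x f x.
  move=> cont_f; rewrite -(m_fix (cf f cont_f)); apply: Rint_eq => x.
  transitivity (f x * tr T lw (fun=> 1) x); last by rewrite nlw mulr1.
  rewrite /tr mulr_sumr !big_seq; apply: eq_bigr => y.
  by rewrite mem_pre//= => /eqP ->; rewrite mulr1 mulrC.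
have [||Q QP] := density_probability (P := m) (continuous_map_borel cT) (bmf_cst 1).
- by move=> x; exact: ler01.
- exact: Rint_cst.
have QE (f : borel X -> R) : bmf f -> \int[Q]_x f x = \int[m]_x f (T x).
  by move=> bf; rewrite QP//; apply: Rint_eq => x; rewrite mulr1.
have Qm : forall f : X -> R, continuous f -> \int[Q]_x f x = \int[m]_x f x.
  by move=> f cont_f; rewrite QE ?E//; exact: continuous_bmf.
move=> A mA.
have mTA : measurable (T @^-1` A : set (borel X)).
  by have := continuous_map_borel cT measurableT mA; rewrite setTI.
rewrite -(prob_continuous_unique X_compact Qm mA) (pr_fin m mTA) (pr_fin Q mA).
congr EFin; rewrite -(Rint_indic m mTA) -(Rint_indic Q mA) QE//; last exact: bmf_indic.
Qed.

(* A test function supported in [V] sees at most one preimage of each point. *)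
Lemma fixed_cell (E V : set X) (s : R) : measurable (E : set (borel X)) -> open V ->
  (forall x y, V x -> V y -> mdist x y < a) -> (forall x, V x -> expR (lw x) <= s) ->
  0 <= s ->
  forall A : set X, measurable (A : set (borel X)) -> A `<=` V ->
  pr m (A `&` T @^-1` E : set (borel X)) <= s * pr m (E : set (borel X)).
Proof.
move=> mE oV Va Vs s0 A mA AV.
have mTE (B : set X) : measurable (B : set (borel X)) -> measurable (T @^-1` B : set (borel X)).
  by move=> mB; have := continuous_map_borel cT measurableT mB; rewrite setTI.
apply/ler_addgt0Pr => e e0.
have es : 0 < e / (s + 1) by rewrite divr_gt0// ltr_wpDl.
have [K [U [cK oU KE EU UK]]] := prob_regular m mE es.
have mU := open_borel oU; have mK := closed_borel cK.
have UE : pr m (U : set (borel X)) <= pr m (E : set (borel X)) + e / (s + 1).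
  rewrite -lerBlDl -(prD m mU mE EU) (le_trans _ (ltW UK))//.
  apply: pr_le; [exact: measurableD|exact: measurableD|].
  by move=> x [Ux nEx]; split => // /KE.
apply: (@le_trans _ _ (s * pr m (U : set (borel X)))); last first.
  apply: (le_trans (ler_wpM2l s0 UE)); rewrite mulrDr lerD2l.
  by rewrite mulrCA ler_piMr ?(ltW e0)// ler_pdivrMr ?ltr_wpDl// mul1r lerDl.
pose W : set X := V `&` T @^-1` U.
have oW : open W by apply: openI => //; move/continuousP: cT; exact.
apply: (@le_trans _ _ (pr m (W : set (borel X)))).
  apply: pr_le; [|exact: open_borel|].
    by apply: measurableI => //; exact: mTE.
  by move=> x [/AV Vx /EU].
apply: pr_open_le => // h ch h01 h0.
rewrite -(m_fix ch) -(Rint_indic m mU) -RintZ; last exact: bmf_indic.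
apply: Rint_le.
- by apply: continuous_bmf => //; exact: (tr_continuous a_gt0 lambda_lt1 T_exp X_compact).
- by apply: bmfZ; exact: bmf_indic.
move=> x; have [[y [Ty Wy]]|nW] := pselect (exists y, T y = x /\ W y); last first.
  rewrite /tr big_seq big1 => [|y].
    by rewrite mulr_ge0// indicE.
  rewrite mem_pre// => /eqP Ty; rewrite h0 ?mulr0// => Wy.
  by apply: nW; exists y.
have Ux : U x by rewrite -Ty; case: Wy.
rewrite indicE mem_set// mulr1 /tr (bigD1_seq y) ?pre_uniq ?mem_pre ?Ty//=.
rewrite big_seq_cond big1 => [|z]; last first.
  rewrite mem_pre// => /andP[/eqP Tz zy]; rewrite h0 ?mulr0// => Wz.
  move/eqP: zy; apply; apply: (expanding_inj a_gt0 T_exp); first by rewrite Tz Ty.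
  by apply: Va; [case: Wz|case: Wy].
rewrite addr0 (le_trans _ (Vs y _))//; last by case: Wy.
by rewrite ler_piMr ?expR_ge0//; case/andP: (h01 y).
Qed.

(** Removing the first symbol with [fixed_cell] bounds the measure of an itinerary cell by the
    exponential of the sum of [lw + e] along the orbit. Taking logarithms and using invariance, each
    step contributes at least minus the integral of [lw], up to [e]. *)
Lemma measure_entropy_lower : ((- \int[m]_x lw x)%:E <= measure_entropy m T)%E.
Proof.
have m_inv := fixed_invariant; have blw := continuous_bmf X_compact clw.
apply/lee_addgt0Pr => e e0; have e20 : 0 < e / 2 by rewrite divr_gt0.
have [d1 d10 d1P] := continuous_unif X_compact clw e20.
pose d := Num.min d1 (a / 2).
have d0 : 0 < d by rewrite lt_min d10 divr_gt0.
have da : d <= a / 2 by rewrite ge_min lexx orbT.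
have dd1 : d <= d1 by rewrite ge_min lexx.
have [p [eta [meta eta_d]]] := small_partition X_compact d0.
pose F n x := \sum_(j < n) (lw (iter j T x) + e).
have cellF n x : cellp m (itinerary T eta n) (itinerary T eta n x) <= expR (F n x).
  elim: n x => [|n IH] x.
    rewrite /F big_ord0 expR0; apply: cellp_le1; exact: (mpart_itinerary cT).
  pose A := eta @^-1` [set eta x].
  pose E := itinerary T eta n @^-1` [set itinerary T eta n (T x)].
  have mE : measurable (E : set (borel X)) by exact: (mpart_itinerary cT).
  rewrite /cellp (_ : _ @^-1` _ = A `&` T @^-1` E); last first.
    apply/seteqP; split=> y /=.
      by move/itinerary_succP => [E0 E1]; split.
    by move=> [E0 E1]; apply/itinerary_succP; congr pair.
  apply: (@le_trans _ _ (expR (lw x + e) * pr m (E : set (borel X)))).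
    apply: (@fixed_cell _ [set y | mdist x y < d]) => //.
    - exact: open_mball.
    - move=> y z /= xy xz; rewrite (le_lt_trans (metric_triangle _ x _))// metric_sym.
      by lra.
    - move=> y /= xy; rewrite ler_expR.
      have := d1P _ _ (lt_le_trans xy dd1); rewrite ltr_norml => /andP[h _].
      by lra.
    - exact: meta.
    - by move=> y yx; apply: eta_d.
  rewrite /F big_ord_recl [leRHS]expRD ler_pM2l ?expR_gt0//.
  rewrite (eq_bigr (fun j : 'I_n => lw (iter j T (T x)) + e)) => [|j _].
    exact: IH.
  by rewrite -iterSr.
have bF n : bmf (F n : borel X -> R).
  apply: bmf_sum => j _; apply: bmfD; last exact: bmf_cst.
  exact: (invariant_integral_iter cT m_inv j blw).1.
have IF n : \int[m]_x F n x = n%:R * (\int[m]_x lw x + e).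
  rewrite Rint_sum => [|j _]; last first.
    apply: bmfD; last exact: bmf_cst.
    exact: (invariant_integral_iter cT m_inv j blw).1.
  rewrite (eq_bigr (fun=> \int[m]_x lw x + e)) => [|j _].
    by rewrite sumr_const card_ord mulr_natl.
  have [bj Ej] := invariant_integral_iter cT m_inv j blw.
  by rewrite (RintD m bj (bmf_cst _)) Ej Rint_cst.
apply: (@le_trans _ _ ((limn (fun n => partition_entropy m (itinerary T eta n) / n%:R))%:E + e%:E)%E); last first.
  by rewrite leeD2r//; apply: ereal_sup_ubound; exists p, eta.
rewrite -EFinD lee_fin -lerBlDr -opprD; apply: (entropy_rate_ge cT m_inv) => // n.
rewrite mulrN -IF; apply: entropy_lower => //; exact: (mpart_itinerary cT).
Qed.

End eigenmeasure.

Lemma expR_le_quad (s : R) : s <= 2^-1 -> expR s <= 1 + s + 2 * s ^+ 2.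
Proof.
move=> s1; have h := expR_ge1Dx (- s); rewrite expRN in h.
have e0 := expR_gt0 s; have s10 : 0 < 1 - s by lra.
have h1 : (1 - s) * expR s <= 1 by rewrite -ler_pdivlMr// mul1r.
rewrite -(ler_pM2l s10) (le_trans h1)//.
have -> : (1 - s) * (1 + s + 2 * s ^+ 2) = 1 + s ^+ 2 * (1 - 2 * s) by ring.
by rewrite lerDl mulr_ge0 ?sqr_ge0//; lra.
Qed.

(* The potential [lw + t u - ln (L e^(t u)) o T] is again normalised: compare its
   entropy bound with the equality at [t = 0], for [t] tending to [0] from both sides. *)
Lemma equality_case (m : prob) (lw : X -> R) :
  invariant_measure T m -> continuous lw -> normalised lw ->
  measure_entropy m T = (- \int[m]_x lw x)%:E ->
  forall u : X -> R, continuous u -> \int[m]_x tr T lw u x = \int[m]_x u x.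
Proof.
move=> m_inv clw nlw mE u cu.
have ctr (psi f : X -> R) : continuous psi -> continuous f -> continuous (tr T psi f).
  exact: (tr_continuous a_gt0 lambda_lt1 T_exp X_compact).
have [M0 M0P] := continuous_bounded X_compact cu.
(* [M] is twice a bound for [u], so that an absolute value of [t] at most [M^-1] brings [t * u]
   below 1/2, the range of [expR_le_quad]; the maximum with 1 keeps [M] positive. *)
pose N := Num.max M0 1; pose M := 2 * N.
have N1 : 1 <= N by rewrite le_max lexx orbT.
have M1 : 1 <= M by rewrite /M; lra.
have NP x : `|u x| <= N by rewrite (le_trans (M0P x))// le_max lexx.
have MP x : `|u x| <= M by rewrite (le_trans (NP x))// /M; lra.
have bu := continuous_bmf X_compact cu.
have blw := continuous_bmf X_compact clw.
have cLu := ctr _ _ clw cu; have bLu := continuous_bmf X_compact cLu.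
have key (t : R) : `|t| <= M^-1 ->
    t * \int[m]_x u x <= t * \int[m]_x tr T lw u x + 2 * t ^+ 2 * M ^+ 2.
  move=> tM.
  have ceu : continuous (fun x => expR (t * u x)).
    move=> x; apply: continuous_comp; last exact: continuous_expR.
    by apply: cvgM; [exact: cvg_cst|exact: cu].
  pose G := tr T lw (fun x => expR (t * u x)).
  have cG : continuous G by exact: ctr.
  have G0 x : 0 < G x by apply: tr_gt0 => // y; exact: expR_gt0.
  have clG : continuous (fun x => ln (G x)).
    by move=> x; apply: continuous_comp; [exact: cG|exact: continuous_ln].
  pose lwt x := lw x + t * u x - ln (G (T x)).
  have ctu : continuous (fun x => t * u x).
    by move=> x; apply: cvgM; [exact: cvg_cst|exact: cu].
  have clT : continuous ((fun x => ln (G x)) \o T).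
    by move=> x; apply: continuous_comp; [exact: cT|exact: clG].
  have clwt : continuous lwt.
    move=> x; apply: cvgB; last exact: clT.
    by apply: cvgD; [exact: clw|exact: ctu].
  have nlwt : normalised lwt.
    move=> x; have [c cE] : exists c, c = (G x)^-1 by eexists.
    transitivity (c * G x); last by rewrite cE mulVf// gt_eqF.
    rewrite [in RHS]/G /tr mulr_sumr !big_seq; apply: eq_bigr => y.
    rewrite mem_pre// => /eqP Ty; rewrite mulr1 /lwt Ty !expRD expRN lnK ?posrE//.
    by rewrite -cE mulrC.
  have := measure_entropy_upper m_inv clwt nlwt; rewrite mE lee_fin lerN2 /lwt.
  have btu := continuous_bmf X_compact ctu.
  have blG := continuous_bmf X_compact clG.
  have [blT ET] := invariant_integral cT m_inv blG.
  rewrite (RintB m (bmfD blw btu) blT) (RintD m blw btu) ET (RintZ m _ bu).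
  rewrite -addrA gerDl subr_le0 => /le_trans; apply.
  apply: (@le_trans _ _ (\int[m]_x (t * tr T lw u x + 2 * t ^+ 2 * M ^+ 2))).
    apply: Rint_le => //; first exact: (bmfD (bmfZ _ bLu) (bmf_cst _)).
    move=> x; apply: (@le_trans _ _ (G x - 1)).
      have := @le_ln1Dx _ (G x - 1); rewrite [1 + _]addrC subrK; apply.
      by rewrite ltrBrDl subrr.
    rewrite lerBlDr.
    have -> : t * tr T lw u x + 2 * t ^+ 2 * M ^+ 2 + 1 =
        tr T lw (fun y => (1 + t * u y) + 2 * t ^+ 2 * M ^+ 2 * 1) x.
      by rewrite !trD !trZ nlw; ring.
    apply: tr_le => // y _.
    have tu1 : t * u y <= 2^-1.
      rewrite (le_trans (ler_norm _))// normrM.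
      have -> : 2^-1 = M^-1 * N by rewrite /M; field; rewrite gt_eqF// (lt_le_trans ltr01).
      by rewrite ler_pM.
    apply: (le_trans (expR_le_quad tu1)); rewrite lerD2l mulr1 exprMn -mulrA.
    rewrite ler_wpM2l// ler_wpM2l ?sqr_ge0//.
    by rewrite -[leLHS]ger0_norm ?sqr_ge0// normrX lerXn2r ?nnegrE// (le_trans ler01).
  by rewrite (RintD m (bmfZ _ bLu) (bmf_cst _)) Rint_cst (RintZ m _ bLu).
set A := \int[m]_x u x in key *; set B := \int[m]_x tr T lw u x in key *.
have M0' : 0 < M by exact: lt_le_trans M1.
have lim0 (c d : R) : (forall t, 0 < t -> t <= M^-1 -> t * c <= t * d + 2 * t ^+ 2 * M ^+ 2) -> c <= d.
  move=> H; apply/ler_addgt0Pr => e e0.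
  pose t := Num.min M^-1 (e / (2 * M ^+ 2)).
  have t0 : 0 < t by rewrite lt_min invr_gt0 M0' divr_gt0// mulr_gt0// exprn_gt0.
  have := H t t0; rewrite ge_min lexx => /(_ isT).
  have te : t <= e / (2 * M ^+ 2) by rewrite ge_min lexx orbT.
  rewrite ler_pdivlMr in te; last by rewrite mulr_gt0// exprn_gt0.
  have -> : t * d + 2 * t ^+ 2 * M ^+ 2 = t * (d + t * (2 * M ^+ 2)) by ring.
  rewrite ler_pM2l// => /le_trans; apply.
  by rewrite lerD2l.
apply/eqP; rewrite eq_le; apply/andP; split; apply: lim0 => t t0 tM.
  have := key (- t); rewrite normrN gtr0_norm// => /(_ tM).
  by rewrite sqrrN !mulNr; lra.
by have := key t; rewrite gtr0_norm// => /(_ tM).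
Qed.

End normalised_potential.

(** * Equilibrium states of words *)

Lemma cvg_sumr (R : realType) (T I : Type) (F : set_system T) (FF : Filter F)
    (r : seq I) (f : I -> T -> R) (l : I -> R) :
  (forall i, f i t @[t --> F] --> l i) ->
  \sum_(i <- r) f i t @[t --> F] --> \sum_(i <- r) l i.
Proof.
move=> H; elim: r => [|i r IH].
  rewrite big_nil (_ : (fun=> _) = fun=> 0); first exact: cvg_cst.
  by apply/funext => t; rewrite big_nil.
rewrite big_cons (_ : (fun=> _) = fun t => f i t + \sum_(j <- r) f j t).
  by apply: cvgD; [exact: H|exact: IH].
by apply/funext => t; rewrite big_cons.
Qed.

Section periodic_words.
Context {k : nat}.
Implicit Types (w : seq 'I_k).

Definition wpow w n : seq 'I_k := flatten (nseq n w).

Lemma wpowS w n : wpow w n.+1 = w ++ wpow w n.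
Proof. by []. Qed.

Lemma wpow_add w n l : wpow w (n + l) = wpow w n ++ wpow w l.
Proof. by rewrite /wpow nseqD flatten_cat. Qed.

Lemma wpow1 w : wpow w 1 = w.
Proof. by rewrite /wpow /= cats0. Qed.

Lemma size_wpow w n : size (wpow w n) = (n * size w)%N.
Proof. by elim: n => // n IH; rewrite wpowS size_cat IH. Qed.

Lemma rev_wpow w n : rev (wpow w n) = wpow (rev w) n.
Proof.
elim: n => // n IH; rewrite -addn1 addnC wpowS rev_cat IH.
by rewrite addnC wpow_add wpow1.
Qed.

Lemma periodic_prefix w : w != [::] ->
  exists o : nat -> 'I_k, forall n, prefix_word o (n * size w) = wpow w n.
Proof.
case: w => // i w _; pose v := i :: w.
exists (fun j => nth i v (j %% size v)); elim=> [//|n IH].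
rewrite /prefix_word mulSn mkseq_add wpowS; congr (_ ++ _).
  rewrite -[RHS](mkseq_nth i); apply/eq_in_map => j.
  by rewrite mem_iota add0n /= => jv; rewrite modn_small.
rewrite -IH; apply: eq_mkseq => j.
by rewrite modnDl.
Qed.

(** The left-infinite word is read leftwards from the junction, so [s] is the periodic sequence of
    the reversed word. *)
Lemma periodic_ends w : w != [::] -> exists s o : nat -> 'I_k,
  forall n, suffix_word s (n * size w) = wpow w n /\ prefix_word o (n * size w) = wpow w n.
Proof.
move=> w0; have [om omP] := periodic_prefix w0.
have [|s sP] := @periodic_prefix (rev w).
  by rewrite -size_eq0 size_rev size_eq0.
exists s, om => n; split => //.
by rewrite /suffix_word -(size_rev w) [mkseq _ _]sP rev_wpow revK.
Qed.

End periodic_words.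

(** * Compositions of expanding maps *)

Section composition.
Context {R : realType} {X : pmetricType R}.
Hypothesis X_compact : compact [set: X].

Lemma expanding_comp (T1 T2 : X -> X) (b1 b2 lambda : R) :
  0 < b1 -> 0 < b2 -> 0 < lambda -> lambda < 1 -> continuous T1 ->
  ruelle_expanding b1 lambda T1 -> ruelle_expanding b2 lambda T2 ->
  exists2 b : R, 0 < b & ruelle_expanding b lambda (T2 \o T1).
Proof.
move=> b10 b20 l0 l1 cT1 E1 E2.
have [e e0 eP] := continuous_map_unif X_compact cT1 b20.
(* Two candidates for the preimage are within [2 * b] of each other. This must stay below [b1] for
   [T1], and below [e] so that their images under [T1] are within the radius [b2] of injectivity of
   [T2]. *)
pose b := Num.min (b1 / 2) (Num.min b2 (e / 2)).
have bb1 : b <= b1 / 2 by rewrite ge_min lexx.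
have bb2 : b <= b2 by rewrite !ge_min lexx orbT.
have be : b <= e / 2 by rewrite !ge_min lexx !orbT.
exists b; first by rewrite !lt_min !divr_gt0// b20.
move=> x y x' xy Tx'.
have [y1 [Ty1 xy1]] := expanding_branch E2 (lt_le_trans xy bb2) Tx'.
have l1' t : 0 <= t -> lambda * t <= t :> R by move=> t0; rewrite ler_piMl// ltW.
have xy1b : mdist (T1 x') y1 < b.
  by rewrite (le_lt_trans xy1)// (le_lt_trans (l1' _ (mdist_ge0 _ _))).
have xy1b1 : mdist (T1 x') y1 < b1 by lra.
have [y' [Ty' xy']] := expanding_branch E1 xy1b1 erefl.
have d1 : mdist x' y' <= lambda * mdist x y.
  by rewrite (le_trans xy')// ler_wpM2l ?(ltW l0)// (le_trans xy1)// l1'// mdist_ge0.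
have d1b : mdist x' y' < b by rewrite (le_lt_trans d1)// (le_lt_trans (l1' _ (mdist_ge0 _ _))).
exists y'; split => //; split; first by rewrite /= Ty'.
move=> z [Tz xz]; have yz : mdist y' z < 2 * b.
  rewrite (le_lt_trans (metric_triangle _ x' _))// metric_sym; lra.
apply: (expanding_inj b10 E1); last by lra.
apply: (expanding_inj b20 E2); first by rewrite Ty' Ty1.
by apply: eP; lra.
Qed.

End composition.

Section equilibrium.
Context {R : realType} {X : pmetricType R} {k : nat}.
Variables (g : 'I_k -> X -> X) (phi : X -> R) (a lambda alpha D : R).
Hypothesis X_compact : compact [set: X].
Hypothesis a_gt0 : 0 < a.
Hypothesis a_le1 : a <= 1.
Hypothesis lambda_gt0 : 0 < lambda.
Hypothesis lambda_lt1 : lambda < 1.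
Hypothesis alpha_gt0 : 0 < alpha.
Hypothesis alpha_le1 : alpha <= 1.
Hypothesis g_cont : forall i, continuous (g i).
Hypothesis g_surj : forall i y, exists x, g i x = y.
Hypothesis g_exp : forall i, ruelle_expanding a lambda (g i).
Hypothesis g_mix : jointly_mixing g.
Hypothesis D_ge0 : 0 <= D.
Hypothesis phi_hol : forall x y, `|phi x - phi y| <= D * mdist x y `^ alpha.
Implicit Types (u v w : seq 'I_k) (f h F : X -> R) (x y z : X) (s o : nat -> 'I_k).
Local Notation prob := (probability (borel X) R).

Local Notation Lw := (Lw g phi).
Local Notation Fw := (Fw g phi).
Local Notation Qw := (Qw g phi).

Let g_fin i : finpre (g i).
Proof. exact: (g_finpre X_compact a_gt0 (@g_exp)). Qed.

Let trc i h : continuous h -> continuous (tr (g i) phi h).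
Proof. by move=> ch; apply: (tr_continuous_g X_compact a_gt0 lambda_lt1 alpha_gt0 (@g_exp) D_ge0 phi_hol). Qed.

Lemma word_map_continuous w : continuous (word_map g w).
Proof.
elim: w => [|i w IH] x; first exact: cvg_id.
by apply: continuous_comp; [exact: g_cont|exact: IH].
Qed.

Lemma word_map_expanding w : w != [::] ->
  exists2 b : R, 0 < b & ruelle_expanding b lambda (word_map g w).
Proof.
elim: w => // i [|j w] IH _; first by exists a => //; exact: g_exp.
have [b b0 bE] := IH isT.
exact: (expanding_comp X_compact a_gt0 b0 lambda_gt0 lambda_lt1 (@g_cont i) (@g_exp i) bE).
Qed.

Lemma word_pot_continuous w : continuous (word_pot g phi w).
Proof.
have cphi := phi_continuous alpha_gt0 D_ge0 phi_hol.
have -> : word_pot g phi w = fun x => \sum_(j <- index_iota 0 (size w))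
    phi (word_map g (take j w) x) by [].
move=> x; apply: (@cvg_sumr R X nat (nbhs x) _ _ (fun j y => phi (word_map g (take j w) y))).
by move=> j; apply: continuous_comp; [exact: word_map_continuous|exact: cphi].
Qed.

Lemma Lw_cvg v (f_ : nat -> X -> R) f :
  (forall x, f_ n x @[n --> \oo] --> f x) ->
  forall x, Lw v (f_ n) x @[n --> \oo] --> Lw v f x.
Proof.
elim: v f_ f => [//|i v IH] f_ f cf /=; apply: IH => x.
apply: (@cvg_sumr R nat X \oo _ _ (fun y n => expR (phi y) * f_ n y)) => y.
by apply: cvgM; [exact: cvg_cst|exact: cf].
Qed.

(** The powers [wpow w n] and [wpow w (n + j)] end with the same long word, so the relative bound on
    normalising functions makes their quotients by the value at [point] a uniform Cauchy sequence.
    Applying [Lw w] shifts this sequence by one step up to a scalar, and the limit scalar is the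
    eigenvalue. *)
Lemma eigenfunction w : w != [::] -> exists h (L : R),
  [/\ 0 < L, continuous h, forall x, 0 < h x, forall x, Lw w h x = L * h x &
  forall x, Fw (wpow w n) x / Fw (wpow w n) point @[n --> \oo] --> h x].
Proof.
move=> w0; have [C [b [C0 b01 _ HF _]]] := quotient_decay X_compact a_gt0 a_le1 lambda_gt0
  lambda_lt1 alpha_gt0 alpha_le1 g_surj (@g_exp) g_mix D_ge0 phi_hol.
have /andP[b0 b1] := b01.
have F0 u x : 0 < Fw u x by exact: Fw_gt0.
pose hn n x := Fw (wpow w n) x / Fw (wpow w n) point.
have hn0 n x : 0 < hn n x by rewrite divr_gt0.
pose B := 1 + C.
have B1 : 1 <= B by rewrite lerDl ltW.
(* Bounded distortion is the case of an empty common suffix and an empty second word. *)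
have FB u x y : Fw u x <= B * Fw u y.
  have := HF u [::] [::] x y; rewrite !cats0 /= expr0 mulr1.
  by have F1 z : Fw [::] z = 1 by []; rewrite !F1 !mulr1.
have hB n x : hn n x <= B by rewrite ler_pdivrMr.
have hBi n x : B^-1 <= hn n x.
  by rewrite ler_pdivlMr// mulrC ler_pdivrMr ?(lt_le_trans ltr01)// mulrC.
pose d n := C * b ^+ (n * size w).
have d0 n : 0 <= d n by rewrite mulr_ge0 ?(ltW C0)// exprn_ge0// ltW.
have hstep n j x : hn (n + j)%N x <= (1 + d n) * hn n x /\ hn n x <= (1 + d n) * hn (n + j)%N x.
  have E : wpow w (n + j) = wpow w j ++ wpow w n by rewrite addnC wpow_add.
  rewrite /hn E; split.
    rewrite ler_pdivrMr// mulrAC mulrA ler_pdivlMr// -mulrA.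
    have := HF (wpow w j) [::] (wpow w n) x point; rewrite size_wpow cat0s => h.
    by rewrite (le_trans h)// [X in _ * X]mulrC.
  rewrite ler_pdivrMr// mulrAC mulrA ler_pdivlMr// -mulrA.
  have := HF [::] (wpow w j) (wpow w n) x point; rewrite size_wpow cat0s => h.
  by rewrite (le_trans h)// [X in _ * X]mulrC.
have hdist n j x : `|hn n x - hn (n + j)%N x| <= B * d n.
  have [h1 h2] := hstep n j x; have b2 := hB n x; have b3 := hB (n + j)%N x.
  have e1 : d n * hn n x <= B * d n by rewrite mulrC ler_wpM2r.
  have e2 : d n * hn (n + j)%N x <= B * d n by rewrite mulrC ler_wpM2r.
  have h1' : hn (n + j)%N x <= hn n x + B * d n.
    by rewrite (le_trans h1)// mulrDl mul1r lerD2l.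
  have h2' : hn n x <= hn (n + j)%N x + B * d n.
    by rewrite (le_trans h2)// mulrDl mul1r lerD2l.
  by rewrite ler_norml; apply/andP; split; [rewrite lerBrDl lerBlDr|rewrite lerBlDl].
have dcvg : d n @[n --> \oo] --> (0 : R).
  have -> : d = fun n => C * (b ^+ size w) ^+ n.
    by apply/funext => n; rewrite /d mulnC exprM.
  rewrite -(mulr0 C); apply: cvgM; first exact: cvg_cst.
  apply: cvg_expr; rewrite ger0_norm ?exprn_ge0// ?ltW//.
  by rewrite exprn_ilt1// ?(ltW b0)//; case: (w) w0.
have dsmall (e : R) : 0 < e -> exists n0, forall n, (n0 <= n)%N -> B * d n <= e.
  move=> e0; have Bd : B * d n @[n --> \oo] --> (0 : R).
    by rewrite -(mulr0 B); apply: cvgM => //; exact: cvg_cst.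
  move/cvgrPdist_le : Bd => /(_ e e0)[n0 _ n0P]; exists n0 => n /n0P /=.
  by rewrite sub0r normrN; apply: le_trans; exact: ler_norm.
have hcvg x : cvgn (hn^~ x).
  apply/cauchy_cvgP/cauchy_exP => e e0.
  have e20 : 0 < e / 2 by rewrite divr_gt0.
  have [n0 n0P] := dsmall _ e20; exists (hn n0 x), n0 => // m /= nm.
  rewrite /ball/= (@le_lt_trans _ _ (e / 2))//; last first.
    by rewrite ltr_pdivrMr// ltr_pMr// ltr1n.
  by rewrite -(subnKC nm) (le_trans (hdist _ _ _))// n0P.
pose h x := limn (hn^~ x).
have hC x : hn n x @[n --> \oo] --> h x by exact: hcvg.
have hlim n x : `|hn n x - h x| <= B * d n.
  have c1 : (fun j => `|hn n x - hn j x|) @ \oo --> `|hn n x - h x|.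
    by apply: cvg_norm; apply: cvgB; [exact: cvg_cst|exact: hC].
  apply: (cvgr_to_le c1); exists n => // j /= nj.
  by rewrite -(subnKC nj).
have h0 x : 0 < h x.
  apply: (@lt_le_trans _ _ B^-1); first by rewrite invr_gt0 (lt_le_trans ltr01).
  by apply: (cvgr_to_ge (hC x)); apply: nearW => n; exact: hBi.
have chn n : continuous (hn n).
  move=> x; apply: cvgM; last exact: cvg_cst.
  by apply: Lw_continuous => // y; exact: cvg_cst.
have ch : continuous h.
  apply/continuous_distP => x e e0; have e30 : 0 < e / 3 by rewrite divr_gt0.
  have [n0 /(_ n0 (leqnn _)) n0P] := dsmall _ e30.
  have /continuous_distP/(_ x _ e30)[r r0 rP] := chn n0.
  exists r => // y /rP xy; move: xy (hlim n0 x) (hlim n0 y).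
  rewrite ltr_norml !ler_norml ltr_norml => /andP[? ?] /andP[? ?] /andP[? ?].
  by apply/andP; split; lra.
have Lhn n x : Lw w (hn n) x = Lw w (hn n) point * hn n.+1 x.
  have E y : Lw w (hn n) y = Fw (wpow w n.+1) y / Fw (wpow w n) point.
    rewrite -addn1 wpow_add wpow1 Fw_cat mulrC -LwZ//.
    by congr (Lw w _ y); apply/funext => z; rewrite /hn mulrC.
  by rewrite !E /hn; field; rewrite !gt_eqF.
exists h, (Lw w h point); split => //.
  by apply: Lw_gt0.
move=> x; have c1 := @Lw_cvg w hn h hC x.
have c2 : Lw w (hn n) point * hn n.+1 x @[n --> \oo] --> Lw w h point * h x.
  apply: cvgM; first exact: Lw_cvg.
  by rewrite (@cvg_shiftS _ (hn^~ x)).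
apply: (cvg_unique _ c1) => //.
rewrite (_ : (fun n => Lw w (hn n) x) = fun n => Lw w (hn n) point * hn n.+1 x)//.
by apply/funext => n; exact: Lhn.
Qed.

Lemma equilibrium_mu_so w s o : w != [::] ->
  (forall n, suffix_word s (n * size w) = wpow w n /\
    prefix_word o (n * size w) = wpow w n) ->
  forall f, continuous f ->
  \int[equilibrium_state (word_pair g phi w)]_x f x = \int[mu_so g phi s o]_x f x.
Proof.
move=> w0 soP; have [h [L [L0 ch h0 Lh hcvg]]] := eigenfunction w0.
have [b b0 T_exp] := word_map_expanding w0.
set T := word_map g w in T_exp *.
have cT : continuous T by exact: word_map_continuous.
have T_surj y : exists x, T x = y by exact: word_surj.
pose pot := word_pot g phi w.
have cpot : continuous pot by exact: word_pot_continuous.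
have clh : continuous (fun x => ln (h x)).
  by move=> x; apply: continuous_comp; [exact: ch|exact: continuous_ln].
have clhT : continuous ((fun x => ln (h x)) \o T).
  by move=> x; apply: continuous_comp; [exact: cT|exact: clh].
(* The potential changed by the coboundary of [ln h] and the constant [ln L]: its operator [N] is
   that of [w] conjugated by [h] and divided by [L], hence fixes 1, and its integral for an
   invariant measure is that of [pot] minus [ln L]. *)
pose lw x := pot x + ln (h x) - ln (h (T x)) - ln L.
have clw : continuous lw.
  move=> x; apply: cvgB; last exact: cvg_cst.
  by apply: cvgB; [apply: cvgD; [exact: cpot|exact: clh]|exact: clhT].
pose N f := tr T lw f.
have NE f x : N f x = Lw w (fun y => h y * f y) x / (L * h x).
  rewrite Lw_tr// /N /tr mulr_suml !big_seq; apply: eq_bigr => y.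
  rewrite mem_pre; last exact: word_finpre.
  move=> /eqP Ty; rewrite /lw Ty !expRD !expRN !lnK ?posrE// invfM -/pot.
  by ring.
have nlw : normalised T lw.
  move=> x; rewrite -/(N _ _) NE.
  have -> : (fun y => h y * 1) = h by apply/funext => y; rewrite mulr1.
  by rewrite Lh divff// gt_eqF// mulr_gt0.
have NN l f x : iter l N f x = Lw (wpow w l) (fun y => h y * f y) x / (L ^+ l * h x).
  elim: l x => [|l IH] x /=.
    by rewrite expr0 mul1r mulrAC divff ?mul1r// gt_eqF.
  rewrite NE -addn1 wpow_add wpow1 addn1 Lw_cat.
  have -> : (fun y => h y * iter l N f y) =
      (fun y => (L ^+ l)^-1 * Lw (wpow w l) (fun y => h y * f y) y).
    apply/funext => y; rewrite IH; field.
    by rewrite !gt_eqF// exprn_gt0.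
  by rewrite LwZ// exprS; field; rewrite !gt_eqF// exprn_gt0.
have Lhl l x : Lw (wpow w l) h x = L ^+ l * h x.
  have := NN l (fun=> 1) x.
  have -> : (fun y => h y * 1) = h by apply/funext => y; rewrite mulr1.
  have -> : iter l N (fun=> 1) x = 1.
    elim: l x => [//|l IH] x /=; rewrite -[RHS](nlw x); congr (tr T lw _ x).
    by apply/funext.
  by move/esym/divr1_eq.
have F0 u x : 0 < Fw u x by exact: Fw_gt0.
(* As [h] is the limit of the normalised [Fw (wpow w n)], the iterates of [N] are limits of the
   operators that define [mu]. They thus converge uniformly to the integral for [mu], which makes
   [mu] a fixed measure whose integrals are those of any other. *)
have Qcvg l f x : Qw (wpow w n) (wpow w l) f x @[n --> \oo] --> iter l N f x.
  rewrite NN -Lhl.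
  have -> : (fun n => Qw (wpow w n) (wpow w l) f x) = (fun n =>
      Lw (wpow w l) (fun y => Fw (wpow w n) y / Fw (wpow w n) point * f y) x /
      Lw (wpow w l) (fun y => Fw (wpow w n) y / Fw (wpow w n) point) x).
    apply/funext => n; have -> : Qw (wpow w n) (wpow w l) f x =
      Lw (wpow w l) (fun y => f y * Fw (wpow w n) y) x / Fw (wpow w n ++ wpow w l) x by [].
    rewrite Fw_cat.
    set c := Fw (wpow w n) point.
    have -> : (fun y => Fw (wpow w n) y / c) = (fun y => c^-1 * Fw (wpow w n) y).
      by apply/funext => y; rewrite mulrC.
    have -> : (fun y => Fw (wpow w n) y / c * f y) =
        (fun y => c^-1 * (f y * Fw (wpow w n) y)).
      by apply/funext => y; ring.
    rewrite !LwZ//; have c0 : c != 0 by apply: lt0r_neq0; exact: F0.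
    have d0 : Lw (wpow w l) (Fw (wpow w n)) x != 0.
      by apply: lt0r_neq0; apply: Lw_gt0.
    by field; rewrite c0 d0.
  apply: cvgM; first by apply: Lw_cvg => y; apply: cvgM; [exact: hcvg|exact: cvg_cst].
  apply: cvgV; last by apply: Lw_cvg.
  by rewrite gt_eqF//; apply: Lw_gt0.
set mu := mu_so g phi s o.
have [muS _] := mu_so_spec X_compact a_gt0 a_le1 lambda_gt0
  lambda_lt1 alpha_gt0 alpha_le1 g_surj (@g_exp) g_mix D_ge0 phi_hol s o.
have w1 : (0 < size w)%N by case: (w) w0.
have Nlim f (e : R) : continuous f -> 0 < e -> exists n0, forall l x, (n0 <= l)%N ->
    `|iter l N f x - \int[mu]_x f x| <= e.
  move=> cf e0; have [n0 n0P] := muS f e cf e0; exists n0 => l x nl.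
  have c1 : (fun n => `|Qw (wpow w n) (wpow w l) f x - \int[mu]_x f x|) @ \oo -->
      `|iter l N f x - \int[mu]_x f x|.
    by apply: cvg_norm; apply: cvgB; [exact: Qcvg|exact: cvg_cst].
  apply: (cvgr_to_le c1); exists n0 => // n /= nn.
  apply: (n0P n0) => //.
    by rewrite -(soP n).1; apply: left_end_suffix; rewrite (leq_trans nn)// leq_pmulr.
  by rewrite -(soP l).2; apply: right_end_prefix; rewrite (leq_trans nl)// leq_pmulr.
have cN f : continuous f -> continuous (N f).
  exact: (tr_continuous b0 lambda_lt1 T_exp X_compact).
have cNl l f : continuous f -> continuous (iter l N f).
  by move=> cf; elim: l => [//|l IH]; exact: cN.
have bcont f : continuous f -> bmf (f : borel X -> R) by exact: continuous_bmf.
have mu_fix f : continuous f -> \int[mu]_x N f x = \int[mu]_x f x.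
  move=> cf; apply/eqP; rewrite -subr_eq0 -normr_eq0 eq_le normr_ge0 andbT.
  apply/ler_addgt0Pr => e e0; rewrite add0r; have e20 : 0 < e / 2 by rewrite divr_gt0.
  have [n1 n1P] := Nlim _ _ (cN f cf) e20; have [n2 n2P] := Nlim _ _ cf e20.
  have h1 := n1P (maxn n1 n2) point (leq_maxl _ _).
  have h2 := n2P (maxn n1 n2).+1 point (leqW (leq_maxr _ _)).
  rewrite iterSr in h2; rewrite [e]splitr distrC.
  rewrite (le_trans (ler_distD (iter (maxn n1 n2) N (N f) point) _ _))//.
  by apply: lerD => //; rewrite distrC.
have m_unique (m : prob) : (forall f, continuous f -> \int[m]_x N f x = \int[m]_x f x) ->
    forall f, continuous f -> \int[m]_x f x = \int[mu]_x f x.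
  move=> mN f cf; apply/eqP; rewrite -subr_eq0 -normr_eq0 eq_le normr_ge0 andbT.
  apply/ler_addgt0Pr => e e0; rewrite add0r.
  have [n1 n1P] := Nlim _ _ cf e0.
  have E l : \int[m]_x iter l N f x = \int[m]_x f x.
    by elim: l => [//|l IH]; rewrite mN//; exact: cNl.
  rewrite -(E n1) -[\int[mu]_x f x in leLHS](Rint_cst m).
  apply: Rint_dist; [by apply: bcont; exact: cNl|exact: bmf_cst|].
  by move=> x; exact: n1P.
have inv_lw (m : prob) : invariant_measure T m ->
    \int[m]_x lw x = \int[m]_x pot x - ln L.
  move=> m_inv; have [bT ET] := invariant_integral cT m_inv (bcont _ clh).
  rewrite (RintB m (bmfB (bmfD (bcont _ cpot) (bcont _ clh)) bT) (bmf_cst _)).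
  rewrite (RintB m (bmfD (bcont _ cpot) (bcont _ clh)) bT).
  by rewrite (RintD m (bcont _ cpot) (bcont _ clh)) ET Rint_cst addrK.
have mu_inv : invariant_measure T mu by apply: (fixed_invariant X_compact b0 cT T_exp nlw mu_fix).
have mu_ent : measure_entropy mu T = (- \int[mu]_x lw x)%:E.
  apply/eqP; rewrite eq_le (measure_entropy_upper X_compact b0 lambda_gt0 lambda_lt1 cT T_exp)//.
  by rewrite (measure_entropy_lower X_compact b0 lambda_lt1 cT T_exp).
have fe_mu : free_energy T pot mu = (ln L)%:E.
  by rewrite /free_energy mu_ent inv_lw// -EFinD opprB subrK.
have fe_le (m : prob) : invariant_measure T m -> (free_energy T pot m <= (ln L)%:E)%E.
  move=> m_inv.
  have ub := measure_entropy_upper X_compact b0 lambda_gt0 lambda_lt1 cT T_exp m_inv clw nlw.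
  apply: (@le_trans _ _ ((- \int[m]_x lw x)%:E + (\int[m]_x pot x)%:E)%E).
    by rewrite /free_energy leeD2r.
  by rewrite -EFinD lee_fin inv_lw// opprB subrK.
have prE : pressure T pot = (ln L)%:E.
  apply/eqP; rewrite eq_le; apply/andP; split.
    by apply: ge_ereal_sup => _ [m m_inv <-]; exact: fe_le.
  by rewrite -fe_mu; apply: ereal_sup_ubound; exists mu.
have mu_eq : is_equilibrium_state T pot mu by split => //; rewrite fe_mu prE.
(* The state picked by [get] need not be [mu]. The predicate is satisfied, since [mu] satisfies it;
   the picked state attains the pressure, so its entropy is minus the integral of [lw], and
   [equality_case] makes it a fixed measure of [N]. *)
apply: m_unique.
rewrite /equilibrium_state; case: xgetP => [m _ [m_inv /= m_fe]|/(_ mu)]; last by [].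
apply: (equality_case X_compact b0 lambda_gt0 lambda_lt1 cT T_surj T_exp m_inv clw nlw).
move: m_fe; rewrite -/T -/pot prE /free_energy inv_lw// => E.
rewrite opprB EFinB -E; apply/esym.
by rewrite addeK.
Qed.

End equilibrium.

(** * Words, and the expansion constants of their maps *)

Section word_metric.
Context {R : realType} {k : nat}.
Implicit Types v w : seq 'I_k.
(* Otherwise shadowed by the library's [first_diff] on product spaces. *)
Local Notation first_diff := Defs.first_diff.

Definition common j v w :=
  [/\ (j <= size v)%N, (j <= size w)%N & take j v = take j w].

Lemma onth_take (T : Type) (s : seq T) i j : (i < j)%N ->
  onth (take j s) i = onth s i.
Proof. by move=> ij; rewrite !onthE map_take nth_take. Qed.

(** Reads [first_diff] as one plus the length of the longest common prefix; metric properties of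
    words then reduce to properties of common prefixes. *)
Lemma ltn_first_diff j v w : (j < first_diff v w)%N <-> common j v w.
Proof.
rewrite /first_diff; set m := minn _ _.
set p := fun i => _ || _.
have has_p : has p (iota 0 m.+1).
  by apply/hasP; exists m; rewrite ?mem_iota ?add0n ?ltnS//= /p leqnn orbT.
have fm : (find p (iota 0 m.+1) < m.+1)%N by rewrite -[X in (_ < X)%N](size_iota 0) -has_find.
have pf : p (find p (iota 0 m.+1)).
  by have := nth_find 0%N has_p; rewrite nth_iota.
have before i : (i < find p (iota 0 m.+1))%N -> onth v i = onth w i /\ (i < m)%N.
  move=> ilt; have := before_find 0%N ilt; rewrite nth_iota ?add0n; last exact: ltn_trans fm.
  by rewrite /p => /negbT; rewrite negb_or negbK -ltnNge => /andP[/eqP].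
rewrite ltnS; move: fm pf before; set c := find _ _ => fm pf before.
have mv : (m <= size v)%N by rewrite geq_minl.
have mw : (m <= size w)%N by rewrite geq_minr.
split=> [jc|[jv jw E]].
  have jm : (j <= m)%N by rewrite (leq_trans jc).
  have jv : (j <= size v)%N by exact: leq_trans mv.
  have jw : (j <= size w)%N by exact: leq_trans mw.
  split=> //; apply: eq_from_onth => i.
  have [ij|ij] := ltnP i j; last by rewrite !onth_default// size_takel.
  by rewrite !onth_take//; case: (before i (leq_trans ij jc)).
rewrite leqNgt; apply/negP => cj.
have jm : (j <= m)%N by rewrite leq_min jv.
move: pf; rewrite /p => /orP[/eqP ne|mc]; last by move: (leq_trans cj jm); rewrite ltnNge mc.
by apply: ne; rewrite -(onth_take v cj) -(onth_take w cj) E.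
Qed.

Lemma first_diff_gt0 v w : (0 < first_diff v w)%N.
Proof. by []. Qed.

Lemma commonC j v w : common j v w -> common j w v.
Proof. by case. Qed.

Lemma common_trans j u v w : common j u v -> common j v w -> common j u w.
Proof. by case=> ju jv uv [_ jw vw]; split => //; rewrite uv. Qed.

Lemma first_diffC v w : first_diff v w = first_diff w v.
Proof.
have H v' w' : (first_diff v' w' <= first_diff w' v')%N.
  rewrite -(prednK (first_diff_gt0 v' w')); apply/ltn_first_diff/commonC/ltn_first_diff.
  by rewrite prednK// first_diff_gt0.
by apply/eqP; rewrite eqn_leq !H.
Qed.

Lemma first_diff_ultra u v w :
  (minn (first_diff u v) (first_diff v w) <= first_diff u w)%N.
Proof.
set c := minn _ _; have c0 : (0 < c)%N by rewrite leq_min !first_diff_gt0.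
rewrite -(prednK c0); apply/ltn_first_diff.
by apply: (@common_trans _ _ v); apply/ltn_first_diff; rewrite prednK// geq_min leqnn ?orbT.
Qed.

Lemma half_ultra u v w : (2^-1 : R) ^+ first_diff u w <=
  2^-1 ^+ first_diff u v + 2^-1 ^+ first_diff v w.
Proof.
have h n : 0 <= (2^-1 : R) ^+ n by rewrite exprn_ge0// invr_ge0.
apply: (@le_trans _ _ (2^-1 ^+ minn (first_diff u v) (first_diff v w))).
  rewrite ler_wiXn2l ?invr_ge0//; first by rewrite invf_le1// ler1n.
  exact: first_diff_ultra.
by case: leqP => _; rewrite ?lerDl ?lerDr.
Qed.

Local Notation dW := (@word_dist k R).

Lemma word_dist_ge v w n : v != w -> (first_diff v w <= n.+1)%N ->
  2^-1 ^+ n.+1 <= dW v w.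
Proof.
move=> vw fn; rewrite /word_dist (negPf vw).
apply: (@le_trans _ _ (2^-1 ^+ first_diff v w)).
  by rewrite ler_wiXn2l ?invr_ge0//; rewrite invf_le1// ler1n.
by rewrite lerDl exprn_ge0// invr_ge0.
Qed.

Lemma word_dist_metric : is_metric_on setT dW.
Proof.
have h n : 0 < (2^-1 : R) ^+ n by rewrite exprn_gt0// invr_gt0.
have d0 v w : 0 <= dW v w.
  by rewrite /word_dist; case: eqP => // _; rewrite addr_ge0// ltW.
split=> [v w _ _|v w _ _|v w _ _|u v w _ _ _].
- exact: d0.
- rewrite /word_dist; case: eqP => [//|ne]; split=> // e.
  by have := addr_gt0 (h (first_diff v w)) (h (first_diff (rev v) (rev w))); rewrite e ltxx.
- by rewrite /word_dist eq_sym; case: eqP => // _; congr (_ ^+ _ + _ ^+ _); exact: first_diffC.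
- have [->|uw] := eqVneq u w; first by rewrite {1}/word_dist eqxx addr_ge0.
  have [->|uv] := eqVneq u v; first by rewrite {2}/word_dist eqxx add0r.
  have [->|vw] := eqVneq v w; first by rewrite {3}/word_dist eqxx addr0.
  rewrite /word_dist (negPf uw) (negPf uv) (negPf vw) addrACA.
  by apply: lerD; exact: half_ultra.
Qed.

Lemma word_dist_discrete : is_discrete_on setT dW.
Proof.
(* A word other than [v] departs from it at position [(size v).+1] at the latest. *)
move=> v _; exists (2^-1 ^+ (size v).+1); first by rewrite exprn_gt0// invr_gt0.
move=> w _ dvw; apply/eqP; rewrite eq_sym; apply/negPn/negP => vw.
move: dvw; rewrite ltNge; apply/negP/negPn; apply: word_dist_ge => //.
rewrite leqNgt; apply/negP => /ltn_first_diff[+ _ _].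
by rewrite ltnn.
Qed.

Lemma common_ends v w : v != w -> exists n,
  [/\ common n v w, common n (rev v) (rev w) & 2^-1 ^+ n.+1 <= dW v w].
Proof.
move=> vw; have rvw : rev v != rev w by rewrite (inj_eq (can_inj revK)).
pose c := minn (first_diff v w) (first_diff (rev v) (rev w)).
have c0 : (0 < c)%N by rewrite leq_min !first_diff_gt0.
exists c.-1; split.
- by apply/ltn_first_diff; rewrite prednK// geq_minl.
- by apply/ltn_first_diff; rewrite prednK// geq_minr.
rewrite prednK// /word_dist (negPf vw) /c.
by case: leqP => _; rewrite ?lerDl ?lerDr exprn_ge0// invr_ge0.
Qed.

End word_metric.

(** A finite word is [good] if infinitely many of the sequences begin with it. By the pigeonhole
    principle over the finite alphabet a good word extends by one letter to a good word, and [tau]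
    is the limit of these extensions. *)
Lemma konig (F : finType) (t : nat -> nat -> F) : exists tau : nat -> F,
  forall l N, exists2 n, (N <= n)%N & forall j, (j < l)%N -> t n j = tau j.
Proof.
pose good p := forall N, exists2 n, (N <= n)%N & mkseq (t n) (size p) = p.
have /choice[f fP] : forall p, exists c, good p -> good (rcons p c).
  move=> p; have [gp|ngp] := pselect (good p); last by exists (t 0%N 0%N).
  apply: contrapT => /forallNP H.
  have /choice[M MP] : forall c, exists N, forall n, (N <= n)%N ->
      mkseq (t n) (size p).+1 <> rcons p c.
    move=> c; have /not_implyP[_ /existsNP[N NP]] := H c.
    exists N => n Nn E; apply: NP; exists n => //.
    by rewrite size_rcons.
  have [n nM E] := gp (\max_c M c).
  apply: (MP (t n (size p)) n); first exact: leq_trans (leq_bigmax _) nM.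
  by rewrite mkseqS E.
pose pref := fix pref n := if n is n'.+1 then rcons (pref n') (f (pref n')) else [::].
have good_pref n : good (pref n).
  elim: n => [N|n IH]; first by exists N.
  exact: fP.
have prefE n : pref n = mkseq (fun j => f (pref j)) n.
  by elim: n => // n IH; rewrite mkseqS /= -IH.
exists (fun j => f (pref j)) => l N; have [n Nn E] := good_pref l N.
exists n => // j jl; move: E; rewrite {2}prefE {1}prefE size_mkseq => E.
have := congr1 (fun s => nth (t n j) s j) E.
by rewrite !nth_mkseq.
Qed.

(** * Lower bound for the expansion constant of a word map *)

Section kappa_words.
Context {R : realType} {X : pmetricType R} {k : nat}.
Variables (g : 'I_k -> X -> X) (a lambda : R).
Hypothesis X_compact : compact [set: X].
Hypothesis a_gt0 : 0 < a.
Hypothesis lambda_gt0 : 0 < lambda.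
Hypothesis lambda_lt1 : lambda < 1.
Hypothesis g_cont : forall i, continuous (g i).
Hypothesis g_exp : forall i, ruelle_expanding a lambda (g i).
Implicit Types (w : seq 'I_k).

(** The radius [e] shrinks with the word, which is harmless: [kappa] depends only on pairs at
    arbitrarily small distance, and the rate is the full [lambda ^+ size w]. *)
Lemma word_contract w : exists2 e : R, 0 < e & forall x y, mdist x y < e ->
  mdist x y <= lambda ^+ size w * mdist (word_map g w x) (word_map g w y).
Proof.
elim: w => [|i w [e e0 eP]]; first by exists 1 => // x y _; rewrite mul1r.
have [e1 e10 e1P] := continuous_map_unif X_compact (@g_cont i) e0.
have [e2 e20 e2P] := continuous_map_unif X_compact (@g_cont i) a_gt0.
exists (Num.min a (Num.min e1 e2)); first by rewrite !lt_min a_gt0 e10.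
move=> x y; rewrite !lt_min => /and3P[xa x1 x2].
apply: (le_trans (expanding_contract (@g_exp i) xa (e2P _ _ x2))).
by rewrite /= exprS -mulrA ler_wpM2l ?(ltW lambda_gt0)//; exact/eP/e1P.
Qed.

Lemma kappa_word_ge w : ((lambda ^- size w)%:E <= kappa (word_map g w))%E.
Proof.
have [e e0 eP] := word_contract w; rewrite /kappa.
set T := word_map g w in eP *.
set S := fun e : R => [set (mdist (T z.1) (T z.2) / mdist z.1 z.2)%:E
  | z in [set z : X * X | 0 < mdist z.1 z.2 < e]].
have decr (r s : R) : r <= s -> (ereal_inf (S s) <= ereal_inf (S r))%E.
  move=> rs; apply: le_ereal_inf => _ [z /= /andP[z0 zr] <-].
  by exists z => //=; rewrite z0 (lt_le_trans zr).
apply: lime_ge.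
  by apply: nonincreasing_at_right_is_cvge; near=> e1 => r s _ _; exact: decr.
near=> r.
apply: le_ereal_inf_tmp => _ [z /= /andP[z0 zr] <-].
rewrite lee_fin ler_pdivlMr// mulrC ler_pdivrMr ?exprn_gt0// mulrC.
apply: eP; rewrite (lt_trans zr)//.
Unshelve. all: by end_near. Qed.

End kappa_words.

(** * The semigroup metric *)

Lemma cvg_seqP (R : realType) (u : nat -> R) (l : R) : u n @[n --> \oo] --> l <->
  forall e : R, 0 < e -> exists N, forall n, (N <= n)%N -> `|u n - l| < e.
Proof.
split=> [/cvgrPdist_lt H e e0|H].
  by have [N _ NP] := H e e0; exists N => n nN; rewrite distrC; exact: (NP n nN).
apply/cvgrPdist_lt => e e0; have [N NP] := H e e0.
by exists N => // n nN; rewrite distrC; exact: NP.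
Qed.

Lemma cvg0_le (R : realType) (u v : nat -> R) : (forall n, 0 <= u n <= v n) ->
  v n @[n --> \oo] --> (0 : R) -> u n @[n --> \oo] --> (0 : R).
Proof.
move=> uv /cvg_seqP v0; apply/cvg_seqP => e e0; have [N NP] := v0 e e0.
exists N => n /NP; rewrite !subr0; have /andP[u0 un] := uv n.
rewrite (ger0_norm u0); apply: le_lt_trans; exact: (le_trans un (ler_norm _)).
Qed.

Section weak_completeness.
Context {R : realType} {X : pmetricType R}.
Hypothesis X_compact : compact [set: X].
Local Notation prob := (probability (borel X) R).

(** The notion of equality available for picked measures: it is detected by [W] and respected by
    weak limits, whereas equality in the type [prob] also involves the values on non-measurable
    sets. *)
Definition same_integrals (m m' : prob) :=
  forall f : X -> R, continuous f -> \int[m]_x f x = \int[m']_x f x.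

Lemma weak_cvg_same (m_ : nat -> prob) m m' : weak_cvg m_ m -> weak_cvg m_ m' ->
  same_integrals m m'.
Proof.
move=> h h' f cf; apply: (@cvg_unique _ (@norm_hausdorff _ _)
  ((fun n => \int[m_ n]_x f x) @ \oo)); [exact: h|exact: h'].
Qed.

Lemma weak_cvg_ext (m_ m'_ : nat -> prob) m m' : weak_cvg m_ m ->
  (forall n, same_integrals (m_ n) (m'_ n)) -> same_integrals m m' -> weak_cvg m'_ m'.
Proof.
move=> h E E' f cf; rewrite -E'//.
rewrite (_ : (fun n => _) = fun n => \int[m_ n]_x f x); first exact: h.
by apply/funext => n; rewrite E.
Qed.

Lemma weak_limit (m_ : nat -> prob) :
  (forall f : X -> R, continuous f -> cvgn (fun n => \int[m_ n]_x f x)) ->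
  exists m, weak_cvg m_ m.
Proof.
move=> H; pose L (f : X -> R) := limn (fun n => \int[m_ n]_x f x).
have b f : continuous f -> bmf (f : borel X -> R) by exact: continuous_bmf.
have LD f h : continuous f -> continuous h -> L (fun x => f x + h x) = L f + L h.
  move=> cf ch; apply/cvg_lim => //.
  rewrite (_ : (fun n => _) = fun n => \int[m_ n]_x f x + \int[m_ n]_x h x).
    by apply: cvgD; exact: H.
  by apply/funext => n; rewrite (RintD (m_ n) (b _ cf) (b _ ch)).
have LZ (c : R) f : continuous f -> L (fun x => c * f x) = c * L f.
  move=> cf; apply/cvg_lim => //.
  rewrite (_ : (fun n => _) = fun n => c * \int[m_ n]_x f x).
    by apply: cvgM; [exact: cvg_cst|exact: H].
  by apply/funext => n; rewrite (RintZ (m_ n) c (b _ cf)).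
have L0 (f : X -> R) : continuous f -> (forall x, 0 <= f x) -> 0 <= L f.
  move=> cf f0; apply: (cvgr_to_ge (H f cf)); apply: nearW => n.
  exact: Rint_ge0.
have L1 : L (fun=> 1) = 1.
  apply/cvg_lim => //; rewrite (_ : (fun n => _) = fun=> 1); first exact: cvg_cst.
  by apply/funext => n; rewrite Rint_cst.
have [m mP] := riesz_representation X_compact LD LZ L0 L1.
by exists m => f cf; rewrite mP//; exact: H.
Qed.

End weak_completeness.

Section semigroup.
Context {R : realType} {X : pmetricType R} {k : nat}.
Variables (g : 'I_k -> X -> X) (phi : X -> R) (a lambda alpha : R).
Hypothesis X_compact : compact [set: X].
Hypothesis a_gt0 : 0 < a.
Hypothesis lambda_gt0 : 0 < lambda.
Hypothesis lambda_lt1 : lambda < 1.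
Hypothesis alpha_gt0 : 0 < alpha.
Hypothesis alpha_le1 : alpha <= 1.
Hypothesis g_continuous : forall i, continuous (g i).
Hypothesis g_surjective : forall i y, exists x, g i x = y.
Hypothesis g_expanding : forall i, ruelle_expanding a lambda (g i).
Hypothesis g_mixing : jointly_mixing g.
Hypothesis phi_holder : holder alpha phi.
Hypothesis kappa_finite : forall p, generated g phi p -> (kappa p.1 < +oo)%E.
Local Notation prob := (probability (borel X) R).
Local Notation pair := ((X -> X) * (X -> R))%type.
Implicit Types (w : seq 'I_k) (p q r : pair) (u v : nat -> pair) (s o : nat -> 'I_k)
  (m : prob).

Local Notation G := (generated g phi).
Local Notation dG := (pair_dist a lambda alpha phi).
Local Notation W := (Wbar a lambda alpha phi).
Local Notation mu := (@equilibrium_state R X).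
Local Notation wp := (word_pair g phi).
Local Notation mso := (mu_so g phi).

Lemma word_pair_cat (v w : seq 'I_k) : wp (v ++ w) = pair_prod (wp w) (wp v).
Proof.
rewrite /word_pair /pair_prod /=; congr (_, _); apply/funext => x /=.
  by rewrite word_map_cat.
by rewrite word_pot_cat.
Qed.

Lemma word_pair1 i : wp [:: i] = (g i, phi).
Proof.
rewrite /word_pair; congr (_, _); apply/funext => x //.
by rewrite word_pot_cons word_pot_nil addr0.
Qed.

Lemma generatedP p : G p <-> exists2 w, w != [::] & p = wp w.
Proof.
split=> [|[w w0 ->]].
  elim=> [i|p' q' _ [v v0 ->] _ [w w0 ->]].
    by exists [:: i] => //; rewrite word_pair1.
  by exists (w ++ v); rewrite ?word_pair_cat//; case: (w) w0.
elim: w w0 => // i [|j w] IH _; first by rewrite word_pair1; exact: generated_gen.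
rewrite -cat1s word_pair_cat; apply: generated_prod; first exact: IH.
by rewrite word_pair1; exact: generated_gen.
Qed.

(** This is positive on the semigroup because [kappa] is finite there. At an infinite [kappa] it
    would be 0, as [fine] and the inverse both return 0, and the lower bound [dG_ge], which
    separates distinct elements, would be lost. *)
Definition kinv p : R := (fine (kappa p.1))^-1.

Lemma kappa_word w : w != [::] ->
  [/\ kappa (wp w).1 = ((kinv (wp w))^-1)%:E, 0 < kinv (wp w) & kinv (wp w) <= lambda ^+ size w].
Proof.
move=> w0; have kf : (kappa (wp w).1 < +oo)%E by apply/kappa_finite/generatedP; exists w.
have := kappa_word_ge X_compact a_gt0 lambda_gt0 g_continuous (@g_expanding) w.
move: kf; rewrite /kinv /word_pair /=; case: (kappa _) => [r _|//|//] /=.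
rewrite lee_fin => rl; have ll0 : 0 < lambda ^+ size w by rewrite exprn_gt0.
have r0 : 0 < r by rewrite (lt_le_trans _ rl)// invr_gt0.
by rewrite invrK invr_gt0; split=> //; rewrite invf_ple ?posrE.
Qed.

Lemma kinv_gt0 p : G p -> 0 < kinv p.
Proof. by move=> /generatedP[w w0 ->]; case: (kappa_word w0). Qed.

Lemma kappaE p : G p -> kappa p.1 = ((kinv p)^-1)%:E.
Proof. by move=> /generatedP[w w0 ->]; case: (kappa_word w0). Qed.

Let Dl := Delta a lambda alpha phi.

Let Dl_gt0 : 0 < Dl.
Proof. by rewrite /Dl /Delta lt_max powR_gt0// orbT. Qed.

Let W0 m m' : 0 <= W m m'.
Proof. exact: (snow_W_ge0 alpha Dl_gt0). Qed.

Let Ws m m' : W m m' = W m' m.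
Proof. exact: (snow_W_sym X_compact alpha Dl_gt0). Qed.

Let Wt m m' m'' : W m m'' <= W m m' + W m' m''.
Proof. exact: (snow_W_triangle X_compact alpha_gt0 alpha_le1 Dl_gt0). Qed.

Let W_weak (m_ : nat -> prob) m :
  weak_cvg m_ m <-> W (m_ n) m @[n --> \oo] --> (0 : R).
Proof.
split; first exact: (weak_cvg_W X_compact alpha_gt0 Dl_gt0).
exact: (W_weak_cvg X_compact alpha_gt0 Dl_gt0).
Qed.

Let W_same m m' : W m m' = 0 <-> same_integrals m m'.
Proof.
split=> [E f cf|E]; first exact: (W_eq0_integral X_compact alpha_gt0 Dl_gt0 E).
have /W_weak : weak_cvg (fun=> m) m'.
  by move=> f cf; rewrite -(E f cf); exact: cvg_cst.
by move/(cvg_lim (@norm_hausdorff _ _)); rewrite lim_cst.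
Qed.

Let Wxx m : W m m = 0.
Proof. exact/W_same. Qed.

Let same_refl m : same_integrals m m.
Proof. by []. Qed.

Let W_ext m1 m1' m2 m2' : same_integrals m1 m1' -> same_integrals m2 m2' ->
  W m1 m2 = W m1' m2'.
Proof.
move=> /W_same e1 /W_same e2; apply/eqP; rewrite eq_le; apply/andP; split.
  by have := Wt m1 m1' m2; have := Wt m1' m2' m2; rewrite e1 (Ws m2' m2) e2; lra.
by have := Wt m1' m1 m2'; have := Wt m1 m2 m2'; rewrite (Ws m1' m1) e1 e2; lra.
Qed.

Lemma W_cauchy_weak (m_ : nat -> prob) :
  (forall e : R, 0 < e -> exists N, forall n l, (N <= n)%N -> (N <= l)%N ->
    W (m_ n) (m_ l) < e) -> exists m, weak_cvg m_ m.
Proof.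
move=> WC; apply: (weak_limit X_compact) => f cf.
apply/cauchy_cvgP/cauchy_exP => e e0.
have e20 : 0 < e / 2 by rewrite divr_gt0.
have [K K0 KP] := W_integral_continuous X_compact alpha_gt0 Dl_gt0 cf e20.
have d0 : 0 < e / 2 / (K + 1) by rewrite divr_gt0// ltr_wpDl.
have [N NP] := WC _ d0; exists (\int[m_ N]_x f x), N => // n /= Nn.
rewrite /ball/= (le_lt_trans (KP _ _))// [ltRHS]splitr ltrD2l.
have := NP N n (leqnn _) Nn; rewrite ltr_pdivlMr ?ltr_wpDl//; apply: le_lt_trans.
by rewrite mulrC ler_wpM2l ?lerDl// (W0 (m_ N) (m_ n)).
Qed.

(** All that the metric part takes from the dynamics: exponential closeness of the limit measures,
    the identification of equilibrium states with periodic limit measures, and the predicate behind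
    [mu_so] expressed by integrals. The letter [i] provides the nets of [net_count]. *)
Lemma words_close (i : 'I_k) : exists C b : R, [/\ 0 < C, 0 < b < 1 &
  forall s o s' o' n, suffix_word s n = suffix_word s' n ->
    prefix_word o n = prefix_word o' n -> W (mso s o) (mso s' o') <= C * b ^+ n] /\
  (forall w, w != [::] -> exists s o, [/\ suffix_word s (size w) = w,
     prefix_word o (size w) = w & same_integrals (mu (wp w)) (mso s o)]) /\
  (forall s o m, same_integrals m (mso s o) <->
     forall nu (f : X -> R), continuous f ->
       dual_quot g phi (suffix_word s z.1) (prefix_word o z.2) nu f
         @[z --> filter_prod \oo \oo] --> \int[m]_x f x).
Proof.
have [D0 D0P] := phi_holder; pose D := `|D0|.
have D_ge0 : 0 <= D by exact: normr_ge0.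
have phi_hol x y : `|phi x - phi y| <= D * mdist x y `^ alpha.
  by rewrite (le_trans (D0P x y))// ler_wpM2r ?powR_ge0// ler_norm.
(* Below radius 1 the [alpha]-th power of a distance is at most 1, as the distortion estimates
   require. The metric itself keeps the original [a]. *)
pose a1 := Num.min a 1.
have a1_gt0 : 0 < a1 by rewrite lt_min a_gt0 ltr01.
have a1_le1 : a1 <= 1 by rewrite ge_min lexx orbT.
have g_exp j : ruelle_expanding a1 lambda (g j).
  by apply: (ruelle_expanding_le lambda_lt1 lambda_gt0 _ (@g_expanding j)); rewrite ge_min lexx.
have [C [b [C0 b01 CP]]] := mu_so_W X_compact a1_gt0 a1_le1 lambda_gt0 lambda_lt1 alpha_gt0
  alpha_le1 g_surjective (@g_exp) g_mixing D_ge0 phi_hol i Dl_gt0.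
exists C, b; split; first by [].
split=> [w w0|s o m].
  have [s [om so]] := periodic_ends w0; exists s, om.
  have [E1 E2] := so 1%N; rewrite mul1n wpow1 in E1 E2; split=> //.
  exact: (equilibrium_mu_so X_compact a1_gt0 a1_le1 lambda_gt0 lambda_lt1 alpha_gt0
    alpha_le1 g_continuous g_surjective (@g_exp) g_mixing D_ge0 phi_hol w0 so).
split=> H.
  exact: ((mu_so_spec X_compact a1_gt0 a1_le1 lambda_gt0 lambda_lt1 alpha_gt0
    alpha_le1 g_surjective (@g_exp) g_mixing D_ge0 phi_hol s o).2 m H).
exact: (mu_so_unique X_compact a1_gt0 a1_le1 lambda_gt0 lambda_lt1 alpha_gt0
    alpha_le1 g_surjective (@g_exp) g_mixing D_ge0 phi_hol H).
Qed.

Lemma W_words : exists C b : R, [/\ 0 < C, 0 < b < 1 & forall (v w : seq 'I_k) n,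
  v != [::] -> w != [::] -> common n v w -> common n (rev v) (rev w) ->
  W (mu (wp v)) (mu (wp w)) <= C * b ^+ n].
Proof.
have [i|k0] := pickP (@predT 'I_k); last first.
  exists 1, 2^-1; split=> //; first by rewrite invr_gt0 invf_lt1 ?ltr1n ?ltr0n.
  by move=> [|j v] w n // _; have := k0 j.
move=> _; have [C [b [[C0 b01 CP] [per _]]]] := words_close i.
exists C, b; split=> // v w n v0 w0 [nv nw vw] [_ _ rvw].
have [s [om [sv ov Ev]]] := per v v0; have [s' [om' [sw ow Ew]]] := per w w0.
rewrite (W_ext Ev Ew); apply: CP.
- have E t z : (n <= size z)%N -> suffix_word t (size z) = z ->
      suffix_word t n = rev (take n (rev z)).
    move=> nz <-; rewrite /suffix_word revK; congr rev.
    by rewrite -map_take take_iota; case: ltngtP nz => // ->.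
  by rewrite (E _ s v)// (E _ s' w)// rvw.
- have E t z : (n <= size z)%N -> prefix_word t (size z) = z ->
      prefix_word t n = take n z.
    move=> nz <-; rewrite /prefix_word -map_take take_iota.
    by case: ltngtP nz => // ->.
  by rewrite (E _ om v)// (E _ om' w)// vw.
Qed.

Lemma dG_eq p : dG p p = 0.
Proof. by rewrite /pair_dist; case: asboolP. Qed.

Lemma dG_neq p q : p <> q -> dG p q = W (mu p) (mu q) + kinv p + kinv q.
Proof. by rewrite /pair_dist; case: asboolP. Qed.

Lemma dG_le p q : G p -> G q -> dG p q <= W (mu p) (mu q) + kinv p + kinv q.
Proof.
move=> /kinv_gt0 p0 /kinv_gt0 q0; have [->|/dG_neq ->//] := pselect (p = q).
by rewrite dG_eq Wxx add0r addr_ge0// ltW.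
Qed.

Lemma W_le_dG p q : G p -> G q -> W (mu p) (mu q) <= dG p q.
Proof.
move=> /kinv_gt0 p0 /kinv_gt0 q0; have [->|/dG_neq ->] := pselect (p = q).
  by rewrite dG_eq Wxx.
by rewrite -addrA lerDl addr_ge0// ltW.
Qed.

Lemma dG_ge0 p q : G p -> G q -> 0 <= dG p q.
Proof. by move=> Gp Gq; exact: le_trans (W_le_dG Gp Gq). Qed.

Lemma dG_ge p q : G p -> G q -> p <> q -> kinv p < dG p q.
Proof.
move=> Gp Gq /dG_neq ->; have := W0 (mu p) (mu q); have := kinv_gt0 Gq.
by move=> ? ?; lra.
Qed.

Lemma dG_sym p q : G p -> G q -> dG p q = dG q p.
Proof.
move=> Gp Gq; have [->//|pq] := pselect (p = q).
by rewrite !dG_neq// 1?Ws 1?addrAC//; exact: nesym.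
Qed.

Lemma dG_triangle p q r : G p -> G q -> G r -> dG p r <= dG p q + dG q r.
Proof.
move=> Gp Gq Gr; have p0 := ltW (kinv_gt0 Gp).
have q0 := ltW (kinv_gt0 Gq); have r0 := ltW (kinv_gt0 Gr).
have [->|pq] := pselect (p = q); first by rewrite dG_eq add0r.
have [->|qr] := pselect (q = r); first by rewrite dG_eq addr0.
apply: (le_trans (dG_le Gp Gr)); rewrite (dG_neq pq) (dG_neq qr).
move: (Wt (mu p) (mu q) (mu r)) p0 q0 r0.
move: (W _ _) (W _ _) (W _ _) (kinv p) (kinv q) (kinv r) => t1 t2 t3 kp kq kr.
by move=> *; lra.
Qed.

Lemma dG_metric : is_metric_on G dG.
Proof.
split; [exact: dG_ge0| |exact: dG_sym|exact: dG_triangle].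
move=> p q Gp Gq; split=> [d0|->]; last exact: dG_eq.
apply: contrapT => pq; have := dG_ge Gp Gq pq.
by rewrite d0 ltNge (ltW (kinv_gt0 Gp)).
Qed.

Lemma dG_discrete : is_discrete_on G dG.
Proof.
move=> p Gp; exists (kinv p); first exact: kinv_gt0.
move=> q Gq pq; apply: contrapT => /nesym /(dG_ge Gp Gq).
by rewrite ltNge (ltW pq).
Qed.

Lemma word_pair_holder : exists C gamma : R, [/\ 0 < gamma, gamma <= 1 &
  forall v w : seq 'I_k, v != [::] -> w != [::] ->
    dG (wp v) (wp w) <= C * word_dist R v w `^ gamma].
Proof.
have [C [b [C0 /andP[b0 b1] CP]]] := W_words.
(* A common rate: [b] for the Wasserstein part, [lambda] for the two inverse expansion constants,
   and 1/2 to ensure that the exponent [gam] is at most 1. *)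
pose c := Num.max 2^-1 (Num.max b lambda).
have half0 : 0 < 2^-1 :> R by rewrite invr_gt0.
have half1 : 2^-1 < 1 :> R by rewrite invf_lt1// ltr1n.
have c2 : 2^-1 <= c by rewrite le_max lexx.
have cb : b <= c by rewrite !le_max lexx orbT.
have cl : lambda <= c by rewrite !le_max lexx !orbT.
have c1 : c < 1 by rewrite !gt_max half1 b1 lambda_lt1.
have c0 : 0 < c by exact: lt_le_trans c2.
have ln2 : ln 2^-1 < 0 :> R by rewrite ln_lt0// half0.
pose gam := ln c / ln 2^-1.
have gam0 : 0 < gam by rewrite ltr_ndivlMr// mul0r ln_lt0// c0.
have gam1 : gam <= 1 by rewrite ler_ndivrMr// mul1r ler_ln ?posrE.
have cE : c = 2^-1 `^ gam.
  by rewrite /powR gt_eqF// /gam divfK ?lt_eqF// lnK ?posrE.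
(* [C] for the Wasserstein part and 1 for each inverse expansion constant; the division by [c]
   arises because [common_ends] bounds the word distance below by the power [n.+1] of 1/2, not
   [n]. *)
exists ((C + 2) / c), gam; split=> // v w v0 w0.
have [->|vw] := eqVneq v w.
  by rewrite dG_eq mulr_ge0 ?powR_ge0// divr_ge0 ?(ltW c0)// addr_ge0// ltW.
have [n [cvw crvw dn]] := @common_ends R _ _ _ vw.
have pow_le (t : R) : 0 < t -> t <= c -> t ^+ n <= c ^+ n.
  by move=> t0 tc; rewrite lerXn2r// nnegrE ltW.
have kl z : z != [::] -> (n <= size z)%N -> kinv (wp z) <= c ^+ n.
  move=> z0 nz; have [_ _ h] := kappa_word z0; rewrite (le_trans h)//.
  rewrite (le_trans _ (pow_le _ lambda_gt0 cl))//.
  by rewrite ler_wiXn2l// ltW.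
have Gv : G (wp v) by apply/generatedP; exists v.
have Gw : G (wp w) by apply/generatedP; exists w.
apply: (@le_trans _ _ ((C + 2) * c ^+ n)).
  rewrite (le_trans (dG_le Gv Gw))//.
  have h1 : W (mu (wp v)) (mu (wp w)) <= C * c ^+ n.
    rewrite (le_trans (CP v w n v0 w0 cvw crvw))// ler_wpM2l ?(ltW C0)//.
    exact: pow_le.
  have h2 : kinv (wp v) <= c ^+ n by apply: kl => //; case: cvw.
  have h3 : kinv (wp w) <= c ^+ n by apply: kl => //; case: cvw.
  have -> : (C + 2) * c ^+ n = C * c ^+ n + c ^+ n + c ^+ n by ring.
  by rewrite !lerD.
rewrite -mulrA ler_wpM2l ?addr_ge0 ?(ltW C0)// ler_pdivlMl//.
have -> : c * c ^+ n = (2^-1 ^+ n.+1) `^ gam.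
  rewrite -exprS {1}cE -powR_mulrn ?powR_ge0// powRAC powR_mulrn//.
by rewrite ge0_ler_powR ?(ltW gam0)// nnegrE ?exprn_ge0 ?(ltW half0)//
  (le_trans _ dn)// exprn_ge0 ?(ltW half0).
Qed.

Definition vanishing u := forall e : R, 0 < e -> exists N, forall n, (N <= n)%N -> kinv (u n) < e.

Lemma kappa_vanishing u : (forall n, G (u n)) ->
  kappa (u n).1 @[n --> \oo] --> +oo%E <-> vanishing u.
Proof.
move=> Gu; rewrite (_ : (fun n => kappa (u n).1) = fun n => ((kinv (u n))^-1)%:E); last first.
  by apply/funext => n; exact: kappaE.
have k0 n := kinv_gt0 (Gu n).
split=> [/cvgeyPgt H e e0|H].
  have [N _ NP] := H e^-1; exists N => n /NP /=.
  by rewrite lte_fin ltf_pV2 ?posrE.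
apply/cvgeyPgt => A; have [|N NP] := H (`|A| + 1)^-1.
  by rewrite invr_gt0 ltr_wpDl.
exists N => // n /NP /= kA; rewrite lte_fin (@lt_trans _ _ (`|A| + 1))//.
  by rewrite (le_lt_trans (ler_norm _))// ltrDl.
by rewrite -[ltLHS]invrK ltf_pV2 ?posrE// invr_gt0 ltr_wpDl.
Qed.

Lemma vanishing_cvg u : (forall n, G (u n)) ->
  vanishing u <-> kinv (u n) @[n --> \oo] --> (0 : R).
Proof.
move=> Gu; split=> [H|/cvg_seqP H e e0].
  apply/cvg_seqP => e /H[N NP]; exists N => n /NP.
  by rewrite subr0 gtr0_norm// kinv_gt0.
have [N NP] := H e e0; exists N => n /NP.
by rewrite subr0 gtr0_norm// kinv_gt0.
Qed.

Let Cau := is_cauchy_in G dG.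

(** After every index [n] some later element differs from [u n], and their distance exceeds
    [kinv (u n)]; the Cauchy property therefore forces these numbers to 0. As [W] is below the
    metric, the equilibrium states form a Cauchy sequence as well. *)
Lemma cauchy_limit u : Cau u -> ~ eventually_constant u ->
  vanishing u /\ exists m, weak_cvg (mu \o u) m.
Proof.
move=> [Gu uC] nc; split.
  move=> e e0; have [N NP] := uC e e0; exists N => n Nn.
  have [l nl ul] : exists2 l, (n <= l)%N & u n <> u l.
    apply: contrapT => H; apply: nc; exists n => l nl.
    by apply: contrapT => ul; apply: H; exists l => //; exact: nesym.
  by apply: lt_trans (dG_ge (Gu n) (Gu l) ul) _; apply: NP => //; exact: leq_trans nl.
apply: W_cauchy_weak => e /uC[N NP]; exists N => n l Nn Nl.
exact: le_lt_trans (W_le_dG (Gu n) (Gu l)) (NP _ _ Nn Nl).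
Qed.

Lemma limit_cauchy u m : (forall n, G (u n)) -> vanishing u ->
  weak_cvg (mu \o u) m -> Cau u /\ ~ eventually_constant u.
Proof.
move=> Gu kv /W_weak/cvg_seqP Wm; split; last first.
  (* Along an eventually constant sequence [kinv] would stay at a positive value. *)
  move=> [N NP]; have [M MP] := kv _ (kinv_gt0 (Gu N)).
  by have := MP (maxn N M) (leq_maxr _ _); rewrite NP ?leq_maxl// ltxx.
split=> // e e0; have e40 : 0 < e / 4 by rewrite divr_gt0.
have [N NP] := kv _ e40; have [M MP] := Wm _ e40.
exists (maxn N M) => n l; rewrite !geq_max => /andP[Nn Mn] /andP[Nl Ml].
rewrite (le_lt_trans (dG_le (Gu n) (Gu l)))//.
have h3 := MP n Mn; rewrite subr0 (ger0_norm (W0 _ _)) in h3.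
have h4 := MP l Ml; rewrite subr0 (ger0_norm (W0 _ _)) in h4.
have h5 := Wt (mu (u n)) m (mu (u l)); rewrite (Ws m (mu (u l))) in h5.
move: (NP n Nn) (NP l Nl) h3 h4 h5 => /=.
move: (W _ _) (W _ _) (W _ _) (kinv _) (kinv _) => t1 t2 t3 k1 k2.
by move=> *; lra.
Qed.

Lemma weak_dist0 u v m : (forall n, G (u n)) -> (forall n, G (v n)) ->
  weak_cvg (mu \o u) m -> dG (u n) (v n) @[n --> \oo] --> (0 : R) ->
  weak_cvg (mu \o v) m.
Proof.
move=> Gu Gv /W_weak Wm duv; apply/W_weak.
apply: (@cvg0_le _ _ (fun n => dG (u n) (v n) + W (mu (u n)) m)) => [n|].
  rewrite W0/= (le_trans (Wt _ (mu (u n)) _))// lerD2r Ws.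
  exact: W_le_dG.
by rewrite -(addr0 0); apply: cvgD.
Qed.

(** The elements may coincide for some [n], where the distance is 0 by definition. The two bounds
    [dG_le] and [W_le_dG] also hold there and enclose the distance between quantities with the same
    limit. *)
Lemma dist_cvg u v m m' : (forall n, G (u n)) -> (forall n, G (v n)) ->
  vanishing u -> vanishing v -> weak_cvg (mu \o u) m -> weak_cvg (mu \o v) m' ->
  dG (u n) (v n) @[n --> \oo] --> W m m'.
Proof.
move=> Gu Gv /(vanishing_cvg Gu) ku /(vanishing_cvg Gv) kv /W_weak Wu /W_weak Wv.
have : (fun n => (W (mu (u n)) m + W (mu (v n)) m') + (kinv (u n) + kinv (v n)))
    @ \oo --> (0 : R).
  have z : 0 = (0 + 0) + (0 + 0) :> R by rewrite !addr0.
  by rewrite z; apply: cvgD; apply: cvgD.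
move=> /cvg_seqP H; apply/cvg_seqP => e e0.
have [N NP] := H e e0; exists N => n Nn.
have := NP n Nn; rewrite subr0 => h; apply: (le_lt_trans _ (le_lt_trans (ler_norm _) h)); move=> {h}.
have h1 := dG_le (Gu n) (Gv n); have h2 := W_le_dG (Gu n) (Gv n).
have h3 := Wt (mu (u n)) m (mu (v n)); have h4 := Wt m m' (mu (v n)).
have h5 := Wt m (mu (u n)) m'; have h6 := Wt (mu (u n)) (mu (v n)) m'.
have h7 := kinv_gt0 (Gu n); have h8 := kinv_gt0 (Gv n).
rewrite (Ws m' (mu (v n))) in h4; rewrite (Ws m (mu (u n))) in h5.
rewrite ler_norml; move: h1 h2 h3 h4 h5 h6 h7 h8.
move: (dG _ _) (W (mu (u n)) (mu (v n))) (W (mu (u n)) m) (W (mu (v n)) m') (W m m')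
  (W m (mu (v n))) (W (mu (u n)) m') (kinv _) (kinv _) => t0 t1 t2 t3 t4 t5 t6 k1 k2.
by move=> *; apply/andP; split; lra.
Qed.

Lemma limit_class_eq u v : Cau u -> Cau v -> dG (u n) (v n) @[n --> \oo] --> (0 : R) ->
  limit_class G dG u = limit_class G dG v.
Proof.
have H (u' v' : nat -> pair) : Cau u' -> Cau v' ->
    dG (u' n) (v' n) @[n --> \oo] --> (0 : R) ->
    limit_class G dG u' `<=` limit_class G dG v'.
  move=> [Gu _] [Gv _] duv t [tC dut]; split=> //; have [Gt _] := tC.
  apply: (@cvg0_le _ _ (fun n => dG (u' n) (v' n) + dG (u' n) (t n))) => [n|].
    by rewrite dG_ge0//= (dG_sym (Gu n) (Gv n)) dG_triangle.
  by rewrite -(addr0 0); apply: cvgD.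
move=> Cu Cv duv; apply/seteqP; split; first exact: H.
apply: H => //; rewrite (_ : (fun n => _) = fun n => dG (u n) (v n))//.
by apply/funext => n; rewrite dG_sym//; [case: Cv|case: Cu].
Qed.

Lemma limit_class_refl u : Cau u -> limit_class G dG u u.
Proof.
move=> Cu; split=> //; rewrite (_ : (fun n => _) = fun=> 0); first exact: cvg_cst.
by apply/funext => n; rewrite dG_eq.
Qed.

Lemma cst_cauchy p : G p -> Cau (fun=> p).
Proof. by move=> Gp; split=> // e e0; exists 0%N => *; rewrite dG_eq. Qed.

Let bd := completion_boundary G dG.

Lemma boundary_mem C u : bd C -> C u ->
  [/\ Cau u, ~ eventually_constant u & C = limit_class G dG u].
Proof.
move=> [[u0 Cu0 <-] nC] [Cu d0u].
have E := limit_class_eq Cu0 Cu d0u; split=> // -[N NP].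
have GN : G (u N) by case: Cu.
have E' : limit_class G dG (fun=> u N) = limit_class G dG u.
  apply: limit_class_eq; [exact: cst_cauchy|exact: Cu|].
  apply/cvg_seqP => e e0; exists N => n Nn.
  by rewrite (NP n Nn) dG_eq subrr normr0.
apply: nC; exists (u N); [exact: GN|exact: (etrans E' (esym E))].
Qed.

Lemma boundary_ex C : bd C -> exists u, C u.
Proof. by move=> [[u Cu <-] _]; exists u; exact: limit_class_refl. Qed.

(** A sequence tending to an element [p] of the semigroup eventually enters the ball of radius
    [kinv p], whose only point is [p], and so becomes constant. *)
Lemma boundary_class u : Cau u -> ~ eventually_constant u -> bd (limit_class G dG u).
Proof.
move=> Cu nc; split; first by exists u.
move=> [p Gp E]; apply: nc; have := limit_class_refl Cu; rewrite -E => -[_].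
move=> /cvg_seqP /(_ _ (kinv_gt0 Gp))[N NP]; have [Gu _] := Cu.
have up n : (N <= n)%N -> u n = p.
  move=> /NP; rewrite subr0 (ger0_norm (dG_ge0 Gp (Gu n))) => pu.
  by apply: contrapT => /nesym /(dG_ge Gp (Gu n)); rewrite ltNge (ltW pu).
by exists N => n Nn; rewrite (up n Nn) (up N (leqnn N)).
Qed.

(** [limit_state] is picked along some representative of the class. The distance between two
    representatives tends to 0 and dominates [W], so the same weak limit serves all of them. *)
Lemma limit_state_cvg C u : bd C -> C u -> weak_cvg (mu \o u) (limit_state C).
Proof.
move=> bC Cu; have [[Gu uC] nc E] := boundary_mem bC Cu.
have [_ [m um]] := cauchy_limit (conj Gu uC) nc.
rewrite /limit_state; case: xgetP => [m' _ [v Cv vm']|/(_ m)]; last first.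
  by case; exists u.
have [[Gv _] _ Ev] := boundary_mem bC Cv.
apply: (weak_dist0 Gv Gu vm'); move: Cu; rewrite Ev => -[_].
exact.
Qed.

(** Both measures are [get] of a predicate. If one pair of candidates has the same integrals, then
    each predicate says exactly that a measure has these integrals; the predicates are equal as
    sets, and so are the picked measures. *)
Lemma limit_state_so C m s o : bd C -> same_integrals (limit_state C) (mso s o) ->
  limit_state C = mso s o.
Proof.
move=> bC E; have [u Cu] := boundary_ex bC.
have i : 'I_k := s 0%N.
have [C' [b [_ [_ spec]]]] := words_close i.
rewrite {1}/limit_state /mso /mu_so; congr (get _).
apply/seteqP; split=> m' /=.
  move=> [v Cv vm']; apply/spec => f cf; rewrite -E//.
  exact: (weak_cvg_same vm' (limit_state_cvg bC Cv)).
move=> /spec Em'; exists u => //.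
apply: (weak_cvg_ext (limit_state_cvg bC Cu)) => // f cf.
by rewrite E// Em'.
Qed.

Lemma limit_state_mem C : bd C -> mu_so_set g phi (limit_state C).
Proof.
move=> bC; have [u Cu] := boundary_ex bC.
have [[Gu uC] nc E] := boundary_mem bC Cu.
have /choice[w wP] : forall n, exists w, w != [::] /\ u n = wp w.
  by move=> n; have /generatedP[w w0 ->] := Gu n; exists w.
have [i _] : exists i : 'I_k, True by case: (w 0%N) (wP 0%N) => [[]//|i ? _]; exists i.
have [C' [b [[C0 b01 CP] [per spec]]]] := words_close i.
(* The left and right periodic words are coded as one sequence of pairs of letters, so that a single
   subsequence argument handles both sides of the junction. *)
have /choice[t tP] : forall n, exists t : nat -> 'I_k * 'I_k,
    same_integrals (mu (u n)) (mso (fun j => (t j).1) (fun j => (t j).2)).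
  move=> n; have [w0 ->] := wP n; have [s [om [_ _ H]]] := per _ w0.
  by exists (fun j => (s j, om j)).
have [tau tauP] := konig t.
exists (fun j => (tau j).1), (fun j => (tau j).2); apply: limit_state_so => //.
  exact: (limit_state C).
have /W_weak/cvg_seqP Wl := limit_state_cvg bC Cu.
apply/W_same/eqP; rewrite eq_le W0 andbT; apply/ler_addgt0Pr => e e0; rewrite add0r.
have e20 : 0 < e / 2 by rewrite divr_gt0.
have [N NP] := Wl _ e20.
have /andP[b0 b1] := b01.
have : C' * b ^+ n @[n --> \oo] --> (0 : R).
  by rewrite -(mulr0 C'); apply: cvgM; [exact: cvg_cst|apply: cvg_expr; rewrite gtr0_norm].
move=> /cvg_seqP /(_ _ e20)[L /(_ L (leqnn L))]; rewrite subr0 => bL.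
have [n Nn tn] := tauP L N.
have := NP n Nn; rewrite subr0 ger0_norm ?W0//= => h1.
have h2 : W (mso (fun j => (t n j).1) (fun j => (t n j).2))
    (mso (fun j => (tau j).1) (fun j => (tau j).2)) <= C' * b ^+ L.
  apply: CP.
    congr rev; apply/eq_in_map => j; rewrite mem_iota add0n /= => jL.
    by rewrite tn.
  apply/eq_in_map => j; rewrite mem_iota add0n /= => jL.
  by rewrite tn.
apply: (le_trans (Wt _ (mu (u n)) _)); rewrite Ws [leRHS]splitr; apply: lerD; first exact: ltW.
by rewrite (W_ext (tP n) (same_refl _)) (le_trans h2)// ltW// (le_lt_trans (ler_norm _)).
Qed.

(** The two sides are in fact equal: along representatives the inverse expansion constants vanish,
    and the distance tends to [W] of the limit states. *)
Lemma limit_state_lipschitz C D : bd C -> bd D ->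
  W (limit_state C) (limit_state D) <= completion_dist dG C D.
Proof.
move=> bC bD; have lim u v : C u -> D v ->
    dG (u n) (v n) @[n --> \oo] --> W (limit_state C) (limit_state D).
  move=> Cu Dv; have [uC nu _] := boundary_mem bC Cu; have [vC nv _] := boundary_mem bD Dv.
  apply: dist_cvg; [by case: uC|by case: vC|exact: (cauchy_limit uC nu).1|
    exact: (cauchy_limit vC nv).1|exact: limit_state_cvg|exact: limit_state_cvg].
have [u Cu] := boundary_ex bC; have [v Dv] := boundary_ex bD.
rewrite /completion_dist; case: xgetP => [r _ [u' [v' [Cu' Dv' dr]]]|/(_ (W (limit_state C) (limit_state D)))]; last first.
  by case; exists u, v; split=> //; exact: lim.
by rewrite (@cvg_unique _ (@norm_hausdorff _ _)
  ((fun n => dG (u' n) (v' n)) @ \oo) _ _ _ (lim _ _ Cu' Dv') dr).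
Qed.

Lemma limit_state_onto m : mu_so_set g phi m -> exists2 C, bd C & limit_state C = m.
Proof.
move=> [s [om ->]]; have i : 'I_k := s 0%N.
have [C' [b [[C0 /andP[b0 b1] CP] [per spec]]]] := words_close i.
(* The periodic repetition of this word begins with the prefix of [om] to the right of the junction
   and ends with the suffix of [s] to its left. The shift [n.+1] keeps it nonempty. *)
pose w n := prefix_word om n.+1 ++ suffix_word s n.+1.
have szw n : size (w n) = (n.+1 + n.+1)%N by rewrite size_cat size_rev !size_mkseq.
have w0 n : w n != [::] by rewrite -size_eq0 szw.
pose u n := wp (w n).
have Gu n : G (u n) by apply/generatedP; exists (w n).
have kv : vanishing u.
  apply/(vanishing_cvg Gu); apply: (@cvg0_le _ _ (fun n => lambda ^+ n)) => [n|].
    rewrite (ltW (kinv_gt0 (Gu n)))/=; have [_ _ h] := kappa_word (w0 n).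
    rewrite (le_trans h)// szw ler_wiXn2l ?(ltW lambda_gt0) ?(ltW lambda_lt1)//.
    by rewrite addSn (leq_trans (leq_addr n.+1 n)).
  by apply: cvg_expr; rewrite gtr0_norm.
have um : weak_cvg (mu \o u) (mso s om).
  apply/W_weak; apply: (@cvg0_le _ _ (fun n => C' * b ^+ n.+1)) => [n|]; last first.
    have c0 : C' * b ^+ n @[n --> \oo] --> (0 : R).
      by rewrite -(mulr0 C'); apply: cvgM; [exact: cvg_cst|apply: cvg_expr; rewrite gtr0_norm].
    by rewrite (@cvg_shiftS _ (fun n => C' * b ^+ n)).
  rewrite W0/=; have [s' [om' [sw ow Ew]]] := per _ (w0 n).
  rewrite (W_ext Ew (same_refl _)); apply: CP.
    have : rev (suffix_word s' (size (w n))) = rev (w n) by rewrite sw.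
    rewrite szw /w rev_cat /suffix_word !revK mkseq_add => /eqP.
    by rewrite eqseq_cat ?size_mkseq// => /andP[/eqP ->].
  move: ow; rewrite szw /prefix_word mkseq_add /w => /eqP.
  by rewrite eqseq_cat ?size_mkseq// => /andP[/eqP ->].
have [uC nc] := limit_cauchy Gu kv um.
have bC := boundary_class uC nc; exists (limit_class G dG u) => //.
apply: limit_state_so => //.
apply: (weak_cvg_same _ um); apply: limit_state_cvg => //.
exact: limit_class_refl.
Qed.

Lemma cauchyP u : (forall n, G (u n)) ->
  (Cau u /\ ~ eventually_constant u <->
   kappa (u n).1 @[n --> \oo] --> +oo%E /\ exists m, weak_cvg (mu \o u) m).
Proof.
move=> Gu; split=> [[uC nc]|[/(kappa_vanishing Gu) kv [m um]]].
  by have [kv um] := cauchy_limit uC nc; split=> //; exact/kappa_vanishing.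
exact: limit_cauchy um.
Qed.

Lemma same_limitP u v : Cau u -> ~ eventually_constant u ->
  Cau v -> ~ eventually_constant v ->
  (limit_class G dG u = limit_class G dG v <->
   exists m, weak_cvg (mu \o u) m /\ weak_cvg (mu \o v) m).
Proof.
move=> uC nu vC nv; have [ku [m um]] := cauchy_limit uC nu.
have [kv _] := cauchy_limit vC nv; have [Gu _] := uC; have [Gv _] := vC.
split=> [E|[m' [um' vm']]].
  exists m; split; first exact: um.
  apply: (weak_dist0 Gu Gv um); have := limit_class_refl vC; rewrite -E => -[_].
  exact.
apply: (limit_class_eq uC vC); have := dist_cvg Gu Gv ku kv um' vm'.
by rewrite Wxx.
Qed.

End semigroup.

(** The semigroup is generated without an identity, hence the words in (2) are nonempty. In a
    discrete space an eventually constant sequence is Cauchy although [kappa] does not tend to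
    infinity along it; such sequences converge inside the semigroup, and (3) concerns the others,
    which are the ones that define boundary points. *)
Theorem proposition8p5 (R : realType) (X : pmetricType R) (k : nat)
    (g : 'I_k -> X -> X) (phi : X -> R) (a lambda alpha : R)
    (X_compact : compact [set: X])
    (a_gt0 : 0 < a) (lambda_gt0 : 0 < lambda) (lambda_lt1 : lambda < 1)
    (alpha_gt0 : 0 < alpha) (alpha_le1 : alpha <= 1)
    (g_continuous : forall i, continuous (g i))
    (g_surjective : forall i y, exists x, g i x = y)
    (g_expanding : forall i, ruelle_expanding a lambda (g i))
    (g_mixing : jointly_mixing g)
    (phi_holder : holder alpha phi)
    (kappa_finite : forall p, generated g phi p -> (kappa p.1 < +oo)%E) :
  let G := generated g phi in
  let dG := pair_dist a lambda alpha phi in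
  let dW := @word_dist k R in
  (* (1) *)
  [/\ [/\ is_metric_on setT dW, is_discrete_on setT dW,
          is_metric_on G dG & is_discrete_on G dG],
  (* (2) *)
      (forall w, w != [::] -> G (word_pair g phi w)) /\
      (exists C gamma : R, [/\ 0 < gamma, gamma <= 1 &
         forall v w, v != [::] -> w != [::] ->
           dG (word_pair g phi v) (word_pair g phi w) <=
             C * dW v w `^ gamma]),
  (* (3) *)
      (forall u, (forall n, G (u n)) ->
         (is_cauchy_in G dG u /\ ~ eventually_constant u <->
          kappa (u n).1 @[n --> \oo] --> +oo%E /\
          exists m, weak_cvg (equilibrium_state \o u) m)) /\
      (forall u v,
         is_cauchy_in G dG u -> ~ eventually_constant u ->
         is_cauchy_in G dG v -> ~ eventually_constant v ->
         (limit_class G dG u = limit_class G dG v <->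
          exists m, weak_cvg (equilibrium_state \o u) m /\
                    weak_cvg (equilibrium_state \o v) m)) &
  (* (4) *)
      let bd := completion_boundary G dG in
      [/\ forall C u, bd C -> C u ->
            weak_cvg (equilibrium_state \o u) (limit_state C),
          forall C, bd C -> mu_so_set g phi (limit_state C),
          exists L : R, forall C D, bd C -> bd D ->
            Wbar a lambda alpha phi (limit_state C) (limit_state D) <=
              L * completion_dist dG C D &
          forall m, mu_so_set g phi m ->
            exists2 C, bd C & limit_state C = m]].
Proof.
move=> G dG dW.
pose dGm := dG_metric X_compact a_gt0 lambda_gt0 alpha_gt0 alpha_le1 g_continuous
  (@g_expanding) kappa_finite.
split.
- split; [exact: word_dist_metric|exact: word_dist_discrete|exact: dGm|].
  exact: (dG_discrete alpha X_compact a_gt0 lambda_gt0 g_continuous (@g_expanding) kappa_finite).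
- split; first by move=> w w0; apply/generatedP; exists w.
  exact: word_pair_holder.
- split=> [u Gu|u v uC nu vC nv].
    exact: (cauchyP X_compact a_gt0 lambda_gt0 alpha_gt0 alpha_le1 g_continuous
      (@g_expanding) kappa_finite Gu).
  exact: (same_limitP X_compact a_gt0 lambda_gt0 alpha_gt0 alpha_le1 g_continuous
    (@g_expanding) kappa_finite uC nu vC nv).
- split.
  + move=> C u; exact: (limit_state_cvg X_compact a_gt0 lambda_gt0 alpha_gt0 alpha_le1
      g_continuous (@g_expanding) kappa_finite).
  + move=> C; exact: limit_state_mem.
  + exists 1 => C D bC bD; rewrite mul1r.
    exact: (limit_state_lipschitz X_compact a_gt0 lambda_gt0 alpha_gt0 alpha_le1
      g_continuous (@g_expanding) kappa_finite bC bD).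
  + move=> m; exact: (limit_state_onto X_compact a_gt0 lambda_gt0 lambda_lt1 alpha_gt0
      alpha_le1 g_continuous g_surjective (@g_expanding) g_mixing phi_holder kappa_finite).
Qed.
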